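(* Let $X$ be a $K$-regular (i.e. $K$-ary) rooted tree with $K\ge 2$, and let $\Phi(t)=t^p\log^{\lambda_1}(e+t)$ with either $p>1$ and $\lambda_1\in\mathbb{R}$, or $p=1$ and $\lambda_1\ge 0$. Fix $\lambda_2\in\mathbb{R}$ and let $\mu_{\lambda_2}$ be the weighted measure on $X$ given by $d\mu_{\lambda_2}(x)=e^{-\beta|x|}(|x|+C)^{\lambda_2}\,d|x|$. Assume that $p>(\beta-\log K)/\epsilon>0$. Then the trace space of the Orlicz-Sobolev space $N^{1,\Phi}(X,\mu_{\lambda_2})$ is the Orlicz-Besov space $\mathcal{B}^{\theta,\lambda_2}_{\Phi}(\partial X)$, where $\theta=1-\frac{\beta-\log K}{\epsilon p}$. That is, there exist a bounded linear operator $T:N^{1,\Phi}(X,\mu_{\lambda_2})\to \mathcal{B}^{\theta,\lambda_2}_{\Phi}(\partial X)$ and a bounded linear extension operator $E:\mathcal{B}^{\theta,\lambda_2}_{\Phi}(\partial X)\to N^{1,\Phi}(X,\mu_{\lambda_2})$ such that $T\circ E=\mathrm{Id}$ on $\mathcal{B}^{\theta,\lambda_2}_{\Phi}(\partial X)$.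
   Context: **Tree.** A $K$-regular (or $K$-ary) tree $X$ is the union of the vertices and edges of a rooted tree with root $0$ in which every vertex has exactly $K$ children; each edge is an isometric copy of the unit interval. For $x\in X$, $|x|$ is the length of the geodesic from $0$ to $x$, and $[x,y]$ denotes the geodesic between $x$ and $y$. Fix $\epsilon>0$ and define the metric $d_X(x,y)=\int_{[x,y]}e^{-\epsilon|z|}\,d|z|$, where $d|z|$ is the natural measure giving each edge Lebesgue measure $1$. **Boundary.** $\partial X$ is the boundary obtained by completing $X$ with respect to $d_X$. Points $\xi\in\partial X$ are identified with infinite geodesics $[0,\xi)$ starting at the root. If the geodesics of $\xi\neq\zeta$ share exactly their vertices of levels $0,\dots,k$, then $d_X(\xi,\zeta)=\frac{2}{\epsilon}e^{-\epsilon k}$. $\partial X$ is equipped with an Ahlfors $Q$-regular Borel measure $\nu$, $Q=\log K/\epsilon$: $\nu(B_{\partial X}(\xi,r))\approx r^Q$ for all $\xi\in\partial X$, $0<r\le\operatorname{diam}\partial X$. Function spaces such as $L^1(\partial X)$, $L^p(\partial X)$, $L^\Phi(\partial X)$ are with respect to $\nu$. **Measure on $X$.** $d\mu_{\lambda_2}(x)=e^{-\beta|x|}(|x|+C)^{\lambda_2}\,d|x|$, where $\beta>\log K$ and $C\ge\max\{2|\lambda_2|/(\beta-\log K),\,2(\log 4)/\epsilon\}$ are fixed constants. **Orlicz spaces.** $\log^{\lambda_1}(e+t)$ means $(\log(e+t))^{\lambda_1}$. For a measure space $(Y,m)$, $L^\Phi(Y,m)$ is the space of (a.e. equivalence classes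 of) measurable $u:Y\to\mathbb{R}$ with $\int_Y\Phi(\alpha|u|)\,dm<\infty$ for some $\alpha>0$, with Luxemburg norm $\|u\|_{L^\Phi(Y,m)}=\inf\{k>0:\int_Y\Phi(|u|/k)\,dm\le 1\}$. **Orlicz-Sobolev space.** A Borel function $g:X\to[0,\infty]$ is an upper gradient of $u\in L^1_{\rm loc}(X,\mu_{\lambda_2})$ if $|u(z)-u(y)|\le\int_\gamma g\,ds_X$ whenever $z,y\in X$ and $\gamma$ is the geodesic from $z$ to $y$, where $ds_X$ is arc length with respect to $d_X$. $N^{1,\Phi}(X,\mu_{\lambda_2})$ is the collection of all $u$ for which $\|u\|_{N^{1,\Phi}(X,\mu_{\lambda_2})}=\|u\|_{L^\Phi(X,\mu_{\lambda_2})}+\inf_g\|g\|_{L^\Phi(X,\mu_{\lambda_2})}$ is finite, the infimum being over all upper gradients $g$ of $u$. **Dyadic decomposition.** For a vertex $x$, $I_x=\{\xi\in\partial X:\ [0,\xi)\text{ passes through }x\}$. $\mathscr{Q}_n=\{I_x: x\text{ a vertex},\ |x|=n\}$ for $n\in\mathbb{N}$ (including $n=0$, with $\mathscr{Q}_0=\{\partial X\}$). For $n\ge1$ and $I=I_x\in\mathscr{Q}_n$, $\widehat I=I_y\in\mathscr{Q}_{n-1}$, where $y$ is the mother (parent) of $x$. $f_I=\frac{1}{\nu(I)}\int_I f\,d\nu$. **Orlicz-Besov space.** For $g\in L^1_{\rm loc}(\partial X)$ put $$|g|_{\dot{\mathcal B}^{\theta,\lambda_2}_\Phi(\partial X)}=\sum_{n=1}^\infty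 e^{\epsilon n(\theta-1)p}n^{\lambda_2}\sum_{I\in\mathscr{Q}_n}\nu(I)\,\Phi\!\left(\frac{|g_I-g_{\widehat I}|}{e^{-\epsilon n}}\right).$$ $\mathcal{B}^{\theta,\lambda_2}_\Phi(\partial X)$ consists of all $f\in L^\Phi(\partial X)$ for which $$\|f\|_{\mathcal{B}^{\theta,\lambda_2}_\Phi(\partial X)}=\|f\|_{L^\Phi(\partial X)}+\inf\{k>0:\ |f/k|_{\dot{\mathcal B}^{\theta,\lambda_2}_\Phi(\partial X)}\le 1\}$$ is finite. **Trace space.** A space $\mathbb{X}(\partial X)$ is called a trace space of $\mathbb{Y}(X)$ if and only if there exist a bounded linear operator $T:\mathbb{Y}(X)\to\mathbb{X}(\partial X)$ and a bounded linear extension operator $E:\mathbb{X}(\partial X)\to\mathbb{Y}(X)$ such that $T\circ E=\mathrm{Id}$ on $\mathbb{X}(\partial X)$. *)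

(* Defs.v *)
From HB Require Import structures.
From mathcomp Require Import all_boot all_order all_algebra.
From mathcomp Require Import all_classical all_reals all_analysis.
From mathcomp Require Import measurable_realfun.

Set Implicit Arguments.
Unset Strict Implicit.
Unset Printing Implicit Defensive.

Import Order.TTheory GRing.Theory Num.Theory.
Import numFieldNormedType.Exports.

Local Open Scope classical_set_scope.
Local Open Scope ring_scope.

(* The alphabet naming the K children of a vertex: this is 'I_K when 0 < K, and
   it is inhabited for every K because measurable types have to be. *)
Notation label K := 'I_K.-1.+1.

Lemma card_label (K : nat) : (0 < K)%N -> #|{: label K}| = K.
Proof. by move=> K0; rewrite card_ord prednK. Qed.

(* A vertex is the word spelled by the path from the root, and its children are
   the words [rcons w i].  A point of the tree is stored as the pair of the lower
   endpoint [tip] of the half-open edge ]mother, tip] it lies on and its distance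
   [height] to the root; the root itself is ([::], 0).  Since
   [size tip] is the ceiling of [height], every point has exactly one code. *)
Definition tree_code (R : realType) (K : nat) (x : seq (label K) * R) : bool :=
  [&& 0 <= x.2, x.2 <= (size x.1)%:R & (size x.1)%:R < x.2 + 1].

Record tree (R : realType) (K : nat) := TreePoint {
  tree_val :> seq (label K) * R ;
  tree_valP : tree_code tree_val }.

HB.instance Definition _ R K := [isSub for @tree_val R K].
HB.instance Definition _ R K := [Choice of tree R K by <:].

Definition tip R K (x : tree R K) : seq (label K) := x.1.
Definition height R K (x : tree R K) : R := x.2.

Lemma vertex_subproof (R : realType) K (w : seq (label K)) :
  tree_code (w, (size w)%:R : R).
Proof. by rewrite /tree_code /= lexx ler0n ltrDl ltr01. Qed.

Definition vertex (R : realType) K (w : seq (label K)) : tree R K :=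
  TreePoint (vertex_subproof R w).

HB.instance Definition _ (R : realType) K :=
  isPointed.Build (tree R K) (vertex R [::]).

Definition mother K (w : seq (label K)) : seq (label K) := take (size w).-1 w.

Definition edge_section R K (A : set (tree R K)) (w : seq (label K)) : set R :=
  [set height x | x in A `&` [set x | tip x = w]].

Section tree_measurable.
Context (R : realType) (K : nat).
Local Notation tree := (tree R K).
Implicit Types (A : set tree) (w : seq (label K)).

Definition edge_range w : set R :=
  [set h | [&& 0 <= h, h <= (size w)%:R & (size w)%:R < h + 1]].

Lemma measurable_edge_range w : measurable (edge_range w).
Proof.
rewrite (_ : edge_range w = `[0, (size w)%:R] `&` `](size w)%:R - 1, +oo[).
  exact: measurableI.
apply/seteqP; split => h /=.
  by move=> /and3P[h0 hw wh]; rewrite !in_itv/= andbT ltrBlDr; split=> //; apply/andP.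
by rewrite !in_itv/= andbT ltrBlDr => -[/andP[h0 hw] wh]; apply/and3P.
Qed.

Lemma edge_sectionP A w h :
  edge_section A w h <-> exists2 hw : tree_code (w, h), True & A (TreePoint hw).
Proof.
split=> [[[[w' h'] xP] [/= Ax]]|[hw _ Ax]].
  by rewrite /tip /height /= => <- <-; exists xP.
by exists (TreePoint hw).
Qed.

Lemma edge_section0 w : edge_section (set0 : set tree) w = set0.
Proof. by rewrite /edge_section set0I image_set0. Qed.

Lemma edge_sectionC A w :
  edge_section (~` A) w = edge_range w `\` edge_section A w.
Proof.
apply/seteqP; split => h.
  move=> /edge_sectionP[hw _ nAx]; split; first exact: hw.
  move=> /edge_sectionP[hw' _]; apply: contra_not nAx.
  by rewrite (bool_irrelevance hw hw').
move=> [hw nA]; apply/edge_sectionP; exists hw => // Ax.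
by apply: nA; apply/edge_sectionP; exists hw.
Qed.

Lemma edge_section_bigcup (F : (set tree)^nat) w :
  edge_section (\bigcup_i F i) w = \bigcup_i edge_section (F i) w.
Proof.
apply/seteqP; split => h.
  move=> /edge_sectionP[hw _ [i _ Fx]]; exists i => //.
  by apply/edge_sectionP; exists hw.
by move=> [i _ /edge_sectionP[hw _ Fx]]; apply/edge_sectionP; exists hw => //; exists i.
Qed.

(* By [tree_measurableE] below these are the Borel sets of d_X for every eps > 0;
   the direct description makes them available before d_X is defined. *)
Definition tree_measurable : set (set tree) :=
  [set A | forall w, measurable (edge_section A w)].

Lemma tree_measurable0 : tree_measurable set0.
Proof. by move=> w; rewrite edge_section0. Qed.

Lemma tree_measurableC A : tree_measurable A -> tree_measurable (~` A).
Proof.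
move=> mA w; rewrite edge_sectionC; apply: measurableD => //.
exact: measurable_edge_range.
Qed.

Lemma tree_measurable_bigcup (F : (set tree)^nat) :
  (forall i, tree_measurable (F i)) -> tree_measurable (\bigcup_i (F i)).
Proof.
move=> mF w; rewrite edge_section_bigcup; apply: bigcup_measurable => i _.
exact: mF.
Qed.

HB.instance Definition _ := @isMeasurable.Build default_measure_display
  tree tree_measurable tree_measurable0 tree_measurableC tree_measurable_bigcup.

Lemma tree_measurableP A :
  measurable A <-> forall w, measurable (edge_section A w).
Proof. by []. Qed.

Lemma measurable_height : measurable_fun [set: tree] (@height R K).
Proof.
move=> _ B mB; rewrite setTI; apply/tree_measurableP => w.
rewrite (_ : edge_section _ w = edge_range w `&` B); last first.
  apply/seteqP; split => h.
    by move=> /edge_sectionP[hw _ Bh]; split; first exact: hw.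
  by move=> [hw Bh]; apply/edge_sectionP; exists hw.
by apply: measurableI => //; exact: measurable_edge_range.
Qed.

Local Open Scope ereal_scope.

(* The natural measure d|z|, giving each edge Lebesgue measure 1. *)
Definition tree_length A : \bar R :=
  \esum_(w in [set: seq (label K)]) lebesgue_measure (edge_section A w).

Let tree_length0 : tree_length set0 = 0.
Proof. by rewrite /tree_length esum1// => w _; rewrite edge_section0 measure0. Qed.

Let tree_length_ge0 A : 0 <= tree_length A.
Proof. by apply: esum_ge0 => w _; exact: measure_ge0. Qed.

Let tree_length_sigma_additive : semi_sigma_additive tree_length.
Proof.
move=> F mF tF _; apply: cvg_toP.
  by apply: ereal_nondecreasing_is_cvgn => m n mn; exact: lee_sum_nneg_natr.
rewrite /tree_length nneseries_esumT; last by move=> n; exact: esum_ge0.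
rewrite esum_esum//=.
rewrite (@reindex_esum R _ _ ([set: seq (label K)] `*`` fun=> [set: nat]) _
  (fun k => (k.2, k.1)))/=; last first.
  split => //=.
  - by move=> [a b] [c d] _ _ [-> ->].
  - by move=> [a b] _; exists (b, a).
rewrite -(@esum_esum R _ _ _ _ (fun w n => lebesgue_measure (edge_section (F n) w)))//.
apply: eq_esum => w _; rewrite edge_section_bigcup measure_semi_bigcup//=.
- by rewrite nneseries_esumT.
- by move=> n; exact: mF.
- move=> i j _ _ [h [/edge_sectionP[hw _ Fi] /edge_sectionP[hw' _ Fj]]].
  apply: tF => //; exists (TreePoint hw); split=> //.
  by rewrite (bool_irrelevance hw hw').
- by apply: bigcup_measurable => n _; exact: mF.
Qed.

HB.instance Definition _ := isMeasure.Build _ _ _ tree_length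
  tree_length0 tree_length_ge0 tree_length_sigma_additive.

End tree_measurable.

Section tree_metric.
Context (R : realType) (K : nat).
Local Notation tree := (tree R K).
Implicit Types (x y z : tree) (eps : R).

(* [ancestor z x] means that z lies on the geodesic from the root to x. *)
Definition ancestor z x : Prop :=
  prefix (tip z) (tip x) /\ height z <= height x.

(* The branch point of x and y is their largest common ancestor. *)
Definition geodesic x y : set tree :=
  [set z | (ancestor z x \/ ancestor z y) /\
           forall v, ancestor v x -> ancestor v y -> ancestor v z].

(* The integral of g along [x, y] against ds_X = e^(- eps |z|) d|z|, where d|z|
   is [tree_length]. *)
Definition path_integral eps (g : tree -> \bar R) x y : \bar R :=
  (\int[@tree_length R K]_(z in geodesic x y)
     (g z * (expR (- eps * height z))%:E))%E.

Definition dist_tree eps x y : R := fine (path_integral eps (cst 1%E) x y).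

Definition upper_gradient eps (u : tree -> R) (g : tree -> \bar R) : Prop :=
  [/\ measurable_fun setT g, forall x, (0 <= g x)%E &
      forall z y, (`|u z - u y|%:E <= path_integral eps g z y)%E].

End tree_metric.

Definition dist_ball (R : realType) T (d : T -> T -> R) (x : T) (r : R) : set T :=
  [set y | d x y < r].

Definition dist_open (R : realType) T (d : T -> T -> R) (A : set T) : Prop :=
  forall x, A x -> exists2 r, 0 < r & dist_ball d x r `<=` A.

Section tree_borel.
Context (R : realType) (K : nat) (eps : R) (eps0 : 0 < eps).
Local Notation tree := (tree R K).
Local Notation dist := (@dist_tree R K eps).
Implicit Types (x y z v : tree) (w : seq (label K)).

Lemma tree_heightP x :
  [/\ 0 <= height x, height x <= (size (tip x))%:R &
      (size (tip x))%:R < height x + 1].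
Proof. exact/and3P/(tree_valP x). Qed.

Lemma ancestor_refl x : ancestor x x.
Proof. by split; rewrite ?prefix_refl. Qed.

Lemma ancestor_chain v z x :
  ancestor v x -> ancestor z x -> height v <= height z -> ancestor v z.
Proof.
move=> [vx _] [zx _] vz; split=> //.
have [_ _ hv] := tree_heightP v; have [_ hz _] := tree_heightP z.
have svz : (size (tip v) <= size (tip z))%N.
  rewrite -ltnS -(ltr_nat R) -natr1; apply: lt_le_trans hv _.
  by rewrite lerD2r (le_trans vz).
by move: vx zx; rewrite !prefixE => /eqP vx /eqP <-; rewrite take_takel// vx.
Qed.

Lemma measurable_geodesic x y : measurable (geodesic x y).
Proof.
apply/tree_measurableP => w; apply: is_interval_measurable => h1 h2.
move=> /edge_sectionP[w1 _ [or1 b1]] /edge_sectionP[w2 _ [or2 b2]] h /andP[h1h hh2].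
have wh : tree_code (w, h).
  have /and3P[/= p1 q1 r1] := w1; have /and3P[/= p2 q2 r2] := w2.
  apply/and3P; split => /=.
  - exact: le_trans h1h.
  - exact: le_trans q2.
  - by apply: lt_le_trans r1 _; rewrite lerD2r.
apply/edge_sectionP; exists wh => //; split.
  by case: or2 => -[pr le2]; [left|right]; split => //; exact: le_trans le2.
by move=> v vx vy; have [pr le1] := b1 v vx vy; split=> //; exact: le_trans h1h.
Qed.

Lemma measurable_path_weight (D : set tree) :
  measurable_fun D (fun z => ((cst 1 z) * (expR (- eps * height z))%:E)%E).
Proof.
apply: measurable_funTS; apply: emeasurable_funM => //.
apply: measurableT_comp => //; apply: measurableT_comp => //.
by apply: measurable_funM => //; exact: measurable_height.
Qed.

Lemma path_weight_ge0 z : (0 <= cst 1 z * (expR (- eps * height z))%:E)%E.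
Proof. by rewrite mul1e lee_fin expR_ge0. Qed.

Lemma path_integral_length x y :
  (path_integral eps (cst 1%E) x y <= tree_length (geodesic x y))%E.
Proof.
rewrite -[leRHS]mul1e -(integral_cst _ (measurable_geodesic x y)).
apply: ge0_le_integral => //=.
- exact: measurable_geodesic.
- exact: measurable_path_weight.
move=> z _; rewrite mul1e lee_fin -expR0 ler_expR mulNr oppr_le0.
by rewrite mulr_ge0 ?(ltW eps0)//; have [] := tree_heightP z.
Qed.

Lemma path_integral_ge0 x y : (0 <= path_integral eps (cst 1%E) x y)%E.
Proof. by apply: integral_ge0 => z _; exact: path_weight_ge0. Qed.

Lemma geodesic_fin_length x y : (tree_length (geodesic x y) < +oo)%E.
Proof.
pose P := [set w | prefix w (tip x) \/ prefix w (tip y)].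
have finP : finite_set P.
  have finp (t : seq (label K)) : finite_set [set w | prefix w t].
    apply: (@sub_finite_set _ _ ((fun n => take n t) @` `I_(size t).+1)).
      move=> w /= wt; exists (size w); first by rewrite /= ltnS size_prefix.
      by move: wt; rewrite prefixE => /eqP.
    exact/finite_image/finite_II.
  apply: sub_finite_set (_ : P `<=` [set w | prefix w (tip x)] `|` [set w | prefix w (tip y)]) _.
    by [].
  by rewrite finite_setU; split; exact: finp.
have secP w : (lebesgue_measure (edge_section (geodesic x y) w) <=
               if w \in P then 1 else 0)%E.
  have msec : measurable (edge_section (geodesic x y) w).
    by move: w; apply/tree_measurableP; exact: measurable_geodesic.
  case: ifPn => [_|/negP wP].
    have -> : 1%E = lebesgue_measure `[(size w)%:R - 1 : R, (size w)%:R].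
      by rewrite lebesgue_measure_itv/= lte_fin ltrBlDr ltrDl ltr01 -EFinD opprB addrCA subrr addr0.
    apply: le_measure; rewrite ?inE//.
    move=> h /edge_sectionP[/and3P[/= h0 hw wh] _ _].
    by rewrite /= in_itv/= hw andbT lerBlDr ltW.
  rewrite (_ : edge_section _ _ = set0) ?measure0//.
  apply/seteqP; split => // h /edge_sectionP[hw _ [[[pr _]|[pr _]] _]];
    by apply: wP; rewrite inE /P /=; tauto.
apply: (@le_lt_trans _ _ (\esum_(w in P) 1)%E).
  by rewrite esum_mkcond; apply: le_esum => w _; exact: secP.
rewrite esum_fset//.
  by rewrite fsbig_finite//= sumEFin ltry.
Qed.

Lemma path_integralE x y :
  path_integral eps (cst 1%E) x y = (dist x y)%:E.
Proof.
rewrite fineK// ge0_fin_numE ?path_integral_ge0//.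
by rewrite (le_lt_trans (path_integral_length x y))// geodesic_fin_length.
Qed.

Lemma dist_tree_same_edge x y :
  tip x = tip y -> dist x y <= `|height x - height y|.
Proof.
wlog le_xy : x y / height x <= height y => [hwlog xy|xy].
  have [/hwlog|/ltW yx] := leP (height x) (height y); first exact.
  rewrite distrC -lee_fin -path_integralE.
  suff -> : path_integral eps (cst 1%E) x y = path_integral eps (cst 1%E) y x.
    by rewrite path_integralE lee_fin; exact: hwlog.
  rewrite /path_integral; congr (integral _ _ _).
  by apply/seteqP; split => z [zxy ub]; split; [tauto|auto|tauto|auto].
rewrite -lee_fin -path_integralE; apply: (le_trans (path_integral_length x y)).
rewrite /tree_length.
have sub w : edge_section (geodesic x y) w `<=`
    if w == tip x then `[height x, height y]%classic else set0.
  move=> h /edge_sectionP[hw _ [za zb]].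
  have [xz hxz] : ancestor x (TreePoint hw).
    by apply: zb; [exact: ancestor_refl|split=> //; rewrite xy prefix_refl].
  have [zy hzy] : ancestor (TreePoint hw) y.
    case: za => // -[zx hzx]; split; first by rewrite -xy.
    exact: le_trans le_xy.
  have -> : w == tip x.
    have [/= wy xw] : prefix w (tip y) /\ prefix (tip x) w by [].
    apply/eqP; move: wy xw; rewrite -xy !prefixE => /eqP wx /eqP xw.
    have [le|/ltnW le] := leqP (size w) (size (tip x)).
      by rewrite -xw take_oversize.
    by rewrite -wx take_oversize.
  by rewrite /= in_itv/=; apply/andP.
have msec w : measurable (edge_section (geodesic x y) w).
  by move: w; apply/tree_measurableP; exact: measurable_geodesic.
apply: (@le_trans _ _ (\esum_(w in [set tip x]) (height y - height x)%:E)%E).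
  rewrite [leRHS]esum_mkcond; apply: le_esum => w _; rewrite in_set1.
  have := sub w; case: (w == tip x) => subw.
    have -> : ((height y - height x)%:E = lebesgue_measure `[height x, height y])%E.
      rewrite lebesgue_measure_itv/= lte_fin -EFinD; case: ltP => // yx.
      by rewrite (le_anti (introT andP (conj le_xy yx))) subrr.
    apply: le_measure; [rewrite inE; exact: msec|rewrite inE; exact: measurable_itv|exact: subw].
  by move: subw; rewrite subset0 => ->; rewrite measure0.
rewrite esum_set1 ?lee_fin ?subr_ge0// distrC ger0_norm// subr_ge0//.
Qed.

Lemma dist_tree_lower x y s : 0 <= s < height x ->
  (forall v, ancestor v x -> ancestor v y -> height v <= s) ->
  expR (- eps * height x) *
    (height x - Num.max s ((size (tip x))%:R - 1)) <= dist x y.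
Proof.
move=> /andP[s0 sx] branch; set s' := Num.max _ _.
have [hx0 hx1 hx2] := tree_heightP x.
have s'x : s' < height x by rewrite gt_max sx ltrBlDr.
pose D := [set z : tree | tip z = tip x /\ s' < height z <= height x].
have secD w : edge_section D w =
    if w == tip x then `]s', height x]%classic else set0.
  apply/seteqP; split => h.
    move=> /edge_sectionP[hw _ [/= tz hz]].
    by rewrite -tz eqxx /= in_itv.
  case: eqP => // -> /=; rewrite in_itv/= => /andP[h1 h2].
  have hw : tree_code (tip x, h).
    apply/and3P; split => /=.
    - rewrite (le_trans s0)// (le_trans _ (ltW h1))// le_max lexx//.
    - exact: le_trans hx1.
    - by rewrite -ltrBlDr (le_lt_trans _ h1)// le_max lexx orbT.
  by apply/edge_sectionP; exists hw => //; split=> //; rewrite /height/= h1.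
have mD : measurable D.
  by apply/tree_measurableP => w; rewrite secD; case: ifP.
have lenD : tree_length D = (height x - s')%:E.
  rewrite /tree_length; transitivity (\esum_(w in [set tip x]) (height x - s')%:E)%E.
    rewrite [RHS]esum_mkcond; apply: eq_esum => w _; rewrite secD in_set1.
    case: ifPn => _; last by rewrite measure0.
    by rewrite lebesgue_measure_itv/= lte_fin s'x.
  by rewrite esum_set1// lee_fin subr_ge0 ltW.
have DG : D `<=` geodesic x y.
  move=> z [tz /andP[sz zx]].
  have az : ancestor z x by split; rewrite ?tz ?prefix_refl.
  split=> [|v vx vy]; first by left.
  apply: (ancestor_chain vx az); apply: (le_trans (branch _ vx vy)).
  by apply: le_trans (ltW sz); rewrite le_max lexx.
rewrite -lee_fin -path_integralE EFinM -lenD.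
rewrite -(integral_cst _ mD).
apply: (@le_trans _ _ (path_integral eps (cst 1%E) x y)) => //.
rewrite /path_integral.
apply: (@le_trans _ _ (\int[@tree_length R K]_(z in D)
   (cst 1 z * (expR (- eps * height z))%:E))%E); last first.
  apply: ge0_subset_integral => //; first exact: measurable_geodesic.
    exact: measurable_path_weight.
  by move=> z _; exact: path_weight_ge0.
apply: ge0_le_integral => //=.
- exact: measurable_path_weight.
move=> z [_ /andP[_ zx]]; rewrite mul1e lee_fin ler_expR !mulNr lerN2.
by rewrite ler_pM2l.
Qed.

Lemma dist_open_height_gt (c : R) : dist_open dist [set x | c < height x].
Proof.
have [c0 x /= cx|c0 x _] := leP 0 c; last first.
  exists 1 => // y _ /=; have [hy _ _] := tree_heightP y.
  exact: lt_le_trans hy.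
have [_ _ hx] := tree_heightP x.
exists (expR (- eps * height x) *
    (height x - Num.max c ((size (tip x))%:R - 1))).
  by rewrite mulr_gt0 ?expR_gt0// subr_gt0 gt_max cx ltrBlDr.
move=> y; rewrite /dist_ball/= => dxy; rewrite ltNge; apply/negP => yc.
move: dxy; apply/negP; rewrite -leNgt; apply: dist_tree_lower.
  by rewrite c0.
by move=> v _ [_ vy]; exact: le_trans yc.
Qed.

Lemma dist_open_subtree w : dist_open dist [set x | prefix w (tip x)].
Proof.
have [->|w0] := eqVneq w [::].
  by move=> x _; exists 1 => // y _ /=; rewrite prefix0s.
move=> x /= wx; have [_ _ hx] := tree_heightP x.
have sw : (0 < size w)%N by rewrite lt0n size_eq0.
have swx : (size w)%:R - 1 < height x.
  by rewrite ltrBlDr (le_lt_trans _ hx)// ler_nat size_prefix.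
exists (expR (- eps * height x) *
    (height x - Num.max ((size w)%:R - 1) ((size (tip x))%:R - 1))).
  by rewrite mulr_gt0 ?expR_gt0// subr_gt0 gt_max swx ltrBlDr.
move=> y; rewrite /dist_ball/= => dxy; apply: contraTT dxy => nwy.
rewrite -leNgt; apply: dist_tree_lower.
  by rewrite swx subr_ge0 ler1n sw.
move=> v [vx _] [vy _]; rewrite leNgt; apply: contra nwy => hv.
apply: prefix_trans vy.
have [_ hv1 _] := tree_heightP v.
have svw : (size w <= size (tip v))%N.
  rewrite -ltnS -(ltr_nat R) -natr1 -ltrBlDr.
  exact: lt_le_trans hv hv1.
move: vx wx; rewrite !prefixE => /eqP <- /eqP wx.
by rewrite take_takel// wx.
Qed.

Lemma open_edge_measurable (A : set tree) : dist_open dist A -> measurable A.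
Proof.
move=> oA; apply/tree_measurableP => w.
pose O := \bigcup_(i in [set i : R * R | 0 < i.2 /\ exists hw : tree_code (w, i.1),
  dist_ball dist (TreePoint hw) i.2 `<=` A]) ball i.1 i.2.
have -> : edge_section A w = edge_range w `&` O.
  apply/seteqP; split => h.
    move=> /edge_sectionP[hw _ /[dup] Ax /oA[r r0 rA]]; split; first exact: hw.
    by exists (h, r) => /=; [split=> //; exists hw|exact: ballxx].
  move=> [wh [[h' r]/= [r0 [hw rA]] hr]].
  apply/edge_sectionP; exists wh => //; apply: rA.
  by apply: le_lt_trans hr; exact: dist_tree_same_edge.
apply: measurableI; first exact: measurable_edge_range.
apply: open_measurable; apply: bigcup_open => i [i0 _].
exact: ball_open.
Qed.

Lemma tree_measurableE : @measurable _ tree = <<s dist_open dist >>.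
Proof.
apply/seteqP; split; last first.
  apply: smallest_sub; first exact: sigma_algebra_measurable.
  exact: open_edge_measurable.
pose T := g_sigma_algebraType (dist_open dist).
have mopen (A : set T) : dist_open dist A -> measurable A.
  by move=> oA; exact: sub_sigma_algebra.
have mheight : measurable_fun [set: T] (@height R K : T -> R).
  apply: (measurability _ (RGenOInfty.measurableE R)) => // _ [_ [c ->] <-].
  rewrite setTI; apply: mopen => x /=; rewrite in_itv/= andbT => cx.
  have [r r0 rA] := dist_open_height_gt cx.
  by exists r => // y /rA /=; rewrite in_itv/= andbT.
have mtip w : measurable ([set x | tip x = w] : set T).
  rewrite (_ : [set x | _] = [set x | prefix w (tip x)] `\`
      [set x | (size w)%:R < height x]).
    by apply: measurableD; apply: mopen;
      [exact: dist_open_subtree|exact: dist_open_height_gt].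
  apply/seteqP; split => x /=.
    move=> <-; rewrite prefix_refl; split=> //; apply/negP; rewrite -leNgt.
    by have [] := tree_heightP x.
  move=> [wx /negP]; rewrite -leNgt => xw; have [_ _ hx] := tree_heightP x.
  have : (size (tip x) <= size w)%N.
    by rewrite -ltnS -(ltr_nat R) -natr1 (lt_le_trans hx)// lerD2r.
  by move=> sxw; move: wx; rewrite prefixE take_oversize// => /eqP.
move=> A /tree_measurableP mA.
rewrite (_ : A = \bigcup_w ([set x | tip x = w] `&`
                            (@height R K @^-1` edge_section A w))).
  apply: (@countable_bigcupT_measurable _ T) => // w.
  apply: measurableI => //; rewrite -[X in measurable X]setTI.
  exact: mheight.
apply/seteqP; split => x.
  by move=> Ax; exists (tip x) => //; split=> //; exists x.
move=> [w _ [/= xw [y [Ay yw] yx]]].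
suff <- : y = x by [].
apply/val_inj; case: x y => -[w1 h1] ? [[w2 h2] ?] /= in xw yx yw Ay *.
by move: xw yx yw; rewrite /tip /height /= => -> -> ->.
Qed.

End tree_borel.

Section weighted_measure.
Context (R : realType) (K : nat) (beta C lambda : R).
Local Notation tree := (tree R K).

Definition tree_weight (x : tree) : R :=
  expR (- beta * height x) * (height x + C) `^ lambda.

Definition mu_tree (A : set tree) : \bar R :=
  (\int[@tree_length R K]_(x in A) (tree_weight x)%:E)%E.

Lemma tree_weight_ge0 x : 0 <= tree_weight x.
Proof. by rewrite mulr_ge0 ?expR_ge0 ?powR_ge0. Qed.

Lemma measurable_tree_weight : measurable_fun setT tree_weight.
Proof.
apply: measurable_funM.
  apply: measurableT_comp => //; apply: measurable_funM => //.
  exact: measurable_height.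
apply: (@measurableT_comp _ _ _ _ _ _ (fun r : R => r `^ lambda)).
  exact: measurable_powR.
by apply: measurable_funD => //; exact: measurable_height.
Qed.

Let mu_tree0 : mu_tree set0 = 0%E.
Proof. by rewrite /mu_tree integral_set0. Qed.

Let mu_tree_ge0 A : (0 <= mu_tree A)%E.
Proof. by apply: integral_ge0 => x _; rewrite lee_fin tree_weight_ge0. Qed.

Let mu_tree_sigma_additive : semi_sigma_additive mu_tree.
Proof.
move=> F mF tF mUF; apply: cvg_toP.
  by apply: ereal_nondecreasing_is_cvgn => m n mn; exact: lee_sum_nneg_natr.
rewrite /mu_tree ge0_integral_bigcup//=.
- apply: measurable_funTS; apply: measurableT_comp => //.
  exact: measurable_tree_weight.
- by move=> x _; rewrite lee_fin tree_weight_ge0.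
Qed.

HB.instance Definition _ := isMeasure.Build _ _ _ mu_tree
  mu_tree0 mu_tree_ge0 mu_tree_sigma_additive.

End weighted_measure.

Section boundary.
Context (R : realType) (K : nat).
Implicit Types (eps r : R).

(* The ray xi passes at level n through the vertex [mkseq xi n]. *)
Definition ray := nat -> label K.
HB.instance Definition _ := Choice.on ray.
HB.instance Definition _ := isPointed.Build ray (fun=> ord0).
Implicit Types (xi zeta : ray).

(* The extension of d_X to its completion, in closed form: 2/eps e^(- eps k), where
   k = [ex_minn h] is the last level at which the two rays pass through the same
   vertex. *)
Definition dist_ray eps xi zeta : R :=
  match pselect (exists n, xi n != zeta n) with
  | left h => 2 / eps * expR (- eps * (ex_minn h)%:R)
  | right _ => 0
  end.

Definition boundary eps :=
  g_sigma_algebraType (dist_open (dist_ray eps)).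

Definition cylinder (w : seq (label K)) : set ray :=
  [set xi | mkseq xi (size w) = w].

Definition diameter T (d : T -> T -> R) : R :=
  sup [set r | exists x y, r = d x y].

Definition ahlfors_regular eps Q (nu : set (boundary eps) -> \bar R) : Prop :=
  exists2 c, 0 < c & forall (xi : ray) r,
    0 < r <= diameter (dist_ray eps) ->
    ((c^-1 * r `^ Q)%:E <= nu (dist_ball (dist_ray eps) xi r) <= (c * r `^ Q)%:E)%E.

End boundary.

Section orlicz.
Context d (T : measurableType d) (R : realType).
Variables (Phi : R -> R) (m : {measure set T -> \bar R}).
Local Open Scope ereal_scope.

Definition orlicz : set (T -> R) :=
  [set u : T -> R | measurable_fun setT u /\
     exists2 a : R, (0 < a)%R & \int[m]_x (Phi (a * `|u x|))%:E < +oo].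

(* Upper gradients may be infinite, hence the extension of Phi by Phi(+oo) = +oo. *)
Definition luxemburg (f : T -> \bar R) : \bar R :=
  ereal_inf [set k%:E | k in
    [set k : R | (0 < k)%R /\ \int[m]_x er_map Phi (`|f x| * (k^-1)%:E) <= 1]].

Definition locally_L1 (dist : T -> T -> R) : set (T -> R) :=
  [set u : T -> R | measurable_fun setT u /\ forall x, exists2 r : R, (0 < r)%R &
     m.-integrable (dist_ball dist x r) (EFin \o u)].

End orlicz.

Definition Phi_log (R : realType) (p lambda1 t : R) : R :=
  t `^ p * ln (expR 1 + t) `^ lambda1.

(* A space of functions up to the relation [fs_eq]; it is used with fs_eq
   being almost everywhere equality. *)
Record fun_space (R : realType) := FunSpace {
  fs_point : Type ;
  fs_mem : set (fs_point -> R) ;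
  fs_eq : (fs_point -> R) -> (fs_point -> R) -> Prop ;
  fs_norm : (fs_point -> R) -> \bar R }.

(* An operator is given on representatives; its values off fs_mem Y are
   irrelevant. *)
Definition bounded_linear (R : realType) (Y Z : fun_space R)
    (T : (fs_point Y -> R) -> (fs_point Z -> R)) : Prop :=
  [/\ forall u, fs_mem u -> fs_mem (T u),
      forall u v, fs_mem u -> fs_mem v -> fs_eq u v -> fs_eq (T u) (T v),
      forall (a : R) u v, fs_mem u -> fs_mem v ->
        fs_eq (T (fun x => a * u x + v x)) (fun x => a * T u x + T v x) &
      exists c : R, forall u, fs_mem u -> (fs_norm (T u) <= c%:E * fs_norm u)%E].

Definition is_trace_space (R : realType) (Z Y : fun_space R) : Prop :=
  exists (T : (fs_point Y -> R) -> (fs_point Z -> R))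
         (E : (fs_point Z -> R) -> (fs_point Y -> R)),
    [/\ bounded_linear T, bounded_linear E &
        forall f, fs_mem f -> fs_eq (T (E f)) f].

Section orlicz_sobolev.
Context (R : realType) (K : nat) (eps beta C lambda2 : R) (Phi : R -> R).
Local Notation tree := (tree R K).
Local Notation mu := (@mu_tree R K beta C lambda2).
Local Open Scope ereal_scope.

Definition sobolev_norm (u : tree -> R) : \bar R :=
  luxemburg Phi mu (EFin \o u) +
  ereal_inf [set luxemburg Phi mu g | g in upper_gradient eps u].

Definition orlicz_sobolev : fun_space R := {|
  fs_point := tree ;
  fs_mem := [set u | locally_L1 mu (@dist_tree R K eps) u /\ sobolev_norm u < +oo] ;
  fs_eq := fun u v => {ae mu, forall x, u x = v x} ;
  fs_norm := sobolev_norm |}.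

End orlicz_sobolev.

Section orlicz_besov.
Context (R : realType) (K : nat) (eps theta p lambda2 : R) (Phi : R -> R).
Local Notation bdry := (@boundary R K eps).
Variable nu : {measure set bdry -> \bar R}.
Implicit Types (f : bdry -> R) (w : seq (label K)).

Definition cylinder_mean f w : R :=
  (fine (nu (cylinder w)))^-1 * \int[nu]_(xi in cylinder w) f xi.

(* The members of Q_n are indexed by the words of length n.  The means are
   genuine for f in L^Phi, which lies in L^1 because nu is finite. *)
Definition besov_energy f : \bar R :=
  (\sum_(1 <= n <oo)
     (expR (eps * n%:R * (theta - 1) * p) * n%:R `^ lambda2)%:E *
     \sum_(w : n.-tuple (label K))
       nu (cylinder w) *
       (Phi (`|cylinder_mean f w - cylinder_mean f (mother w)| /
             expR (- eps * n%:R)))%:E)%E.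

Local Open Scope ereal_scope.

Definition besov_norm f : \bar R :=
  luxemburg Phi nu (EFin \o f) +
  ereal_inf [set k%:E | k in
    [set k : R | (0 < k)%R /\ besov_energy (fun xi => f xi / k)%R <= 1]].

Definition orlicz_besov : fun_space R := {|
  fs_point := bdry ;
  fs_mem := [set f | orlicz Phi nu f /\ besov_norm f < +oo] ;
  fs_eq := fun f g => {ae nu, forall xi, f xi = g xi} ;
  fs_norm := besov_norm |}.

End orlicz_besov.

(* Main.v *)
Require Import Defs.
From HB Require Import structures.
From mathcomp Require Import all_boot all_order all_algebra.
From mathcomp Require Import all_classical all_reals all_analysis.
From mathcomp Require Import measurable_realfun.
From mathcomp Require Import ring lra.

Set Implicit Arguments.
Unset Strict Implicit.
Unset Printing Implicit Defensive.

Import Order.TTheory GRing.Theory Num.Theory.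
Import numFieldNormedType.Exports.

Local Open Scope classical_set_scope.
Local Open Scope ring_scope.

(* Write A_n for the value at level n along a ray xi of a function A of the
   vertices, and d_j = e^(eps j) |A_(j+1) - A_j|.  The heart of the proof is a
   Hardy type inequality: the sum over n of e^(- N n) (n+1)^lambda2 times the integral
   of Phi (e^(eps n) sum_(j >= n) |A_(j+1) - A_j|), N = beta - ln K, is controlled
   by the same sum with d_n in place of the tail.  It rests on Jensen's inequality
   for geometric weights and on N < q eps for some q >= 1 such that Phi(t) / t^q
   is almost increasing; this almost monotonicity also replaces convexity, which
   Phi may lack when lambda1 < 0.  Trace: A is the mean of u over the edges, and an
   upper gradient controls d_n.  Extension: interpolate the means of f linearly
   along the edges; their slopes are an upper gradient.  By the Hardy inequality
   the means of f over shrinking cylinders converge in L^1 and a.e., and the limit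
   has the same integral as f over every cylinder, hence equals f, so T o E = Id. *)

(** * Growth functions *)

(** Where the exponents come from: a cylinder of level n has nu-mass about K^(-n), an edge of level
    n has mu-mass about e^(- beta n) (n+1)^lambda2, so e^(- N n) (n+1)^lambda2 nu(I) is comparable
    to the mu-mass of the edge ending at the vertex of I. The value of theta makes the Besov weight
    e^(eps n (theta - 1) p) equal to e^(- N n). Level sums of boundary integrals are thus comparable
    to integrals over the tree. The obstacle is that Phi is not homogeneous: constants cannot be
    pulled out of it, and a Luxemburg norm only sees whether a modular is at most 1. Every estimate
    therefore reads: modulars at most 1 at given scales yield modulars at most 1 at c times these
    scales, or c times their sum, with c independent of the function. This works because q >= 1
    gives Phi(r t) <= A r Phi(t) for 0 <= r <= 1: enlarging the scale by a factor c divides a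
    modular by about c / A. The finer factor r^q is spent in the Hardy inequality, where the decay
    it leaves has to beat the level weights. *)

Section growth.
Context {R : realType}.
Implicit Types (Phi : R -> R) (p q l A s t : R).

(** Cross-multiplied form of: Phi(t) / t^q increases up to the factor A. It admits s = 0, where it
    yields Phi(0) = 0 for q <> 0; [0 < Phi 1] excludes the zero function, whose modular controls
    nothing. *)
Definition power_growth q A Phi : Prop :=
  [/\ forall t, 0 <= Phi t, 0 < Phi 1, measurable_fun setT Phi &
      forall s t, 0 <= s <= t -> Phi s * t `^ q <= A * Phi t * s `^ q].

Lemma ln_expR1D_ge1 s : 0 <= s -> 1 <= ln (expR 1 + s).
Proof.
move=> s0; rewrite -{1}(expRK (1:R)) ler_ln ?posrE ?expR_gt0//; last first.
  by rewrite ltr_wpDr// expR_gt0.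
by rewrite lerDl.
Qed.

Lemma ln_le_powR (k r : R) : 0 < k <= 1 -> 1 <= r -> 1 + ln r <= k^-1 * r `^ k.
Proof.
move=> /andP[k0 k1] r1.
have r0 : 0 < r by exact: lt_le_trans r1.
rewrite -ler_pdivrMl ?invr_gt0// invrK mulrDr mulr1.
apply: (@le_trans _ _ (1 + k * ln r)); first by rewrite lerD2r.
by rewrite /powR gt_eqF// expR_ge1Dx.
Qed.

(** Since e + t <= (e + s) (t / s), the left side is at most ln(e + s) + ln(t / s), and this sum is
    below the product because ln(e + s) >= 1. *)
Lemma ln_expR1D_slow s t : 0 < s <= t ->
  ln (expR 1 + t) <= ln (expR 1 + s) * (1 + ln (t / s)).
Proof.
move=> /andP[s0 st]; have t0 : 0 < t by exact: lt_le_trans st.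
have e0 := @expR_gt0 R 1.
have es0 : 0 < expR 1 + s by rewrite addr_gt0.
have et0 : 0 < expR 1 + t by rewrite addr_gt0.
have ts : 1 <= t / s by rewrite ler_pdivlMr// mul1r.
have h1 : ln (expR 1 + t) <= ln (expR 1 + s) + ln (t / s).
  rewrite -lnM ?posrE ?divr_gt0// ler_ln ?posrE ?mulr_gt0 ?invr_gt0//.
  rewrite mulrDl [s * _]mulrC divfK ?gt_eqF// lerD2r.
  by rewrite ler_peMr// ltW.
apply: (le_trans h1); rewrite mulrDr mulr1 lerD2l.
by rewrite ler_peMl ?ln_ge0// ln_expR1D_ge1// ltW.
Qed.

(** For l >= 0 the logarithmic factor increases. For l < 0 it decreases, and the spare power p - q >
    0 pays for it. *)
Lemma Phi_log_slow p q l : q <= p -> (l < 0 -> q < p) ->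
  exists A, forall s t, 0 < s <= t ->
    ln (expR 1 + s) `^ l <= A * (t / s) `^ (p - q) * ln (expR 1 + t) `^ l.
Proof.
move=> qp lqp.
have [l0|l0] := leP 0 l.
  exists 1 => s t /andP[s0 st]; rewrite mul1r.
  have t0 : 0 < t by exact: lt_le_trans st.
  have ts : 1 <= t / s by rewrite ler_pdivlMr// mul1r.
  apply: (@le_trans _ _ (ln (expR 1 + t) `^ l)).
    rewrite ge0_ler_powR ?nnegrE//; last 1 first.
      by rewrite ler_ln ?posrE ?addr_gt0 ?expR_gt0// lerD2l.
    - by rewrite (le_trans ler01)// ln_expR1D_ge1// ltW.
    - by rewrite (le_trans ler01)// ln_expR1D_ge1// ltW.
  rewrite ler_peMl ?powR_ge0//.
  have : 1 `^ (p - q) <= (t / s) `^ (p - q).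
    by rewrite ge0_ler_powR ?nnegrE ?subr_ge0// (le_trans ler01).
  by rewrite powR1.
(* The bound k (- l) <= p - q keeps the cost within (t / s)^(p - q) once the comparison of
   logarithms is raised to the power - l; the cap at 1 is the range of [ln_le_powR]. *)
pose k := Num.min 1 ((p - q) / - l).
have k0 : 0 < k by rewrite lt_min ltr01 divr_gt0 ?oppr_gt0// subr_gt0 lqp.
have k1 : k <= 1 by rewrite ge_min lexx.
exists (k^-1 `^ (- l)) => s t /andP[s0 st].
have t0 : 0 < t by exact: lt_le_trans st.
have ts : 1 <= t / s by rewrite ler_pdivlMr// mul1r.
set a := ln _; set b := ln _.
have a1 : 1 <= a by rewrite ln_expR1D_ge1// ltW.
have b1 : 1 <= b by rewrite ln_expR1D_ge1// ltW.
have a0 : 0 < a by exact: lt_le_trans a1.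
have b0 : 0 < b by exact: lt_le_trans b1.
have bak : b <= a * (k^-1 * (t / s) `^ k).
  apply: (le_trans (@ln_expR1D_slow s t _)); first by rewrite s0.
  by rewrite ler_pM2l// ln_le_powR// k0.
move: (t / s) ts bak => r r1 bak; have r0 : 0 <= r by rewrite (le_trans ler01).
have : b `^ (- l) <= a `^ (- l) * (k^-1 `^ (- l) * r `^ (p - q)).
  apply: (@le_trans _ _ ((a * (k^-1 * r `^ k)) `^ (- l))).
    by rewrite ge0_ler_powR ?nnegrE ?oppr_ge0 ?(ltW l0)//
      ?mulr_ge0 ?invr_ge0 ?powR_ge0// ?ltW.
  rewrite !powRM ?mulr_ge0 ?invr_ge0 ?powR_ge0 ?(ltW k0) ?(ltW a0)//.
  rewrite ler_pM2l ?powR_gt0// ler_pM2l ?powR_gt0 ?invr_gt0//.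
  rewrite -powRrM ler_powR//.
  by rewrite -ler_pdivlMr ?oppr_gt0// ge_min lexx orbT.
have bl : 0 < b `^ l by rewrite powR_gt0.
have al : 0 < a `^ l by rewrite powR_gt0.
by rewrite [b `^ _]powRN [a `^ _]powRN ler_pdivlMl// ler_pdivrMr.
Qed.

Lemma Phi_log_growth p q l : 0 < q -> q <= p -> (l < 0 -> q < p) ->
  exists A, power_growth q A (Phi_log p l).
Proof.
move=> q0 qp lqp; have p0 : 0 < p by exact: lt_le_trans qp.
have [A hA] := Phi_log_slow qp lqp.
exists A; split.
- by move=> t; rewrite mulr_ge0 ?powR_ge0.
- rewrite mulr_gt0 ?powR_gt0//.
  by rewrite (lt_le_trans ltr01)// ln_expR1D_ge1.
- apply: measurable_funM; first exact: measurable_powR.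
  apply: (@measurableT_comp _ _ _ _ _ _ (fun r : R => r `^ l)).
    exact: measurable_powR.
  apply: measurableT_comp; first exact: measurable_ln.
  exact: measurable_funD.
- move=> s t /andP[]; rewrite le_eqVlt => /predU1P[<- _|s0 st].
    by rewrite /Phi_log !powR0 ?gt_eqF// !mul0r mulr0.
  have t0 : 0 < t by exact: lt_le_trans st.
  rewrite /Phi_log.
  have -> : t `^ p = t `^ (p - q) * t `^ q by rewrite -powRD ?subrK ?gt_eqF ?implybT.
  have -> : s `^ p = s `^ (p - q) * s `^ q by rewrite -powRD ?subrK ?gt_eqF ?implybT.
  have := hA s t; rewrite s0 st => /(_ isT).
  rewrite powRM ?invr_ge0 ?(ltW s0) ?(ltW t0)//.
  rewrite (_ : s^-1 `^ (p - q) = (s `^ (p - q))^-1); last first.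
    by rewrite -powR_inv1 ?ltW// -powRrM mulN1r powRN.
  set x := ln _ `^ l; set y := ln _ `^ l.
  have := powR_gt0 (p - q) s0; have := powR_gt0 q s0; have := powR_gt0 q t0.
  set a := s `^ q; set b := t `^ q; set c := s `^ _; set d := t `^ _.
  move=> b0 a0 c0 h.
  rewrite (_ : _ * b = a * b * (c * x)); last by ring.
  rewrite (_ : _ * a = a * b * (A * d * y)); last by ring.
  rewrite ler_pM2l ?mulr_gt0// -ler_pdivlMl//.
  by apply: (le_trans h); rewrite le_eqVlt; apply/orP; left; apply/eqP; ring.
Qed.

(** A negative l forces q strictly below p, and p > 1 leaves room for it: q is the midpoint of
    max(1, r) and p. For p = 1 there is no room, but l >= 0 permits q = p = 1. *)
Lemma Phi_log_exponent p l r : 1 < p \/ (p = 1 /\ 0 <= l) -> r < p ->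
  exists q A, [/\ 1 <= q, r < q & power_growth q A (Phi_log p l)].
Proof.
move=> [p1|[-> l0]] rp.
  pose q := (Num.max 1 r + p) / 2.
  have mp : Num.max 1 r < p by rewrite gt_max p1.
  have m1 : 1 <= Num.max 1 r by rewrite le_max lexx.
  have mr : r <= Num.max 1 r by rewrite le_max lexx orbT.
  have q1 : 1 <= q by rewrite /q; lra.
  have qr : r < q by rewrite /q; lra.
  have qp : q < p by rewrite /q; lra.
  have [A hA] := @Phi_log_growth p q l (lt_le_trans ltr01 q1) (ltW qp) (fun=> qp).
  by exists q, A.
have [|A hA] := @Phi_log_growth 1 1 l ltr01 (lexx _); first by rewrite ltNge l0.
by exists 1, A.
Qed.

End growth.

(** * Jensen inequalities for almost increasing Phi(t) / t^q *)

Section growth_theory.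
Context {R : realType} {q A : R} {Phi : R -> R}.
Hypotheses (q1 : 1 <= q) (hPhi : power_growth q A Phi).
Implicit Types r s t : R.

Lemma growth_ge0 t : 0 <= Phi t. Proof. by case: hPhi. Qed.

Lemma growth_const_ge1 : 1 <= A.
Proof.
case: hPhi => _ Phi1 _ /(_ 1 1); rewrite ler01 lexx powR1 !mulr1 => /(_ isT).
by rewrite -ler_pdivrMr// divff// gt_eqF.
Qed.

Lemma growth_const_gt0 : 0 < A.
Proof. exact: lt_le_trans ltr01 growth_const_ge1. Qed.

Lemma growth_pow_contract r t : 0 <= r <= 1 -> 0 <= t ->
  Phi (r * t) <= A * r `^ q * Phi t.
Proof.
move=> /andP[r0 r1]; rewrite le_eqVlt => /predU1P[<-|t0].
  have q0 : q != 0 by rewrite gt_eqF// (lt_le_trans ltr01).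
  have [_ _ _ /(_ 0 1)] := hPhi; rewrite lexx ler01 powR1 mulr1 powR0// mulr0.
  move=> /(_ isT) Phi0; rewrite mulr0 (le_trans Phi0)// !mulr_ge0 ?powR_ge0 ?growth_ge0//.
  exact: ltW growth_const_gt0.
have [_ _ _ /(_ (r * t) t)] := hPhi.
rewrite mulr_ge0 ?(ltW t0)//= ler_piMl ?(ltW t0)// => /(_ isT).
rewrite powRM ?(ltW t0)// mulrA ler_pM2r ?powR_gt0// => /le_trans; apply.
by rewrite mulrAC.
Qed.

(** Follows from r^q <= r, as q >= 1; it stands in for Phi(r t) <= r Phi(t), which holds for convex
    Phi vanishing at 0. *)
Lemma growth_contract r t : 0 <= r <= 1 -> 0 <= t ->
  Phi (r * t) <= A * r * Phi t.
Proof.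
move=> r01 t0; apply: (le_trans (growth_pow_contract r01 t0)).
rewrite ler_wpM2r ?growth_ge0// ler_wpM2l ?(ltW growth_const_gt0)//.
case/andP: r01; rewrite le_eqVlt => /predU1P[<-|r0] r1.
  by rewrite powR0// gt_eqF// (lt_le_trans ltr01).
by rewrite -[leRHS](powRr1 (ltW r0)) /powR gt_eqF// ler_expR ler_wnM2r// ln_le0.
Qed.

Lemma growth0 : Phi 0 = 0.
Proof.
apply/eqP; rewrite eq_le growth_ge0 andbT -{1}(mul0r 0).
by rewrite (le_trans (growth_contract _ _))// ?lexx ?ler01// mulr0 mul0r.
Qed.

Lemma growth_mono s t : 0 <= s <= t -> Phi s <= A * Phi t.
Proof.
move=> /andP[s0 st]; have := le_trans s0 st; rewrite le_eqVlt => /predU1P[t0|t0].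
  have -> : s = 0 by apply/le_anti; rewrite s0 t0 st.
  by rewrite growth0 mulr_ge0 ?growth_ge0// ltW// growth_const_gt0.
rewrite -{1}(divfK (lt0r_neq0 t0) s).
have st01 : 0 <= s / t <= 1 by rewrite divr_ge0 ?(ltW t0)//= ler_pdivrMr ?mul1r.
apply: (le_trans (growth_contract st01 (ltW t0))).
rewrite ler_wpM2r ?growth_ge0// ler_piMr ?(ltW growth_const_gt0)//.
by case/andP: st01.
Qed.

(* Substitute for a supporting line at t, Phi being only almost convex. *)
Lemma growth_tangent s t : 0 <= s -> 0 < t ->
  Phi t * s <= t * Phi t + A * t * Phi s.
Proof.
move=> s0 t0; have A0 := growth_const_gt0.
have [st|ts] := leP s t.
  rewrite ler_wpDr ?mulr_ge0 ?growth_ge0 ?(ltW t0) ?(ltW A0)//.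
  by rewrite [leRHS]mulrC ler_wpM2l ?growth_ge0.
rewrite ler_wpDl ?mulr_ge0 ?growth_ge0 ?(ltW t0)//.
have s0' : 0 < s by exact: lt_trans ts.
have := @growth_contract (t / s) s; rewrite divfK ?gt_eqF//.
rewrite divr_ge0 ?(ltW t0)//= ler_pdivrMr// mul1r (ltW ts) => /(_ isT s0).
rewrite mulrA -[A * t / s * _]mulrAC ler_pdivlMr//.
Qed.

(** The tangent inequality at t = 1: Phi grows at least linearly, so on sets of finite measure a
    finite modular gives integrability. *)
Lemma growth_dominates s : 0 <= s -> s <= 1 + A / Phi 1 * Phi s.
Proof.
move=> s0; have := growth_tangent s0 ltr01; have [_ Phi1 _ _] := hPhi.
rewrite mul1r mulr1 -ler_pdivlMl// => /le_trans; apply.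
by rewrite mulrDr mulVf ?gt_eqF// lerD2l mulrA [A / _]mulrC.
Qed.

Section jensen.
Local Open Scope ereal_scope.
Context d (T : measurableType d) (m : {measure set T -> \bar R}).
Variables (D : set T) (f : T -> \bar R).
Hypotheses (mD : measurable D) (mf : measurable_fun D f).
Hypothesis f0 : forall x, D x -> 0 <= f x.

Lemma growth_er_map_ge0 (y : \bar R) : 0 <= y -> 0 <= er_map Phi y.
Proof. by case: y => [r| |]//= _; rewrite lee_fin growth_ge0. Qed.

Lemma measurable_growth_er_map : measurable_fun D (fun x => er_map Phi (f x)).
Proof.
by apply: (measurableT_comp _ mf); apply: measurable_er_map; case: hPhi.
Qed.

Lemma growth_integral_bound :
  \int[m]_(x in D) f x <= m D + (A / Phi 1)%:E * \int[m]_(x in D) er_map Phi (f x).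
Proof.
have [_ Phi1 _ _] := hPhi; have A0 := growth_const_gt0.
have ge0 x : D x -> 0 <= er_map Phi (f x) by move=> /f0; exact: growth_er_map_ge0.
have APhi : (0 <= A / Phi 1)%R by rewrite divr_ge0// ltW.
have mm : measurable_fun D (fun x => (A / Phi 1)%:E * er_map Phi (f x)).
  by apply: measurable_funeM; exact: measurable_growth_er_map.
rewrite -ge0_integralZl//; last exact: measurable_growth_er_map.
rewrite -[X in X + _]mul1e -integral_cst// -ge0_integralD//; last first.
  by move=> x Dx; rewrite mule_ge0// ?lee_fin// ge0.
apply: ge0_le_integral => //.
  by apply: emeasurable_funD.
move=> x Dx; have := f0 Dx; case: (f x) => [r| |]//= r0; last first.
  by rewrite gt0_muley ?lte_fin ?divr_gt0.
by rewrite -EFinM -EFinD lee_fin; exact: growth_dominates.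
Qed.

(** Integrating the tangent inequality at t bounds Phi(t) times the integral of f by t Phi(t) m(D)
    plus A t times the modular. An integral of at least 2 t m(D), instead of t m(D), lets half of
    the left side absorb the first term. *)
Lemma growth_jensen t : (0 <= t)%R -> m D < +oo ->
  (2 * t)%:E * m D <= \int[m]_(x in D) f x ->
  (Phi t)%:E * m D <= A%:E * \int[m]_(x in D) er_map Phi (f x).
Proof.
move=> t0 mDoo; have A0 := growth_const_gt0.
have ge0 x : D x -> 0 <= er_map Phi (f x) by move=> /f0; exact: growth_er_map_ge0.
have X0 : 0 <= \int[m]_(x in D) er_map Phi (f x) by exact: integral_ge0.
move: t0; rewrite le_eqVlt => /predU1P[<- _|t0 h].
  by rewrite growth0 mul0e mule_ge0// lee_fin ltW.
have At0 : (0 <= A * t)%R by rewrite mulr_ge0// ltW.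
have Pt0 := growth_ge0 t.
have /(lee_wpmul2l (x := (Phi t)%:E)) := h; rewrite lee_fin => /(_ Pt0).
have mm : measurable_fun D (fun x => (A * t)%:E * er_map Phi (f x)).
  by apply: measurable_funeM; exact: measurable_growth_er_map.
rewrite -[X in _ <= X -> _]ge0_integralZl//.
have : \int[m]_(x in D) ((Phi t)%:E * f x) <=
    \int[m]_(x in D) ((t * Phi t)%:E + (A * t)%:E * er_map Phi (f x)).
  apply: ge0_le_integral => //.
  - by move=> x Dx; rewrite mule_ge0// ?lee_fin// f0.
  - exact: measurable_funeM.
  - by apply: emeasurable_funD.
  move=> x Dx; have := f0 Dx; case: (f x) => [r| |]//= r0; last first.
    by rewrite [X in _ <= _ + X]gt0_muley ?lte_fin ?mulr_gt0// addey// leey.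
  by rewrite -!EFinM -EFinD lee_fin; exact: growth_tangent.
rewrite ge0_integralD//; last 2 first.
  - by move=> x _; rewrite lee_fin mulr_ge0// ltW.
  - by move=> x Dx; rewrite mule_ge0// ?lee_fin// ge0.
rewrite integral_cst// (@ge0_integralZl _ _ _ m D mD (fun x => er_map Phi (f x)))//; last exact: measurable_growth_er_map.
move=> /[swap] /le_trans /[apply].
have mDfin : m D \is a fin_num by rewrite ge0_fin_numE.
rewrite -(fineK mDfin); move: (fine _) => x.
move: X0; case: (integral _ _ _) => [y| |]//= y0.
  rewrite -!EFinM -EFinD !lee_fin => h'.
  by rewrite -(ler_pM2l t0); move: h'; lra.
by move=> *; rewrite [X in _ <= X]gt0_muley ?lte_fin// leey.
Qed.

End jensen.

(** The tangent inequality is summed against weights of total mass at most 1; the factor 2 has the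
    same role as in [growth_jensen]. *)
Lemma growth_series_jensen (w a : nat -> R) t : 0 <= t ->
  (forall k, 0 <= w k) -> (forall k, 0 <= a k) ->
  (\sum_(k <oo) (w k)%:E <= 1)%E ->
  ((2 * t)%:E <= \sum_(k <oo) (w k * a k)%:E)%E ->
  ((Phi t)%:E <= A%:E * \sum_(k <oo) (w k * Phi (a k))%:E)%E.
Proof.
move=> t0 w0 a0 w1; have A0 := growth_const_gt0.
have X0 : (0 <= \sum_(k <oo) (w k * Phi (a k))%:E)%E.
  by apply: nneseries_ge0 => k _ _; rewrite lee_fin mulr_ge0// growth_ge0.
move: t0; rewrite le_eqVlt => /predU1P[<- _|t0].
  by rewrite growth0 mule_ge0// lee_fin ltW.
have Pt0 := growth_ge0 t.
move=> /(@lee_wpmul2l _ (Phi t)%:E); rewrite lee_fin => /(_ Pt0).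
rewrite -nneseriesZl; last by move=> k _; rewrite lee_fin mulr_ge0.
have : (\sum_(k <oo) ((Phi t)%:E * (w k * a k)%:E) <=
  \sum_(k <oo) ((t * Phi t)%:E * (w k)%:E + (A * t)%:E * (w k * Phi (a k))%:E))%E.
  apply: lee_nneseries => [k _ _|k _].
    by rewrite -EFinM lee_fin !mulr_ge0.
  rewrite -!EFinM -EFinD lee_fin.
  have := ler_wpM2l (w0 k) (growth_tangent (a0 k) t0).
  rewrite (_ : w k * (_ * a k) = Phi t * (w k * a k)); last by ring.
  by move=> /le_trans; apply; rewrite le_eqVlt; apply/orP; left; apply/eqP; ring.
have tP0 : 0 <= t * Phi t by rewrite mulr_ge0// ltW.
have At0 : 0 <= A * t by rewrite mulr_ge0// ltW.
rewrite nneseriesD; last 2 first.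
- by move=> k _ _; rewrite -EFinM lee_fin mulr_ge0.
- by move=> k _ _; rewrite -EFinM lee_fin mulr_ge0// mulr_ge0// growth_ge0.
rewrite (nneseriesZl (f := fun k => (w k)%:E)); last by move=> k _; rewrite lee_fin.
rewrite (nneseriesZl (f := fun k => (w k * Phi (a k))%:E)); last first.
  by move=> k _; rewrite lee_fin mulr_ge0// growth_ge0.
move=> /[swap] /le_trans /[apply] h.
have {}h := le_trans h (leeD (@lee_wpmul2l _ (t * Phi t)%:E tP0 _ _ w1) (lexx _)).
move: h X0; case: (limn _) => [y| |]//=.
  rewrite -!EFinM -EFinD !lee_fin => h y0.
  by rewrite -(ler_pM2l t0); move: h; lra.
by move=> *; rewrite [X in (_ <= X)%E]gt0_muley ?lte_fin// leey.
Qed.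

End growth_theory.

(** * Level weights *)

Section weights.
Context {R : realType}.
Implicit Types (b l N s x y tau : R) (m n : nat).

(** The sign of l decides which of the two comparisons is used; lambda2 may have either sign. *)
Lemma powR_comparable b l x y : 0 < x -> 0 < y -> 1 <= b ->
  x <= b * y -> y <= b * x -> x `^ l <= b `^ `|l| * y `^ l.
Proof.
move=> x0 y0 b1 xby ybx; have b0 : 0 < b by exact: lt_le_trans b1.
have [l0|l0] := leP 0 l.
  rewrite ger0_norm// -powRM ?(ltW b0) ?(ltW y0)//.
  by rewrite ge0_ler_powR ?nnegrE ?mulr_ge0 ?(ltW x0) ?(ltW y0) ?(ltW b0)//.
rewrite ltr0_norm//.
have : y `^ (- l) <= b `^ (- l) * x `^ (- l).
  rewrite -powRM ?(ltW b0) ?(ltW x0)//.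
  by rewrite ge0_ler_powR ?nnegrE ?mulr_ge0 ?oppr_ge0 ?(ltW x0) ?(ltW y0) ?(ltW b0) ?(ltW l0)//.
rewrite [y `^ _]powRN [x `^ _]powRN ler_pdivlMr ?powR_gt0//.
by rewrite mulrC ler_pdivrMr ?powR_gt0.
Qed.

Lemma powR_le_expR a tau : 0 <= a -> 0 < tau ->
  exists2 C, 0 < C & forall m, m.+1%:R `^ a <= C * expR (tau * m%:R).
Proof.
(* Dividing by a + 1 gives k a <= tau and allows a = 0. The bound is the a-th power of m + 1 <= (1 +
   1/k) (1 + k m) <= (1 + 1/k) e^(k m). *)
move=> a0 tau0; pose k := tau / (a + 1).
have a10 : 0 < a + 1 by rewrite ltr_wpDl.
have k0 : 0 < k by rewrite divr_gt0.
have c0 : 0 < 1 + k^-1 by rewrite addr_gt0// invr_gt0.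
exists ((1 + k^-1) `^ a); first by rewrite powR_gt0.
move=> m; apply: (@le_trans _ _ (((1 + k^-1) * expR (k * m%:R)) `^ a)).
  rewrite ge0_ler_powR ?nnegrE ?mulr_ge0 ?expR_ge0 ?(ltW c0)//.
  apply: (@le_trans _ _ ((1 + k^-1) * (1 + k * m%:R))); last first.
    by rewrite ler_pM2l// expR_ge1Dx.
  rewrite mulrDr mulr1 mulrDl mul1r mulrA mulVf ?gt_eqF// mul1r -natr1.
  have : 0 <= k * m%:R by rewrite mulr_ge0// ltW.
  have : 0 <= k^-1 by rewrite invr_ge0 ltW.
  lra.
rewrite powRM ?(ltW c0) ?expR_ge0// ler_pM2l ?powR_gt0//.
rewrite /powR gt_eqF ?expR_gt0// expRK ler_expR mulrA ler_wpM2r//.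
by rewrite /k mulrCA ler_piMr ?(ltW tau0)// ler_pdivrMr// mul1r lerDl.
Qed.

(** Index n serves the edges from level n to level n + 1 and the Besov term of level n + 1; the base
    n + 1 avoids powers of 0. *)
Definition level_weight N l n : R := expR (- N * n%:R) * n.+1%:R `^ l.

Lemma level_weight_gt0 N l n : 0 < level_weight N l n.
Proof. by rewrite mulr_gt0 ?expR_gt0 ?powR_gt0. Qed.

Lemma level_weight0 N l : level_weight N l 0 = 1.
Proof. by rewrite /level_weight mulr0 expR0 mul1r powR1. Qed.

(** Moving the weight from level n to level n + m leaves the factor e^(- (s - N) m). One half of
    this exponent beats the polynomial ratio of the two weights, the other half survives as
    geometric decay. *)
Lemma level_weight_decay N l s : N < s ->
  exists C tau, [/\ 0 < C, 0 < tau & forall n m,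
    level_weight N l n * expR (- s * m%:R) <=
    C * expR (- tau * m%:R) * level_weight N l (n + m)].
Proof.
move=> Ns; pose tau := (s - N) / 2.
have tau0 : 0 < tau by rewrite divr_gt0// subr_gt0.
have [C C0 hC] := powR_le_expR (normr_ge0 l) tau0.
exists C, tau; split => // n m.
have h : n.+1%:R `^ l <= C * expR (tau * m%:R) * (n + m).+1%:R `^ l.
  apply: (@le_trans _ _ (m.+1%:R `^ `|l| * (n + m).+1%:R `^ l)).
    apply: powR_comparable; rewrite ?ltr0n ?ler1n// -natrM ler_nat.
      by apply: (@leq_trans (n + m).+1); rewrite ?ltnS ?leq_addr ?leq_pmull.
    by rewrite mulSn addSn ltnS leq_add2l leq_pmulr.
  by rewrite ler_wpM2r ?powR_ge0// hC.
rewrite /level_weight [leLHS]mulrAC.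
have e0 : 0 < expR (- N * n%:R) * expR (- s * m%:R) by rewrite mulr_gt0 ?expR_gt0.
have := h; rewrite -(ler_pM2l e0) => /le_trans; apply.
rewrite le_eqVlt; apply/orP; left; apply/eqP.
have -> : expR (- N * (n + m)%:R) = expR (- N * n%:R) * expR (- s * m%:R) * expR (tau * m%:R) * expR (tau * m%:R).
  by rewrite -!expRD; congr expR; rewrite natrD /tau; field.
have -> : expR (- tau * m%:R) = (expR (tau * m%:R))^-1 by rewrite mulNr expRN.
by field; rewrite gt_eqF ?expR_gt0.
Qed.

Lemma nneseries_expR tau : 0 < tau ->
  (\sum_(m <oo) (expR (- tau * m%:R))%:E = ((1 - expR (- tau))^-1)%:E)%E.
Proof.
move=> tau0; apply/cvg_lim => //.
have -> : (fun n => \sum_(0 <= m < n) (expR (- tau * m%:R))%:E)%E =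
    EFin \o series (geometric 1 (expR (- tau))).
  apply/funext => n; rewrite /= /series/= sumEFin; congr EFin.
  by apply: eq_bigr => i _; rewrite mul1r -expRM_natr.
apply: cvg_EFin; first exact: nearW.
have := @cvg_geometric_series R 1 (expR (- tau)).
by rewrite ger0_norm ?expR_ge0// mul1r expR_lt1 oppr_lt0 tau0; exact.
Qed.

End weights.

(** * Cylinders of the boundary *)

Section cylinders.
Context {R : realType} {K : nat} {eps : R}.
Hypotheses (K2 : (2 <= K)%N) (eps0 : 0 < eps).
Local Notation bdry := (@boundary R K eps).
Local Notation dist := (@dist_ray R K eps).
Implicit Types (xi zeta : ray K) (w : seq (label K)) (n : nat).

Lemma mkseq_eqP xi zeta n :
  mkseq xi n = mkseq zeta n <-> forall i, (i < n)%N -> xi i = zeta i.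
Proof.
split=> [h i ni|h]; last first.
  by apply/eq_in_map => i; rewrite mem_iota add0n => /andP[_]; exact: h.
by rewrite -(nth_mkseq ord0 xi ni) h nth_mkseq.
Qed.

(** Distances take only the values (2 / eps) e^(- eps k), k being the first index where the letters
    differ. Lying strictly below the value for n means k > n, whence the shift to n + 1 letters. *)
Lemma dist_ray_lt xi zeta n :
  dist xi zeta < 2 / eps * expR (- eps * n%:R) <->
  mkseq zeta n.+1 = mkseq xi n.+1.
Proof.
have e0 : 0 < 2 / eps by rewrite divr_gt0.
rewrite mkseq_eqP /dist_ray; case: pselect => [h|h].
  rewrite ltr_pM2l// ltr_expR !mulNr ltrN2 ltr_pM2l// ltr_nat.
  case: ex_minnP => k xik kmin; split => [nk i ni|eqn].
    apply/esym/eqP; apply: contraTT nk => /kmin ki.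
    by rewrite -leqNgt (leq_trans ki).
  rewrite ltnNge; apply: contra xik => kn; apply/eqP; rewrite eqn//.
rewrite mulr_gt0 ?expR_gt0//; split => // _ i _.
by apply/eqP; apply/negPn/negP => xii; apply: h; exists i; rewrite eq_sym.
Qed.

Lemma dist_ball_cylinder xi n :
  dist_ball dist xi (2 / eps * expR (- eps * n%:R)) = cylinder (mkseq xi n.+1).
Proof.
by apply/seteqP; split => zeta; rewrite /dist_ball /cylinder /mkset size_mkseq => /dist_ray_lt.
Qed.

Lemma cylinder_mkseq xi n : cylinder (mkseq xi n) xi.
Proof. by rewrite /cylinder /= size_mkseq. Qed.

Lemma mkseq_take xi n m : (m <= n)%N -> mkseq xi m = take m (mkseq xi n).
Proof. by move=> mn; rewrite /mkseq -map_take take_iota (minn_idPl mn). Qed.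

Lemma cylinder_prefix xi n m : (m <= n)%N ->
  cylinder (mkseq xi n) `<=` cylinder (mkseq xi m).
Proof.
move=> mn zeta; rewrite /cylinder/= !size_mkseq => h.
by rewrite (mkseq_take _ mn) h -mkseq_take.
Qed.

Lemma measurable_cylinder w : measurable (cylinder w : set bdry).
Proof.
apply: sub_sigma_algebra => xi xiw.
exists (2 / eps * expR (- eps * (size w)%:R)).
  by rewrite mulr_gt0 ?expR_gt0 ?divr_gt0.
rewrite dist_ball_cylinder; apply: (subset_trans (@cylinder_prefix _ _ (size w) _)) => //.
by rewrite xiw.
Qed.

Lemma measurable_mkseq d (T : measurableType d) (psi : seq (label K) -> T) n :
  measurable_fun [set: bdry] (fun xi => psi (mkseq xi n)).
Proof.
move=> _ Y mY; rewrite setTI.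
rewrite (_ : _ @^-1` Y =
  \bigcup_w (if (size w == n) && `[< Y (psi w) >] then cylinder w else set0)).
  apply: (@countable_bigcupT_measurable _ bdry) => // w.
  by case: ifP => // _; exact: measurable_cylinder.
apply/seteqP; split => xi /=.
  move=> Yxi; exists (mkseq xi n) => //.
  by rewrite size_mkseq eqxx asboolT//; exact: cylinder_mkseq.
move=> [w _]; case: ifP => // /andP[/eqP <- /asboolP Yw].
by rewrite /cylinder /= => ->.
Qed.

Lemma bigsetU_cylinder n :
  [set: ray K] = \big[setU/set0]_(w <- index_enum (n.-tuple (label K))) cylinder w.
Proof.
apply/seteqP; split => xi // _; rewrite -bigcup_seq.
exists (Tuple (introT eqP (size_mkseq xi n))); first by rewrite /= mem_index_enum.
exact: cylinder_mkseq.
Qed.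

Lemma trivIset_cylinder n (s : seq (n.-tuple (label K))) :
  trivIset [set` s] (fun w : n.-tuple _ => cylinder w).
Proof.
move=> v w _ _ [xi [/=]]; rewrite /cylinder/= !size_tuple => h1 h2.
by apply: val_inj; rewrite /= -h1 -h2.
Qed.

Local Open Scope ereal_scope.

Lemma integral_cylinder (nu : {measure set bdry -> \bar R}) n (f : bdry -> \bar R) :
  measurable_fun setT f -> (forall xi, 0 <= f xi) ->
  \int[nu]_xi f xi = \sum_(w : n.-tuple (label K)) \int[nu]_(xi in cylinder w) f xi.
Proof.
move=> mf f0; rewrite (bigsetU_cylinder n) ge0_integral_bigsetU//.
- by move=> w; exact: measurable_cylinder.
- exact: index_enum_uniq.
- exact: trivIset_cylinder.
- by rewrite -bigsetU_cylinder.
Qed.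

Lemma integral_mkseq (nu : {measure set bdry -> \bar R}) n (psi : seq (label K) -> \bar R) :
  (forall w, 0 <= psi w) ->
  \int[nu]_xi psi (mkseq xi n) =
  \sum_(w : n.-tuple (label K)) psi w * nu (cylinder w).
Proof.
move=> psi0; rewrite (integral_cylinder _ n)//; last exact: measurable_mkseq.
apply: eq_bigr => w _; rewrite -integral_cst; last exact: measurable_cylinder.
by apply: eq_integral => xi; rewrite inE /cylinder/= size_tuple => ->.
Qed.

(** There are countably many words, and an open set is the union of the cylinders that it contains.
    This prepares the monotone class argument that identifies a function from its integrals over
    cylinders. *)
Lemma measurable_cylinderE :
  @measurable _ bdry = <<s range (@cylinder K) >>.
Proof.
apply/seteqP; split; last first.
  apply: smallest_sub; first exact: sigma_algebra_measurable.
  by move=> _ [w _ <-]; exact: measurable_cylinder.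
apply: smallest_sub; first exact: smallest_sigma_algebra.
move=> A oA; pose T := g_sigma_algebraType (range (@cylinder K)).
rewrite (_ : A = \bigcup_w (if `[< cylinder w `<=` A >] then cylinder w else set0)).
  apply: (@countable_bigcupT_measurable _ T) => // w.
  by case: ifP => // _; apply: sub_sigma_algebra; exists w.
apply/seteqP; split => xi; last by move=> [w _]; case: asboolP => // wA /wA.
move=> /oA[r r0 rA].
have [n hn] : exists n, (2 / eps * expR (- eps * n%:R) < r)%R.
  exists (Num.truncn (2 / eps / eps / r)).+1; rewrite mulNr expRN ltr_pdivrMr ?expR_gt0//.
  apply: (@lt_le_trans _ _ (r * (eps * (Num.truncn (2 / eps / eps / r)).+1%:R))%R).
    rewrite mulrA -ltr_pdivrMl ?mulr_gt0// mulrC invfM !mulrA.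
    by rewrite (_ : _ / r / eps = 2 / eps / eps / r)%R ?truncnS_gt//; field; rewrite !gt_eqF.
  rewrite ler_pM2l// (le_trans _ (expR_ge1Dx _))// lerDr//.
exists (mkseq xi n.+1) => //; rewrite asboolT; first exact: cylinder_mkseq.
rewrite -dist_ball_cylinder => zeta; rewrite /dist_ball/= => h.
by apply: rA; exact: lt_trans hn.
Qed.

End cylinders.

Section ahlfors.
Context {R : realType} {K : nat} {eps : R}.
Hypotheses (K2 : (2 <= K)%N) (eps0 : 0 < eps).
Local Notation bdry := (@boundary R K eps).
Implicit Types (w : seq (label K)) (n : nat).

(** Two rays with different first letters, which K >= 2 provides, are 2 / eps apart. Hence Ahlfors
    regularity applies to every ball that equals a cylinder of positive size. *)
Lemma diameter_dist_ray : 2 / eps <= diameter (@dist_ray R K eps).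
Proof.
apply: ub_le_sup.
  exists (2 / eps) => _ [xi [zeta ->]]; rewrite /dist_ray; case: pselect => [h|_].
    rewrite ler_piMr ?divr_ge0 ?(ltW eps0)// -expR0 ler_expR mulNr oppr_le0.
    by rewrite mulr_ge0// ltW.
  by rewrite divr_ge0// ltW.
have o01 : ord0 != ord_max :> label K by rewrite -val_eqE/= eq_sym -lt0n -subn1 subn_gt0.
exists (fun=> ord0), (fun=> ord_max); rewrite /dist_ray; case: pselect => [h|[]]; last first.
  by exists 0%N.
case: ex_minnP => -[|k] _; first by rewrite mulr0 expR0 mulr1.
by move=> /(_ 0%N o01).
Qed.

Lemma ahlfors_cylinder (nu : {measure set bdry -> \bar R}) :
  ahlfors_regular (ln K%:R / eps) nu ->
  exists b1 b2, [/\ 0 < b1, 0 < b2 & forall w,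
    ((b1 * expR (- ln K%:R * (size w)%:R))%:E <= nu (cylinder w) <=
     (b2 * expR (- ln K%:R * (size w)%:R))%:E)%E].
Proof.
move=> [c c0 hc]; set Q := ln K%:R / eps.
have K0 : 0 < K%:R :> R by rewrite ltr0n (leq_trans _ K2).
(* A cylinder of size n + 1 is the ball of radius (2 / eps) e^(- eps n), whose Q-th power is (2 /
   eps)^Q K^(-n); the factor K accounts for the shift from n to n + 1. *)
pose a := (2 / eps) `^ Q * K%:R.
have a0 : 0 < a by rewrite mulr_gt0// powR_gt0// divr_gt0.
have hS w : (0 < size w)%N ->
    ((c^-1 * a * expR (- ln K%:R * (size w)%:R))%:E <= nu (cylinder w) <=
     (c * a * expR (- ln K%:R * (size w)%:R))%:E)%E.
  move=> w0; pose n := (size w).-1; have sw : size w = n.+1 by rewrite (prednK w0).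
  have := hc (nth ord0 w) (2 / eps * expR (- eps * n%:R)).
  rewrite dist_ball_cylinder// -sw (mkseq_nth ord0).
  rewrite mulr_gt0 ?expR_gt0 ?divr_gt0//=.
  rewrite (le_trans _ diameter_dist_ray); last first.
    rewrite ler_piMr ?divr_ge0 ?(ltW eps0)// -expR0 ler_expR mulNr oppr_le0.
    by rewrite mulr_ge0// ltW.
  move=> /(_ isT).
  suff -> : (2 / eps * expR (- eps * n%:R)) `^ Q = a * expR (- ln K%:R * (size w)%:R).
    by rewrite !mulrA.
  rewrite powRM ?expR_ge0 ?divr_ge0 ?(ltW eps0)// -expRM /a -mulrA; congr (_ * _).
  transitivity (expR (ln (K%:R : R)) * expR (- ln (K%:R : R) * (size w)%:R)); last by rewrite lnK ?posrE.
  rewrite -expRD; congr expR.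
  by rewrite sw -natr1 /Q; field; rewrite gt_eqF.
(* The empty word is not covered by these balls: its cylinder is bounded below by one cylinder of
   size 1 and above by the sum of all K of them. *)
have nuT : nu setT = (\sum_(w : 1.-tuple (label K)) nu (cylinder w))%E.
  rewrite -[LHS]mul1e -integral_cst//.
  rewrite (integral_mkseq eps0 nu 1 (psi := fun=> 1%E))//.
  by apply: eq_bigr => w _; rewrite mul1e.
exists (c^-1 * a / K%:R), (c * a * K%:R); split.
- by rewrite divr_gt0// mulr_gt0// invr_gt0.
- by rewrite mulr_gt0// mulr_gt0.
case=> [|i w]; last first.
  have /andP[h1 h2] := hS (i :: w) isT; apply/andP; split.
    apply: le_trans h1; rewrite lee_fin ler_pM2r ?expR_gt0//.
    by rewrite ler_pdivrMr// ler_peMr ?ler1n ?(leq_trans _ K2)// mulr_ge0// ?invr_ge0 ltW.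
  apply: (le_trans h2); rewrite lee_fin ler_pM2r ?expR_gt0//.
  by rewrite ler_peMr ?ler1n ?(leq_trans _ K2)// mulr_ge0// ltW.
have -> : cylinder [::] = [set: ray K] by apply/seteqP; split.
rewrite /= mulr0 expR0 !mulr1; apply/andP; split.
  apply: (@le_trans _ _ (nu (cylinder [:: ord0]))).
    have /andP[h _] := hS [:: ord0] isT; apply: le_trans h; rewrite lee_fin/=.
    by rewrite mulr1 expRN lnK ?posrE.
  by apply: le_measure; rewrite ?inE//; exact: measurable_cylinder.
rewrite nuT; apply: (@le_trans _ _ (\sum_(w : 1.-tuple (label K)) (c * a / K%:R)%:E)%E).
  apply: lee_sum => w _; have := hS w; rewrite size_tuple => /(_ isT) /andP[_].
  by rewrite mulr1 expRN lnK ?posrE.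
rewrite sumEFin sumr_const card_tuple expn1 card_label ?(leq_trans _ K2)//.
rewrite lee_fin -[leLHS]mulr_natr divfK ?gt_eqF// ler_peMr ?ler1n ?(leq_trans _ K2)//.
by rewrite mulr_ge0// ltW.
Qed.

End ahlfors.

(** * The Hardy inequality *)

Section hardy.
Context {R : realType} {K : nat} {eps N l q A : R} {Phi : R -> R}.
Hypotheses (eps0 : 0 < eps) (q1 : 1 <= q) (hPhi : power_growth q A Phi).
Hypothesis Nq : N < q * eps.
Local Notation bdry := (@boundary R K eps).
Variable nu : {measure set bdry -> \bar R}.
Implicit Types (W : seq (label K) -> R) (xi : ray K) (n m j : nat).

Definition increment W j xi : R := `|W (mkseq xi j.+1) - W (mkseq xi j)|.

Definition increment_tail W n xi : \bar R :=
  (\sum_(m <oo) (increment W (n + m) xi)%:E)%E.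

Definition scaled_increment W j xi : R := expR (eps * j%:R) * increment W j xi.

Definition increment_energy W : \bar R :=
  (\sum_(j <oo) (level_weight N l j)%:E *
    \int[nu]_xi (Phi (scaled_increment W j xi))%:E)%E.

Lemma increment_ge0 W j xi : 0 <= increment W j xi.
Proof. exact: normr_ge0. Qed.

Lemma increment_tail_ge0 W n xi : (0 <= increment_tail W n xi)%E.
Proof. by apply: nneseries_ge0 => m _ _; rewrite lee_fin increment_ge0. Qed.

Lemma measurable_increment W j : measurable_fun [set: bdry] (increment W j).
Proof.
apply: measurableT_comp => //.
by apply: measurable_funB; exact: (measurable_mkseq eps0).
Qed.

Lemma measurable_increment_tail W n : measurable_fun [set: bdry] (increment_tail W n).
Proof.
rewrite /increment_tail; apply: ge0_emeasurable_sum => [m xi _ _|m _].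
  by rewrite lee_fin increment_ge0.
by apply/measurable_EFinP; exact: measurable_increment.
Qed.

Lemma measurable_Phi_scaled_increment W j :
  measurable_fun [set: bdry] (fun xi => (Phi (scaled_increment W j xi))%:E).
Proof.
apply/measurable_EFinP; apply: measurableT_comp; first by case: hPhi.
by apply: measurable_funM => //; exact: measurable_increment.
Qed.

(* The geometric weight e^(- eps m) of the m-th term of the tail is split into
   a summable part, used in Jensen's inequality, and a part e^(- eps sg m) that
   is moved inside Phi. *)
Lemma tail_growth : exists c s, [/\ 0 < c, c <= 1, N < s &
  forall W n xi,
    (er_map Phi ((c * expR (eps * n%:R))%:E * increment_tail W n xi) <=
     (A ^+ 2)%:E * \sum_(m <oo)
       (expR (- s * m%:R) * Phi (scaled_increment W (n + m) xi))%:E)%E].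
Proof.
have A0 := growth_const_gt0 hPhi.
have q0 : 0 < q by exact: lt_le_trans q1.
(* As N < q eps is strict, a factor sg < 1 can be given away; the maximum with 0 below keeps sg
   positive for N <= 0 as well. *)
have [sg [sg0 sg1 Nsg]] : exists sg, [/\ 0 < sg, sg < 1 & N < eps * sg * q].
  have qe0 : 0 < q * eps by rewrite mulr_gt0.
  pose u := Num.max 0 (N / (q * eps)).
  have u0 : 0 <= u by rewrite le_max lexx.
  have u1 : u < 1 by rewrite gt_max ltr01 ltr_pdivrMr// mul1r.
  have uN : N <= u * (q * eps) by rewrite -ler_pdivrMr// le_max lexx orbT.
  exists ((1 + u) / 2); split; [lra|lra|].
  rewrite (_ : _ * q = (1 + u) / 2 * (q * eps)); last by ring.
  by apply: (le_lt_trans uN); rewrite ltr_pM2r//; lra.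
pose dl := eps * (1 - sg).
have dl0 : 0 < dl by rewrite mulr_gt0// subr_gt0.
(* Normalisation: the weights k e^(- dl m) sum to 1. *)
pose k := 1 - expR (- dl).
have k0 : 0 < k by rewrite subr_gt0 expR_lt1 oppr_lt0.
have k1 : k <= 1 by rewrite gerBl expR_ge0.
exists (k / 2), (eps * sg * q); split => //.
- by rewrite divr_gt0.
- by rewrite ler_pdivrMr// mul1r (le_trans k1)// ler1n.
move=> W n xi; set Y := (\sum_(m <oo) _)%E.
have d0 m : 0 <= scaled_increment W m xi by rewrite mulr_ge0 ?expR_ge0 ?increment_ge0.
(* Stated for real v below the tail, so that an infinite tail can be tested against arbitrarily
   large v. *)
have key v : 0 <= v -> (v%:E <= increment_tail W n xi)%E ->
    ((Phi (k / 2 * expR (eps * n%:R) * v))%:E <= (A ^+ 2)%:E * Y)%E.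
  move=> v0 vle.
  pose w m := k * expR (- dl * m%:R).
  pose a m := expR (- (eps * sg) * m%:R) * scaled_increment W (n + m) xi.
  have w0 m : 0 <= w m by rewrite mulr_ge0 ?expR_ge0 ?ltW.
  have a0 m : 0 <= a m by rewrite mulr_ge0 ?expR_ge0.
  (* As dl + eps sg = eps, the two decaying exponentials cancel the e^(eps m) inside the scaled
     increment. *)
  have wa m : w m * a m = k * expR (eps * n%:R) * increment W (n + m) xi.
    rewrite /w /a /scaled_increment !mulrA; congr (_ * _).
    rewrite -!mulrA; congr (_ * _).
    by rewrite -!expRD; congr expR; rewrite natrD /dl; ring.
  apply: (le_trans (growth_series_jensen q1 hPhi (w := w) (a := a) _ w0 a0 _ _)).
  - by rewrite !mulr_ge0 ?expR_ge0 ?invr_ge0// ltW.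
  - rewrite /w; under eq_eseriesr do rewrite EFinM.
    rewrite nneseriesZl; last by move=> m _; rewrite lee_fin expR_ge0.
    by rewrite nneseries_expR// -EFinM divff// gt_eqF.
  - rewrite (eq_eseriesr (fun m _ => congr1 EFin (wa m))).
    under eq_eseriesr do rewrite EFinM.
    rewrite nneseriesZl; last by move=> m _; rewrite lee_fin increment_ge0.
    rewrite (_ : 2 * _ = k * expR (eps * n%:R) * v); last by field.
    by rewrite EFinM lee_pmul2l// lte_fin mulr_gt0 ?expR_gt0.
  rewrite expr2 EFinM -muleA lee_pmul2l ?lte_fin//.
  rewrite -nneseriesZl; last first.
    by move=> m _; rewrite lee_fin mulr_ge0 ?expR_ge0// (growth_ge0 hPhi).
  apply: lee_nneseries => [m _ _|m _].
    by rewrite lee_fin mulr_ge0// (growth_ge0 hPhi).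
  rewrite -EFinM lee_fin.
  have w1 : w m <= 1.
    rewrite /w mulr_ile1 ?expR_ge0 ?(ltW k0)// -expR0 ler_expR mulNr oppr_le0.
    by rewrite mulr_ge0// ltW.
  apply: (le_trans (ler_piMl (growth_ge0 hPhi _) w1)).
  apply: (le_trans (growth_pow_contract q1 hPhi _ (d0 _))).
    rewrite expR_ge0/= -expR0 ler_expR mulNr oppr_le0.
    by rewrite mulr_ge0// mulr_ge0 ?ltW.
  rewrite le_eqVlt; apply/orP; left; apply/eqP.
  by rewrite -expRM -mulrA; congr (_ * (expR _ * _)); ring.
have ke0 : 0 < k / 2 * expR (eps * n%:R) by rewrite mulr_gt0 ?expR_gt0// divr_gt0.
have Y0 : (0 <= Y)%E.
  apply: nneseries_ge0 => m _ _.
  by rewrite lee_fin mulr_ge0 ?expR_ge0 ?(growth_ge0 hPhi).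
move: (increment_tail_ge0 W n xi) key; case: (increment_tail W n xi) => [v| |]//.
  by rewrite lee_fin => v0 /(_ v v0 (lexx _)).
move=> _ key; rewrite gt0_muley ?lte_fin//=.
move: Y0 key; case: Y => [y| |]//; last first.
  by move=> _ _; rewrite gt0_muley ?lte_fin// exprn_gt0.
rewrite lee_fin => y0 key; exfalso.
have [_ Phi1 _ _] := hPhi.
(* An infinite tail with a finite right side y is impossible: the bound A^2 y on Phi(z) and
   [growth_dominates] would give z <= z - 1. *)
pose z := 2 + A / Phi 1 * (A ^+ 2 * y).
have z0 : 0 <= z.
  by rewrite addr_ge0// mulr_ge0 ?divr_ge0 ?(ltW Phi1) ?(ltW A0)// mulr_ge0// sqr_ge0.
have := key (z / (k / 2 * expR (eps * n%:R))).
rewrite [_ * (z / _)]mulrC divfK ?gt_eqF// divr_ge0 ?(ltW ke0)// leey => /(_ isT isT).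
rewrite -EFinM lee_fin => /(ler_wpM2l (divr_ge0 (ltW A0) (ltW Phi1))).
have := growth_dominates q1 hPhi z0; rewrite {1}/z => h1 h2.
by have := le_trans h1 (lerD (lexx _) h2); rewrite lerD2r leNgt ltr1n.
Qed.

(** After [tail_growth], [level_weight_decay] carries the weight of level n to level n + m at the
    price C e^(- tau m). Once the sums are exchanged, for fixed m the sum over n is a tail of
    [increment_energy], and a geometric series over m remains. *)
Lemma increment_tail_energy : exists c C, [/\ 0 < c, 0 < C &
  forall W,
    (\sum_(n <oo) (level_weight N l n)%:E *
       \int[nu]_xi er_map Phi ((c * expR (eps * n%:R))%:E * increment_tail W n xi) <=
     C%:E * increment_energy W)%E].
Proof.
have A0 := growth_const_gt0 hPhi.
have [c [s [c0 _ Ns htail]]] := tail_growth.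
have [D [tau [D0 tau0 hD]]] := level_weight_decay l Ns.
have e1 : 0 < 1 - expR (- tau) by rewrite subr_gt0 expR_lt1 oppr_lt0.
exists c, (A ^+ 2 * D / (1 - expR (- tau))); split => //.
  by rewrite divr_gt0// mulr_gt0// exprn_gt0.
move=> W; pose B j := (\int[nu]_xi (Phi (scaled_increment W j xi))%:E)%E.
have P0 j xi : (0 <= (Phi (scaled_increment W j xi))%:E)%E.
  by rewrite lee_fin (growth_ge0 hPhi).
have B0 j : (0 <= B j)%E by apply: integral_ge0 => xi _.
have lw0 n : (0 <= (level_weight N l n)%:E)%E by rewrite lee_fin ltW// level_weight_gt0.
have step1 n : (\int[nu]_xi er_map Phi ((c * expR (eps * n%:R))%:E * increment_tail W n xi) <=
    (A ^+ 2)%:E * \sum_(m <oo) (expR (- s * m%:R))%:E * B (n + m)%N)%E.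
  apply: (@le_trans _ _ (\int[nu]_xi ((A ^+ 2)%:E * \sum_(m <oo)
       (expR (- s * m%:R) * Phi (scaled_increment W (n + m) xi))%:E)))%E.
    apply: ge0_le_integral => //.
    - move=> xi _; apply: (growth_er_map_ge0 hPhi).
      by rewrite mule_ge0 ?increment_tail_ge0// lee_fin mulr_ge0 ?expR_ge0 ?ltW.
    - apply: (measurable_growth_er_map hPhi); apply: measurable_funeM.
      exact: measurable_increment_tail.
    - apply: measurable_funeM; apply: ge0_emeasurable_sum => [m xi _ _|m _].
        by rewrite lee_fin mulr_ge0 ?expR_ge0// (growth_ge0 hPhi).
      under eq_fun do rewrite EFinM; apply: measurable_funeM.
      exact: measurable_Phi_scaled_increment.
  rewrite ge0_integralZl//; last 3 first.
  - apply: ge0_emeasurable_sum => [m xi _ _|m _].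
      by rewrite lee_fin mulr_ge0 ?expR_ge0// (growth_ge0 hPhi).
    under eq_fun do rewrite EFinM; apply: measurable_funeM.
    exact: measurable_Phi_scaled_increment.
  - move=> xi _; apply: nneseries_ge0 => m _ _.
    by rewrite lee_fin mulr_ge0 ?expR_ge0// (growth_ge0 hPhi).
  - by rewrite lee_fin sqr_ge0.
  rewrite integral_nneseries//; last 2 first.
  - move=> m; under eq_fun do rewrite EFinM; apply: measurable_funeM.
    exact: measurable_Phi_scaled_increment.
  - by move=> m xi _; rewrite lee_fin mulr_ge0 ?expR_ge0// (growth_ge0 hPhi).
  rewrite le_eqVlt; apply/orP; left; apply/eqP; congr (_ * _)%E.
  apply: eq_eseriesr => m _; under eq_integral do rewrite EFinM.
  rewrite ge0_integralZl// ?lee_fin ?expR_ge0//.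
  exact: measurable_Phi_scaled_increment.
apply: (@le_trans _ _ (\sum_(n <oo) \sum_(m <oo) (A ^+ 2 * D * expR (- tau * m%:R))%:E *
    ((level_weight N l (n + m))%:E * B (n + m)%N)))%E.
  apply: lee_nneseries => [n _ _|n _].
    rewrite mule_ge0// integral_ge0// => xi _; apply: (growth_er_map_ge0 hPhi).
    by rewrite mule_ge0 ?increment_tail_ge0// lee_fin mulr_ge0 ?expR_ge0 ?ltW.
  apply: (le_trans (lee_wpmul2l (lw0 n) (step1 n))).
  rewrite muleA -EFinM -nneseriesZl; last first.
    by move=> m _; rewrite mule_ge0// lee_fin expR_ge0.
  apply: lee_nneseries => [m _ _|m _].
    by rewrite !mule_ge0// ?lee_fin ?expR_ge0// mulr_ge0 ?sqr_ge0// ltW// level_weight_gt0.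
  rewrite !muleA lee_wpmul2r// -!EFinM lee_fin.
  rewrite [_ * A ^+ 2]mulrC -[leLHS]mulrA -[A ^+ 2 * D * _]mulrA -[leRHS]mulrA.
  by rewrite ler_wpM2l ?sqr_ge0.
rewrite nneseries_interchange; last first.
  move=> n m; rewrite !mule_ge0// lee_fin.
  by rewrite !mulr_ge0 ?sqr_ge0 ?expR_ge0// ltW.
apply: (@le_trans _ _ (\sum_(m <oo) (A ^+ 2 * D * expR (- tau * m%:R))%:E * increment_energy W))%E.
  apply: lee_nneseries => [m _ _|m _].
    apply: nneseries_ge0 => n _ _; rewrite !mule_ge0// lee_fin.
    by rewrite !mulr_ge0 ?sqr_ge0 ?expR_ge0// ltW.
  rewrite nneseriesZl; last by move=> n _; rewrite mule_ge0.
  apply: lee_wpmul2l.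
    by rewrite lee_fin !mulr_ge0 ?sqr_ge0 ?expR_ge0// ltW.
  rewrite (nneseries_addn m (f := fun j => (level_weight N l j)%:E * B j)%E); last first.
    by move=> j; rewrite mule_ge0.
  rewrite /increment_energy [leRHS](nneseries_split 0 m)//; last first.
    by move=> j _; apply: mule_ge0; [exact: lw0|exact: B0].
  by rewrite add0n leeDr// sume_ge0// => j _; apply: mule_ge0; [exact: lw0|exact: B0].
have E0 : (0 <= increment_energy W)%E by apply: nneseries_ge0 => j _ _; apply: mule_ge0; [exact: lw0|exact: B0].
under eq_eseriesr do rewrite muleC.
move: E0; case: (increment_energy W) => [e| |]//= e0.
- rewrite nneseriesZl; last first.
    by move=> m _; rewrite lee_fin !mulr_ge0 ?sqr_ge0 ?expR_ge0// ltW.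
  under eq_eseriesr do rewrite EFinM.
  rewrite nneseriesZl; last by move=> m _; rewrite lee_fin expR_ge0.
  by rewrite nneseries_expR// -!EFinM lee_fin mulrC.
- by rewrite gt0_muley ?leey// lte_fin divr_gt0// mulr_gt0// exprn_gt0.
Qed.

End hardy.

(** * Sums over children, limits along rays and means *)

Section almost_everywhere.
Context d (T : measurableType d) (R : realType) (m : {measure set T -> \bar R}).
Implicit Types P Q S : T -> Prop.

Lemma aeS P Q : {ae m, forall x, P x} -> (forall x, P x -> Q x) ->
  {ae m, forall x, Q x}.
Proof. by move=> aeP PQ; apply: filterS aeP. Qed.

Lemma aeS2 P Q S : {ae m, forall x, P x} -> {ae m, forall x, Q x} ->
  (forall x, P x -> Q x -> S x) -> {ae m, forall x, S x}.
Proof. by move=> aeP aeQ PQS; apply: filterS2 aeP aeQ. Qed.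

End almost_everywhere.

Section mother_sum.
Context {R : realType} {K : nat}.
Hypothesis K2 : (2 <= K)%N.

Lemma mother_rcons (v : seq (label K)) i : mother (rcons v i) = v.
Proof. by rewrite /mother size_rcons/= -cats1 take_size_cat. Qed.

Lemma size_mother (w : seq (label K)) : size (mother w) = (size w).-1.
Proof. by rewrite size_takel// leq_pred. Qed.

Lemma sum_mother n (psi : seq (label K) -> \bar R) : (forall w, 0 <= psi w)%E ->
  (\sum_(w : n.+1.-tuple (label K)) psi (mother w) =
   K%:R%:E * \sum_(v : n.-tuple (label K)) psi v)%E.
Proof.
move=> psi0; have K0 : (0 < K)%N by exact: leq_trans K2.
pose g (p : n.-tuple (label K) * label K) : n.+1.-tuple (label K) :=
  [tuple of rcons p.1 p.2].
have ginj : injective g.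
  move=> [v i] [v' i'] /(congr1 val)/= /rcons_inj[vv ->]; congr pair.
  exact: val_inj.
have /inj_card_bij gb : (#|{: n.+1.-tuple (label K)}| <= #|{: n.-tuple (label K) * label K}|)%N.
  by rewrite card_prod !card_tuple expnSr.
rewrite (reindex g)/=; last by apply: onW_bij; exact: gb ginj.
transitivity (\sum_(v : n.-tuple (label K)) \sum_(i : label K) psi (mother (rcons v i)))%E.
  by rewrite pair_bigA.
rewrite ge0_sume_distrr//; apply: eq_bigr => v _.
under eq_bigr do rewrite mother_rcons.
by rewrite sumr_const card_label// mule_natl.
Qed.

End mother_sum.

Section tail_limit.
Context {R : realType} {K : nat}.
Implicit Types (W : seq (label K) -> R) (xi : ray K) (n : nat).

Lemma increment_tail_cvg W xi : (increment_tail W 0 xi < +oo)%E ->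
  cvgn (fun n => W (mkseq xi n)).
Proof.
move=> /nnseries_is_cvg => /(_ (fun i => increment_ge0 W i xi)) h.
pose u j := W (mkseq xi j.+1) - W (mkseq xi j).
have /normed_cvg cu : cvgn [normed series u] by exact: h.
rewrite (_ : (fun n => _) = (fun n => series u n + W (mkseq xi 0))).
  by apply: is_cvgD => //; exact: is_cvg_cst.
by apply/funext => n; rewrite /series/= telescope_sumr// subrK.
Qed.

Lemma increment_tail_bound W xi (f : R) n :
  W (mkseq xi m) @[m --> \oo] --> f ->
  (`|f - W (mkseq xi n)|%:E <= increment_tail W n xi)%E.
Proof.
move=> Wf.
have hM M : (`|W (mkseq xi (n + M)%N) - W (mkseq xi n)|%:E <= increment_tail W n xi)%E.
  apply: (@le_trans _ _ (\sum_(0 <= m < M) (increment W (n + m) xi)%:E)%E); last first.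
    by apply: nneseries_lim_ge => m _ _; rewrite lee_fin increment_ge0.
  rewrite sumEFin lee_fin.
  have := @telescope_sumr R 0 M (fun m => W (mkseq xi (n + m)%N)) (leq0n _).
  rewrite addn0 => <-; apply: (le_trans (ler_norm_sum _ _ _)).
  by apply: ler_sum => m _; rewrite /increment addnS.
have := increment_tail_ge0 W n xi.
move: hM; case: (increment_tail W n xi) => [v| |]//; last by move=> _ _; rewrite leey.
move=> hM _; rewrite lee_fin.
have cv : `|W (mkseq xi (M + n)%N) - W (mkseq xi n)| @[M --> \oo] --> `|f - W (mkseq xi n)|.
  apply: cvg_norm; apply: cvgB; last exact: cvg_cst.
  by rewrite (cvg_shiftn n (fun m => W (mkseq xi m))).
rewrite -(cvg_lim _ cv)//; apply: limr_le; first by apply/cvg_ex; exists `|f - W (mkseq xi n)|.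
by apply: nearW => M; have := hM M; rewrite lee_fin addnC.
Qed.

End tail_limit.

Section mean.
Context d (T : measurableType d) (R : realType) (m : {measure set T -> \bar R}).
Implicit Types (D : set T) (f g : T -> R) (a : R).

Definition mean D f : R := (fine (m D))^-1 * \int[m]_(x in D) f x.

Lemma integrable_fin_cst D a : measurable D -> (m D < +oo)%E ->
  m.-integrable D (EFin \o cst a).
Proof.
move=> mD mDoo; apply/integrableP; split; first exact: (@measurable_cst _ _ T _ D a%:E).
have mDf : m D \is a fin_num by rewrite ge0_fin_numE.
by rewrite /= integral_cst// -(fineK mDf) -EFinM ltry.
Qed.

Lemma mean_dev D f a : measurable D -> m.-integrable D (EFin \o f) ->
  (0 < m D < +oo)%E ->
  (`|mean D f - a|%:E * m D <= \int[m]_(x in D) `|f x - a|%:E)%E.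
Proof.
move=> mD fD /andP[D0 Doo].
have mDf : m D \is a fin_num by rewrite ge0_fin_numE.
have d0 : 0 < fine (m D) by rewrite fine_gt0// D0.
have aD := integrable_fin_cst a mD Doo.
have fai : m.-integrable D (EFin \o (fun x => f x - a)).
  by have := integrableB mD fD aD.
have -> : mean D f - a = (fine (m D))^-1 * \int[m]_(x in D) (f x - a).
  rewrite RintegralB//.
  by rewrite Rintegral_cst// mulrBr [a * _]mulrC mulKf// gt_eqF.
rewrite -{2}(fineK mDf) -EFinM normrM ger0_norm ?invr_ge0 ?(ltW d0)//.
rewrite mulrC mulVKf ?gt_eqF//.
have := le_normr_Rintegral mD fai; rewrite -lee_fin => /le_trans; apply.
rewrite /Rintegral fineK//; apply: integrable_fin_num => //.
exact: integrable_norm.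
Qed.

Lemma mean_dev_le D f a (G : R) : measurable D -> m.-integrable D (EFin \o f) ->
  (0 < m D < +oo)%E -> (forall x, D x -> `|f x - a| <= G) ->
  `|mean D f - a| <= G.
Proof.
move=> mD fD Dp fG; have /andP[D0 Doo] := Dp.
have mDf : m D \is a fin_num by rewrite ge0_fin_numE.
have d0 : 0 < fine (m D) by rewrite fine_gt0// D0.
rewrite -(ler_pM2r d0) -lee_fin !EFinM fineK//.
apply: (le_trans (mean_dev a mD fD Dp)); rewrite -integral_cst//.
apply: ge0_le_integral => //.
- apply/measurable_EFinP; apply: measurableT_comp => //.
  by apply: measurable_funB => //; apply/measurable_EFinP; case/integrableP: fD.
Qed.

Lemma meanZr D f a : measurable D -> m.-integrable D (EFin \o f) ->
  mean D (fun x => f x * a) = mean D f * a.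
Proof. by move=> mD fD; rewrite /mean RintegralZr// mulrA. Qed.

Lemma mean_linear D a f g : measurable D ->
  m.-integrable D (EFin \o f) -> m.-integrable D (EFin \o g) ->
  mean D (fun x => a * f x + g x) = a * mean D f + mean D g.
Proof.
move=> mD fD gD; rewrite /mean RintegralD//; last first.
  by have := integrableZl mD a fD.
by rewrite RintegralZl// mulrDr mulrCA.
Qed.

Lemma mean_ae_eq D f g : measurable D ->
  measurable_fun D f -> measurable_fun D g ->
  {ae m, forall x, f x = g x} -> mean D f = mean D g.
Proof.
move=> mD mf mg fg; rewrite /mean /Rintegral; congr (_ * fine _).
apply: ae_eq_integral => //; [exact/measurable_EFinP|exact/measurable_EFinP|].
by apply: (aeS fg) => x -> _.
Qed.

End mean.

Section cylinder_mean.
Context {R : realType} {K : nat} {eps : R}.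
Hypothesis eps0 : 0 < eps.
Local Notation bdry := (@boundary R K eps).
Variable nu : {measure set bdry -> \bar R}.
Hypothesis nuoo : (nu setT < +oo)%E.
Implicit Types (f : bdry -> R) (w : seq (label K)).

Lemma cylinder_lty w : (nu (cylinder w) < +oo)%E.
Proof.
apply: le_lt_trans nuoo; apply: le_measure; rewrite ?inE//.
exact: measurable_cylinder.
Qed.

Lemma integrable_cylinder f w : nu.-integrable setT (EFin \o f) ->
  nu.-integrable (cylinder w) (EFin \o f).
Proof. by apply: integrableS => //; exact: measurable_cylinder. Qed.

Lemma cylinder_mean_dev f w (a : R) : nu.-integrable setT (EFin \o f) ->
  (0 < nu (cylinder w))%E ->
  (`|cylinder_mean nu f w - a|%:E * nu (cylinder w) <=
   \int[nu]_(xi in cylinder w) `|f xi - a|%:E)%E.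
Proof.
move=> fi I0; apply: (mean_dev a (measurable_cylinder eps0 w)).
  exact: integrable_cylinder.
by rewrite I0 cylinder_lty.
Qed.

Lemma cylinder_meanZ f w (a : R) : nu.-integrable setT (EFin \o f) ->
  cylinder_mean nu (fun xi => f xi * a) w = cylinder_mean nu f w * a.
Proof.
move=> fi; apply: (meanZr _ (measurable_cylinder eps0 w)).
exact: integrable_cylinder.
Qed.

End cylinder_mean.

(** * Besov bounds for limits of vertex functions of finite energy *)

Section besov_bound.
Context {R : realType} {K : nat} {eps N l q A theta p : R} {Phi : R -> R}.
Hypotheses (K2 : (2 <= K)%N) (eps0 : 0 < eps) (q1 : 1 <= q).
Hypotheses (hPhi : power_growth q A Phi) (Nq : N < q * eps).
Hypothesis Ntheta : eps * (theta - 1) * p = - N.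
Local Notation bdry := (@boundary R K eps).
Variables (nu : {measure set bdry -> \bar R}) (b1 b2 : R).
Hypotheses (b10 : 0 < b1) (b20 : 0 < b2).
Hypothesis nub : forall w, ((b1 * expR (- ln K%:R * (size w)%:R))%:E <= nu (cylinder w) <=
     (b2 * expR (- ln K%:R * (size w)%:R))%:E)%E.
Local Notation energy := (@increment_energy R K eps N l Phi nu).
Implicit Types (W : seq (label K) -> R) (f : bdry -> R) (w : seq (label K)).

Lemma nu_setT_lty : (nu setT < +oo)%E.
Proof.
have -> : [set: bdry] = cylinder [::] by apply/seteqP; split.
by have /andP[_ /le_lt_trans] := nub [::]; apply; rewrite ltry.
Qed.

Lemma nu_cylinder_gt0 w : (0 < nu (cylinder w))%E.
Proof.
have /andP[h _] := nub w; apply: lt_le_trans h.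
by rewrite lte_fin mulr_gt0// expR_gt0.
Qed.

Lemma nu_cylinder_mother w : (0 < size w)%N ->
  (nu (cylinder (mother w)) <= (b2 * K%:R / b1)%:E * nu (cylinder w))%E.
Proof.
move=> w0; have /andP[_ h2] := nub (mother w); have /andP[h1 _] := nub w.
have K0 : 0 < K%:R :> R by rewrite ltr0n (leq_trans _ K2).
apply: (le_trans h2); have := @lee_wpmul2l _ (b2 * K%:R / b1)%:E.
rewrite lee_fin divr_ge0 ?mulr_ge0 ?(ltW b10) ?(ltW b20)// => /(_ isT _ _ h1).
apply: le_trans; rewrite -EFinM lee_fin size_mother le_eqVlt; apply/orP; left; apply/eqP.
have -> : (size w)%:R = (size w).-1%:R + 1 :> R by rewrite natr1 (prednK w0).
rewrite mulrDr mulr1 expRD [expR (- ln _)]expRN lnK ?posrE//.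
by field; rewrite !gt_eqF.
Qed.

Lemma le_nu_cylinder_mother w : (nu (cylinder w) <= nu (cylinder (mother w)))%E.
Proof.
apply: le_measure; rewrite ?inE; first exact: measurable_cylinder.
  exact: measurable_cylinder.
move=> xi; rewrite /cylinder/= => xiw.
by rewrite size_mother -{2}xiw /mother size_mkseq -mkseq_take ?leq_pred.
Qed.

(** The term n = 0 of the Hardy inequality bounds the modular of a multiple of the full tail; as nu
    is finite, this bounds its integral. *)
Lemma increment_tail_integrable W : (energy W < +oo)%E ->
  nu.-integrable setT (increment_tail W 0).
Proof.
move=> Woo; have [c [C [c0 C0 /(_ W) h]]] := increment_tail_energy (l := l) eps0 q1 hPhi Nq nu.
have m0 : measurable_fun [set: bdry] (increment_tail W 0).
  exact: (measurable_increment_tail eps0).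
have mc : measurable_fun [set: bdry] (fun xi => c%:E * increment_tail W 0 xi)%E.
  exact: measurable_funeM.
have ce0 xi : (0 <= c%:E * increment_tail W 0 xi)%E.
  by rewrite mule_ge0 ?increment_tail_ge0// lee_fin ltW.
have hb := @growth_integral_bound _ _ _ _ q1 hPhi _ bdry nu setT _ measurableT mc (fun xi _ => ce0 xi).
have X : (\int[nu]_xi er_map Phi (c%:E * increment_tail W 0 xi) < +oo)%E.
  have Goo : (C%:E * energy W < +oo)%E.
    have e0 : (0 <= energy W)%E.
      apply: nneseries_ge0 => n _ _; rewrite mule_ge0//.
        by rewrite lee_fin ltW// level_weight_gt0.
      by apply: integral_ge0 => xi _; rewrite lee_fin (growth_ge0 hPhi).
    have efin : energy W \is a fin_num by rewrite ge0_fin_numE.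
    by rewrite -(fineK efin) -EFinM ltry.
  apply: le_lt_trans Goo; apply: le_trans h.
  have t0 n : (0 <= (level_weight N l n)%:E *
     \int[nu]_xi er_map Phi ((c * expR (eps * n%:R))%:E * increment_tail W n xi))%E.
    rewrite mule_ge0//; first by rewrite lee_fin ltW// level_weight_gt0.
    apply: integral_ge0 => xi _; apply: (growth_er_map_ge0 hPhi).
    by rewrite mule_ge0 ?increment_tail_ge0// lee_fin mulr_ge0 ?expR_ge0// ltW.
  have := nneseries_lim_ge (u_ := (fun n => (level_weight N l n)%:E *
     \int[nu]_xi er_map Phi ((c * expR (eps * n%:R))%:E * increment_tail W n xi))%E)
     (P := xpredT) (m := 0) 1 (fun n _ _ => t0 n).
  rewrite big_nat1 level_weight0 mul1e; apply: le_trans.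
  by rewrite mulr0 expR0 mulr1.
apply/integrableP; split => //.
have : (\int[nu]_xi (c%:E * increment_tail W 0 xi) < +oo)%E.
  apply: (le_lt_trans hb).
  apply: lte_add_pinfty; first exact: nu_setT_lty.
  have X0 : (0 <= \int[nu]_xi er_map Phi (c%:E * increment_tail W 0 xi))%E.
    by apply: integral_ge0 => xi _; exact: (growth_er_map_ge0 hPhi).
  have Xf : (\int[nu]_xi er_map Phi (c%:E * increment_tail W 0 xi))%E \is a fin_num.
    by rewrite ge0_fin_numE.
  by rewrite -(fineK Xf) -EFinM ltry.
rewrite ge0_integralZl//; last 2 first.
- by move=> xi _; exact: increment_tail_ge0.
- by rewrite lee_fin ltW.
have -> : (\int[nu]_xi `|increment_tail W 0 xi| = \int[nu]_xi increment_tail W 0 xi)%E.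
  by apply: eq_integral => xi _; rewrite gee0_abs ?increment_tail_ge0.
case: (integral _ _ _) => [x _| |]; [by rewrite ltry| |by []].
by rewrite gt0_muley ?lte_fin.
Qed.

Lemma increment_tail_ae W : (energy W < +oo)%E ->
  {ae nu, forall xi, (increment_tail W 0 xi < +oo)%E}.
Proof.
move=> /increment_tail_integrable /(integrable_ae measurableT) h.
apply: (aeS h) => xi /(_ I); rewrite ge0_fin_numE//; exact: increment_tail_ge0.
Qed.

(** Everything rests on |f - W_n| <= tail_n. For n = 0 the normalisation W [::] = 0 turns it into a
    bound on f itself, out of reach of an energy that sees only differences. For larger n it
    controls the oscillation of the means of f. *)
Lemma energy_limit_bound : exists2 c, 0 < c & forall W f,
  W [::] = 0 -> (energy W <= 1)%E -> measurable_fun setT f ->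
  {ae nu, forall xi, W (mkseq xi n) @[n --> \oo] --> f xi} ->
  [/\ nu.-integrable setT (EFin \o f),
      (\int[nu]_xi (Phi (`|f xi| / c))%:E <= 1)%E &
      (besov_energy theta p l Phi nu (fun xi => (f xi / c)%R) <= 1)%E].
Proof.
have A0 := growth_const_gt0 hPhi.
have [c0 [C0 [c00 C00 htail]]] := increment_tail_energy (l := l) eps0 q1 hPhi Nq nu.
have K0 : 0 < K%:R :> R by rewrite ltr0n (leq_trans _ K2).
(* [B] adds the contributions of the means over w and over its mother, the former after comparing
   the nu-masses of the two cylinders. In [a] below, 2 is the loss in [growth_jensen] and e^eps the
   passage from the scale of level n + 1 to that of level n. *)
pose B := b2 * K%:R / b1 + 1.
have B1 : 1 <= B by rewrite lerDr divr_ge0// ?mulr_ge0// ltW.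
have B0 : 0 < B by exact: lt_le_trans B1.
pose a := 2 * B * expR eps / c0.
have a0 : 0 < a by rewrite divr_gt0// mulr_gt0 ?expR_gt0// mulr_gt0.
(* One summand per requirement: (c0 c)^-1 <= 1, modular of f / c at most 1, a / c <= 1, Besov energy
   of f / c at most 1. *)
pose c := c0^-1 + A ^+ 2 * C0 / c0 + a + A ^+ 2 * K%:R * expR (- N) * C0 * a.
have p1 : 0 < c0^-1 by rewrite invr_gt0.
have p2 : 0 < A ^+ 2 * C0 / c0 by rewrite divr_gt0// mulr_gt0// exprn_gt0.
have p3 : 0 < A ^+ 2 * K%:R * expR (- N) * C0 * a.
  by rewrite mulr_gt0// mulr_gt0// mulr_gt0 ?expR_gt0// mulr_gt0// exprn_gt0.
have cp : 0 < c by rewrite /c; lra.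
exists c => // W f W0 WE mf Wf.
have Woo : (energy W < +oo)%E by rewrite (le_lt_trans WE)// ltry.
have tint := increment_tail_integrable Woo.
pose h n xi := ((c0 * expR (eps * n%:R))%:E * increment_tail W n xi)%E.
have h0 n xi : (0 <= h n xi)%E.
  by rewrite mule_ge0 ?increment_tail_ge0// lee_fin mulr_ge0 ?expR_ge0// ltW.
have mh n : measurable_fun [set: bdry] (h n).
  by apply: measurable_funeM; exact: (measurable_increment_tail eps0).
have hP0 n xi : (0 <= er_map Phi (h n xi))%E by exact: (growth_er_map_ge0 hPhi).
have mhP n : measurable_fun [set: bdry] (fun xi => er_map Phi (h n xi)).
  exact: (measurable_growth_er_map hPhi).
pose X n := (\int[nu]_xi er_map Phi (h n xi))%E.
have X0 n : (0 <= X n)%E by apply: integral_ge0.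
have lw0 n : (0 <= (level_weight N l n)%:E)%E by rewrite lee_fin ltW// level_weight_gt0.
have XS : (\sum_(n <oo) (level_weight N l n)%:E * X n <= C0%:E)%E.
  apply: (le_trans (htail W)); rewrite -[leRHS]mule1.
  by apply: lee_wpmul2l => //; rewrite lee_fin ltW.
have X0C : (X 0%N <= C0%:E)%E.
  apply: le_trans XS.
  have := nneseries_lim_ge (u_ := (fun n => (level_weight N l n)%:E * X n)%E)
     (P := xpredT) (m := 0) 1 (fun n _ _ => mule_ge0 (lw0 n) (X0 n)).
  by rewrite big_nat1 level_weight0 mul1e.
have dev n : {ae nu, forall xi, (`|f xi - W (mkseq xi n)|%:E <= increment_tail W n xi)%E}.
  by apply: (aeS Wf) => xi; exact: increment_tail_bound.
have fint : nu.-integrable setT (EFin \o f).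
  apply/integrableP; split; first exact/measurable_EFinP.
  apply: (@le_lt_trans _ _ (\int[nu]_xi increment_tail W 0 xi)%E).
    apply: ae_ge0_le_integral => //.
    - by do 2 apply: measurableT_comp => //.
    - by move=> xi _; exact: increment_tail_ge0.
    - exact: (measurable_increment_tail eps0).
    apply: (aeS (dev 0%N)) => xi; rewrite [mkseq _ _]/= W0 subr0 => + _.
    exact: le_trans.
  have -> : (\int[nu]_xi increment_tail W 0 xi = \int[nu]_xi `|increment_tail W 0 xi|)%E.
    by apply: eq_integral => xi _; rewrite gee0_abs ?increment_tail_ge0.
  by case/integrableP : tint.
split => //.
  apply: (@le_trans _ _ (\int[nu]_xi ((A ^+ 2 / (c0 * c))%:E * er_map Phi (h 0%N xi)))%E).
    apply: ae_ge0_le_integral => //.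
    - by move=> xi _; rewrite lee_fin (growth_ge0 hPhi).
    - apply/measurable_EFinP; apply: measurableT_comp; first by case: hPhi.
      by apply: measurable_funM => //; exact: measurableT_comp.
    - by move=> xi _; rewrite mule_ge0// ?hP0// lee_fin divr_ge0 ?sqr_ge0// mulr_ge0// ltW.
    - exact: measurable_funeM.
    apply: (aeS (dev 0%N)) => xi; rewrite [mkseq _ _]/= W0 subr0 => + _.
    have c0c : 0 < c0 * c by rewrite mulr_gt0.
    rewrite /h mulr0 expR0 mulr1; case: (increment_tail W 0 xi) => [y| |]//; last first.
      move=> _; rewrite (_ : c0%:E * +oo = +oo)%E; last by rewrite gt0_muley ?lte_fin.
      by rewrite gt0_muley ?leey// lte_fin divr_gt0// exprn_gt0.
    rewrite lee_fin => fy; rewrite -!EFinM /= lee_fin.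
    rewrite (_ : `|f xi| / c = (c0 * c)^-1 * (c0 * `|f xi|)); last by field; rewrite !gt_eqF.
    have c01 : 0 <= (c0 * c)^-1 <= 1.
      rewrite invr_ge0 (ltW c0c)/= invf_le1// -ler_pdivrMl// mulr1.
      by rewrite /c; lra.
    have f0 : 0 <= c0 * `|f xi| by rewrite mulr_ge0// ltW.
    apply: (le_trans (growth_contract q1 hPhi c01 f0)).
    have fm : Phi (c0 * `|f xi|) <= A * Phi (c0 * y).
      by apply: (growth_mono q1 hPhi); rewrite f0/= ler_pM2l.
    have Ac : 0 <= A * (c0 * c)^-1 by rewrite mulr_ge0 ?invr_ge0 ?(ltW A0) ?(ltW c0c).
    apply: (le_trans (ler_wpM2l Ac fm)).
    by rewrite expr2 mulrA [A / _ * A]mulrAC.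
  rewrite ge0_integralZl//; last first.
    by rewrite lee_fin divr_ge0 ?sqr_ge0// mulr_ge0// ltW.
  apply: (@le_trans _ _ ((A ^+ 2 / (c0 * c))%:E * C0%:E)%E).
    apply: lee_wpmul2l => //.
    by rewrite lee_fin divr_ge0 ?sqr_ge0// mulr_ge0// ltW.
  rewrite -EFinM lee_fin.
  rewrite (_ : A ^+ 2 / (c0 * c) * C0 = A ^+ 2 * C0 / c0 / c); last by field; rewrite !gt_eqF.
  by rewrite ler_pdivrMr// mul1r /c; lra.
pose r := a / c.
have r0 : 0 < r by rewrite divr_gt0.
have r1 : r <= 1 by rewrite ler_pdivrMr// mul1r /c; lra.
(* Both means are compared with the number W (mother w), the constant value of W_n on the cylinder
   of mother w. There f differs from it by at most tail_n, and Jensen is applied on this larger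
   cylinder. *)
have level n (w : n.+1.-tuple (label K)) :
  (nu (cylinder w) * (Phi (`|cylinder_mean nu (fun xi => f xi / c) w -
      cylinder_mean nu (fun xi => f xi / c) (mother w)| / expR (- eps * n.+1%:R)))%:E <=
   (A ^+ 2 * r)%:E * \int[nu]_(xi in cylinder (mother w)) er_map Phi (h n xi))%E.
  rewrite !(cylinder_meanZ eps0)// -mulrBl.
  set v := cylinder_mean nu f w - _.
  have sw : size (mother w) = n by rewrite size_mother size_tuple.
  have mI' := measurable_cylinder eps0 (mother w).
  pose t := c0 * expR (eps * n%:R) * `|v| / (2 * B).
  have t0 : 0 <= t.
    by rewrite divr_ge0// ?mulr_ge0 ?expR_ge0 ?(ltW c00) ?(ltW B0).
  rewrite (_ : `|v * c^-1| / expR (- eps * n.+1%:R) = r * t); last first.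
    rewrite normrM [`|c^-1|]gtr0_norm ?invr_gt0// mulNr expRN invrK /r /t /a.
    have -> : expR (eps * n.+1%:R) = expR eps * expR (eps * n%:R).
      by rewrite -expRD; congr expR; rewrite -natr1; ring.
    by field; rewrite !gt_eqF.
  have devI u : (mother w = u \/ tval w = u) ->
      (`|cylinder_mean nu f u - W (mother w)|%:E * nu (cylinder u) <=
       \int[nu]_(xi in cylinder (mother w)) increment_tail W n xi)%E.
    move=> hu; apply: (le_trans (cylinder_mean_dev eps0 nu_setT_lty _ fint (nu_cylinder_gt0 u))).
    have mIu := measurable_cylinder eps0 u.
    have su : cylinder u `<=` cylinder (mother w).
      case: hu => <- // xi; rewrite /cylinder/= sw size_tuple => xiw.
      by rewrite (mkseq_take _ (leqnSn n)) xiw /mother size_tuple.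
    apply: (@le_trans _ _ (\int[nu]_(xi in cylinder u) increment_tail W n xi)%E); last first.
      apply: ge0_subset_integral => //.
        apply: measurable_funTS; exact: (measurable_increment_tail eps0).
      by move=> xi _; exact: increment_tail_ge0.
    apply: ae_ge0_le_integral => //.
    - apply: measurable_funTS; apply/measurable_EFinP; apply: measurableT_comp => //.
      exact: measurable_funB.
    - by move=> xi _; exact: increment_tail_ge0.
    - apply: measurable_funTS; exact: (measurable_increment_tail eps0).
    apply: (aeS (dev n)) => xi + xiu.
    by have := su _ xiu; rewrite /cylinder/= sw => ->.
  have vI : (`|v|%:E * nu (cylinder (mother w)) <=
      B%:E * \int[nu]_(xi in cylinder (mother w)) increment_tail W n xi)%E.
    have := devI _ (or_introl erefl); have := devI _ (or_intror erefl).
    set Y := (integral _ _ _) => h1 h2.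
    have vle : `|v| <= `|cylinder_mean nu f w - W (mother w)| +
                      `|cylinder_mean nu f (mother w) - W (mother w)|.
      rewrite (_ : v = cylinder_mean nu f w - W (mother w) -
        (cylinder_mean nu f (mother w) - W (mother w))); last by rewrite /v; ring.
      exact: ler_normB.
    apply: (@le_trans _ _ ((`|cylinder_mean nu f w - W (mother w)| +
                      `|cylinder_mean nu f (mother w) - W (mother w)|)%:E *
                      nu (cylinder (mother w)))%E).
      by rewrite lee_wpmul2r.
    rewrite EFinD ge0_muleDl ?lee_fin// /B [in leRHS]EFinD ge0_muleDl ?lee_fin//; last first.
      by rewrite divr_ge0 ?mulr_ge0// ltW.
    rewrite mul1e leeD//.
    apply: (@le_trans _ _ (`|cylinder_mean nu f w - W (mother w)|%:E *
       ((b2 * K%:R / b1)%:E * nu (cylinder w)))%E).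
      by rewrite lee_wpmul2l ?lee_fin// nu_cylinder_mother// size_tuple.
    rewrite muleCA lee_wpmul2l// lee_fin divr_ge0 ?mulr_ge0// ltW//.
  have tI : ((2 * t)%:E * nu (cylinder (mother w)) <=
      \int[nu]_(xi in cylinder (mother w)) h n xi)%E.
    rewrite /h ge0_integralZl//; last 3 first.
    - apply: measurable_funTS; exact: (measurable_increment_tail eps0).
    - by move=> xi _; exact: increment_tail_ge0.
    - by rewrite lee_fin mulr_ge0 ?expR_ge0// ltW.
    rewrite (_ : 2 * t = (c0 * expR (eps * n%:R) / B) * `|v|); last first.
      by rewrite /t; field; rewrite gt_eqF.
    rewrite EFinM -muleA.
    have /(lee_wpmul2l (x := (c0 * expR (eps * n%:R) / B)%:E)) := vI.
    rewrite lee_fin divr_ge0 ?mulr_ge0 ?expR_ge0 ?(ltW c00) ?(ltW B0)// => /(_ isT) /le_trans; apply.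
    by rewrite muleA -EFinM divfK// gt_eqF.
  have mhI : measurable_fun (cylinder (mother w) : set bdry) (h n).
    by apply: measurable_funTS; exact: mh.
  have := @growth_jensen _ _ _ _ q1 hPhi _ bdry nu _ _ mI' mhI (fun xi _ => h0 n xi) t t0
    (cylinder_lty eps0 nu_setT_lty _) tI.
  move=> hJ.
  apply: (@le_trans _ _ ((A * r)%:E * ((Phi t)%:E * nu (cylinder (mother w))))%E).
    rewrite muleC muleA -EFinM.
    apply: lee_pmul => //; first by rewrite lee_fin (growth_ge0 hPhi).
      by rewrite lee_fin (growth_contract q1 hPhi) ?(ltW r0).
    exact: le_nu_cylinder_mother.
  rewrite (_ : A ^+ 2 * r = A * r * A); last by ring.
  rewrite (EFinM (A * r) A) -muleA.
  by apply: lee_wpmul2l => //; rewrite lee_fin mulr_ge0// ltW.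
have sum_level n : (\sum_(w : n.+1.-tuple (label K))
    nu (cylinder w) * (Phi (`|cylinder_mean nu (fun xi => f xi / c) w -
      cylinder_mean nu (fun xi => f xi / c) (mother w)| / expR (- eps * n.+1%:R)))%:E <=
   (A ^+ 2 * r * K%:R)%:E * X n)%E.
  apply: (@le_trans _ _ (\sum_(w : n.+1.-tuple (label K)) (A ^+ 2 * r)%:E *
    \int[nu]_(xi in cylinder (mother w)) er_map Phi (h n xi))%E).
    by apply: lee_sum => w _; exact: level.
  rewrite -ge0_sume_distrr; last by move=> w _; exact: integral_ge0.
  rewrite (sum_mother K2 n (psi := fun v => \int[nu]_(xi in cylinder v) er_map Phi (h n xi)))%E; last first.
    by move=> w; exact: integral_ge0.
  by rewrite -(integral_cylinder eps0)// muleA -EFinM.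
rewrite /besov_energy -nneseries_addn; last first.
  move=> n; apply: mule_ge0; first by rewrite lee_fin mulr_ge0 ?expR_ge0 ?powR_ge0.
  by apply: sume_ge0 => w _; rewrite mule_ge0// lee_fin (growth_ge0 hPhi).
apply: (@le_trans _ _ (\sum_(n <oo) (expR (- N) * (A ^+ 2 * r * K%:R))%:E *
    ((level_weight N l n)%:E * X n))%E).
  apply: lee_nneseries => [n _ _|n _].
    apply: mule_ge0; first by rewrite lee_fin mulr_ge0 ?expR_ge0 ?powR_ge0.
    by apply: sume_ge0 => w _; rewrite mule_ge0// lee_fin (growth_ge0 hPhi).
  rewrite addn1.
  rewrite (_ : expR (eps * n.+1%:R * (theta - 1) * p) * n.+1%:R `^ l = expR (- N) * level_weight N l n); last first.
    rewrite /level_weight mulrA -expRD; congr (expR _ * _).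
    rewrite (_ : eps * n.+1%:R * (theta - 1) * p = (eps * (theta - 1) * p) * n.+1%:R); last by ring.
    by rewrite Ntheta -natr1; ring.
  have el0 : (0 <= (expR (- N) * level_weight N l n)%:E)%E.
    by rewrite lee_fin mulr_ge0 ?expR_ge0 ?ltW ?level_weight_gt0.
  apply: (le_trans (lee_wpmul2l el0 (sum_level n))).
  by rewrite !muleA -!EFinM; apply: lee_wpmul2r => //; rewrite lee_fin mulrAC.
rewrite nneseriesZl; last by move=> n _; rewrite mule_ge0.
apply: (@le_trans _ _ ((expR (- N) * (A ^+ 2 * r * K%:R))%:E * C0%:E)%E).
  apply: lee_wpmul2l => //.
  by rewrite lee_fin mulr_ge0 ?expR_ge0// mulr_ge0// mulr_ge0 ?sqr_ge0// ltW.
rewrite -EFinM lee_fin /r.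
rewrite (_ : _ * C0 = A ^+ 2 * K%:R * expR (- N) * C0 * a / c); last by field; rewrite gt_eqF.
by rewrite ler_pdivrMr// mul1r /c; lra.
Qed.

End besov_bound.

(** * Integration on the tree *)

Section integral_measure.
Context d (T : measurableType d) (R : realType).
Variables (m1 m2 : {measure set T -> \bar R}) (c : R) (D : set T) (f : T -> \bar R).
Local Open Scope ereal_scope.

Import HBNNSimple.

(** Approximation from below by simple functions reduces the comparison of integrals to the measures
    of level sets. *)
Lemma le_integral_measure : (0 < c)%R -> measurable D ->
  measurable_fun D f -> (forall x, D x -> 0 <= f x) ->
  (forall B, measurable B -> B `<=` D -> c%:E * m1 B <= m2 B) ->
  c%:E * \int[m1]_(x in D) f x <= \int[m2]_(x in D) f x.
Proof.
move=> c0 mD mf f0 m12; rewrite !(integral_mkcond D).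
have fD0 x : 0 <= (f \_ D) x by exact: erestrict_ge0.
rewrite !ge0_integralTE//.
rewrite -lee_pdivlMl//; apply: ge_ereal_sup => _ [h hf <-].
rewrite lee_pdivlMl//; apply: (@le_trans _ _ (sintegral m2 h)); last first.
  by apply: ereal_sup_ubound; exists h.
rewrite !sintegralE ge0_mule_fsumr; last by move=> y; exact: nnsfun_mulemu_ge0.
apply: lee_fsum => // _ [x _ <-]; rewrite muleCA.
have : (0 <= h x)%R by [].
rewrite le_eqVlt => /predU1P[<-|hx0].
  by rewrite !mul0e.
apply: lee_wpmul2l; first by rewrite lee_fin ltW.
(* A positive value of h is attained only inside D, because h lies below the restriction of f to
   D. *)
apply: m12 => [|y/= yx]; first exact: measurable_sfunP.
have := hf y; rewrite /patch yx; case: ifPn; first by rewrite inE.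
by rewrite lee_fin leNgt hx0.
Qed.

End integral_measure.

Section edges.
Context {R : realType} {K : nat}.
Local Notation tree := (tree R K).
Local Notation len := (@tree_length R K).
Implicit Types (w : seq (label K)) (a c : R).

Definition edge w : set tree := [set x | tip x = w].

Definition edge_piece w a c : set tree :=
  [set x | tip x = w /\ a < height x <= c].

Lemma edge_section_disj (D : set tree) w w' : D `<=` edge w -> w' != w ->
  edge_section D w' = set0.
Proof.
move=> Dw w'w; apply/seteqP; split => // h /edge_sectionP[hw _ /Dw].
by rewrite /edge /= /tip /= => ww; rewrite ww eqxx in w'w.
Qed.

Lemma tree_length_edge (D : set tree) w : D `<=` edge w ->
  len D = lebesgue_measure (edge_section D w).
Proof.
move=> Dw; rewrite /tree_length.
transitivity (\esum_(v in [set w]) lebesgue_measure (edge_section D w))%E.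
  rewrite [RHS]esum_mkcond; apply: eq_esum => v _; rewrite in_set1.
  by case: eqP => [->//|/eqP vw]; rewrite (edge_section_disj Dw vw) measure0.
by rewrite esum_set1.
Qed.

Lemma edge_section_edge w : edge_section (edge w) w = @edge_range R K w.
Proof.
apply/seteqP; split => h; first by move=> /edge_sectionP[].
by move=> hw; apply/edge_sectionP; exists hw.
Qed.

Lemma measurable_edge w : measurable (edge w).
Proof.
apply/tree_measurableP => v; have [->|vw] := eqVneq v w.
  by rewrite edge_section_edge; exact: measurable_edge_range.
by rewrite (@edge_section_disj _ w).
Qed.

Lemma edge_section_piece w a c : 0 <= a -> (size w)%:R <= a + 1 ->
  c <= (size w)%:R -> edge_section (edge_piece w a c) w = `]a, c]%classic.
Proof.
move=> a0 wa cw; apply/seteqP; split => h.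
  by move=> /edge_sectionP[hw _ [_]]; rewrite /height/= in_itv.
rewrite /= in_itv/= => /andP[ah hc]; apply/edge_sectionP.
have hw : tree_code (w, h).
  apply/and3P; split => /=; first by rewrite (le_trans a0)// ltW.
    exact: le_trans cw.
  by rewrite (le_lt_trans wa)// ltrD2r.
by exists hw => //; split => //; rewrite /height/= ah.
Qed.

Lemma measurable_edge_piece w a c : measurable (edge_piece w a c).
Proof.
rewrite (_ : edge_piece w a c = edge w `&` (@height R K @^-1` `]a, c]%classic)).
  apply: measurableI; first exact: measurable_edge.
  by rewrite -[X in measurable X]setTI; exact: measurable_height.
by apply/seteqP; split => x; rewrite /edge_piece /edge /= in_itv.
Qed.

Lemma tree_length_piece w a c : 0 <= a -> (size w)%:R <= a + 1 -> a <= c ->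
  c <= (size w)%:R -> len (edge_piece w a c) = (c - a)%:E.
Proof.
move=> a0 wa ac cw; rewrite (@tree_length_edge _ w); last by move=> x [].
rewrite edge_section_piece// lebesgue_measure_itv/= lte_fin.
move: ac; rewrite le_eqVlt => /predU1P[->|ac]; first by rewrite ltxx subrr.
by rewrite ac EFinN -EFinD.
Qed.

Lemma tree_length_root : len (edge [::]) = 0%E.
Proof.
rewrite (@tree_length_edge _ [::])// edge_section_edge.
rewrite (_ : edge_range _ = [set 0]) ?lebesgue_measure_set1//.
apply/seteqP; split => h /=; last by move=> ->; rewrite /edge_range/= lexx add0r ltr01.
by move=> /and3P[h0 h1 _]; apply/le_anti; rewrite h0 h1.
Qed.

Lemma tree_length_edgeS w : (0 < size w)%N -> len (edge w) = 1%E.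
Proof.
move=> w0; have -> : edge w = edge_piece w (size w).-1%:R (size w)%:R.
  apply/seteqP; split => x; last by case.
  move=> xw; split => //; have [_ h1 h2] := tree_heightP x; rewrite xw in h1 h2.
  by rewrite h1 andbT -(ltrD2r 1) natr1 (prednK w0).
have s1 : (size w)%:R = (size w).-1%:R + 1 :> R by rewrite natr1 (prednK w0).
by rewrite tree_length_piece// ?s1// ?lerDl// addrAC subrr add0r.
Qed.

Lemma height_edge (x : tree) n : size (tip x) = n.+1 -> n%:R < height x <= n.+1%:R.
Proof.
by move=> xn; have [_ h1 h2] := tree_heightP x; move: h1 h2; rewrite xn -natr1 ltrD2r => -> ->.
Qed.

Definition level n : set tree := [set x | size (tip x) = n].

Lemma level_bigsetU n :
  level n = \big[setU/set0]_(w <- index_enum (n.-tuple (label K))) edge w.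
Proof.
apply/seteqP; split => x; rewrite -bigcup_seq.
  by move=> /= /eqP xn; exists (Tuple xn) => //=; rewrite mem_index_enum.
by move=> [w _]; rewrite /edge /level/= => ->; rewrite size_tuple.
Qed.

Lemma measurable_level n : measurable (level n).
Proof. by rewrite level_bigsetU; apply: bigsetU_measurable => w _; exact: measurable_edge. Qed.

Local Open Scope ereal_scope.

Lemma integral_level (m : {measure set tree -> \bar R}) n (f : tree -> \bar R) :
  measurable_fun (level n) f -> (forall x, 0 <= f x) ->
  \int[m]_(x in level n) f x = \sum_(w : n.-tuple (label K)) \int[m]_(x in edge w) f x.
Proof.
move=> mf f0; rewrite level_bigsetU ge0_integral_bigsetU//.
- by move=> w; exact: measurable_edge.
- exact: index_enum_uniq.
- by move=> v w _ _ [x [/= xv xw]]; apply: val_inj; rewrite /= -xv -xw.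
- by rewrite -level_bigsetU.
Qed.

(** Level 0 is the root alone, assumed to be null, so the sum starts with the words of size 1. *)
Lemma integral_tree (m : {measure set tree -> \bar R}) (f : tree -> \bar R) :
  m (edge [::]) = 0 -> measurable_fun setT f -> (forall x, 0 <= f x) ->
  \int[m]_x f x =
  \sum_(n <oo) \sum_(w : n.+1.-tuple (label K)) \int[m]_(x in edge w) f x.
Proof.
move=> m0 mf f0; have mfl n : measurable_fun (level n) f by exact: measurable_funTS.
rewrite (_ : setT = \bigcup_n level n); last first.
  by apply/seteqP; split => // x _; exists (size (tip x)).
rewrite ge0_integral_bigcup//; last 3 first.
- by move=> n; exact: measurable_level.
- by apply: measurable_funTS.
- by move=> i j _ _ [x [/= <- <-]].
rewrite nneseries_recl//; last by move=> n _; exact: integral_ge0.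
rewrite (_ : level 0 = edge [::]); last first.
  apply/seteqP; split => x; rewrite /level /edge/=; last by move=> ->.
  by move/size0nil.
rewrite null_set_integral//; last 2 first.
- exact: measurable_edge.
- exact: measurable_funTS.
rewrite add0e -nneseries_addn; last by move=> n; exact: integral_ge0.
by apply: eq_eseriesr => n _; rewrite addn1 integral_level.
Qed.

End edges.

Section level_weight_theory.
Context {R : realType}.
Implicit Types (N l : R) (n : nat).

Lemma level_weight_succ N l : exists s1 s2, [/\ 0 < s1, 0 < s2 & forall n,
  s1 * level_weight N l n <= level_weight N l n.+1 <= s2 * level_weight N l n].
Proof.
have c0 : 0 < 2 `^ `|l| :> R by rewrite powR_gt0.
have e0 := expR_gt0 (- N).
exists (expR (- N) / 2 `^ `|l|), (expR (- N) * 2 `^ `|l|); split.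
- by rewrite divr_gt0.
- by rewrite mulr_gt0.
move=> n; have n0 : 0 < n.+1%:R :> R by [].
have n1 : 0 < n.+2%:R :> R by [].
have h1 : n.+1%:R <= 2 * n.+2%:R :> R by rewrite -natrM ler_nat mul2n -addnn ltnW// ltn_addr.
have h2 : n.+2%:R <= 2 * n.+1%:R :> R by rewrite -natrM ler_nat mul2n -addnn addSn ltnS leq_addl.
have l2 : 1 <= 2 :> R by rewrite ler1n.
have := powR_comparable l n0 n1 l2 h1 h2; have := powR_comparable l n1 n0 l2 h2 h1.
have -> : level_weight N l n.+1 = expR (- N) * (expR (- N * n%:R) * n.+2%:R `^ l).
  by rewrite mulrA -expRD /level_weight; congr (expR _ * _); rewrite -natr1; ring.
rewrite /level_weight; set x := n.+1%:R `^ l; set y := n.+2%:R `^ l => h3 h4.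
have en0 := expR_gt0 (- N * n%:R).
apply/andP; split.
  rewrite -mulrA ler_pM2l// ler_pdivrMl// mulrCA ler_pM2l//.
by rewrite -mulrA ler_pM2l// mulrCA ler_pM2l.
Qed.

Lemma level_weight_shift N M l n :
  expR (- M * n%:R) * level_weight N l n = level_weight (N + M) l n.
Proof.
by rewrite /level_weight mulrA -expRD; congr (expR _ * _); ring.
Qed.

Lemma level_weight_summable N l : 0 < N ->
  (\sum_(n <oo) (level_weight N l n)%:E < +oo)%E.
Proof.
move=> N0; have N20 : 0 < N / 2 by rewrite divr_gt0.
have [D D0 hD] := powR_le_expR (normr_ge0 l) N20.
apply: (@le_lt_trans _ _ (\sum_(n <oo) D%:E * (expR (- (N / 2) * n%:R))%:E)%E).
  apply: lee_nneseries => [n _ _|n _]; first by rewrite lee_fin ltW// level_weight_gt0.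
  rewrite -EFinM lee_fin /level_weight.
  have : n.+1%:R `^ l <= D * expR (N / 2 * n%:R).
    by apply: le_trans (hD n); rewrite ler_powR ?ler1n// ler_norm.
  move=> h; apply: (le_trans (ler_wpM2l (expR_ge0 _) h)).
  rewrite mulrCA -expRD le_eqVlt; apply/orP; left; apply/eqP.
  by congr (_ * expR _); field.
rewrite nneseriesZl; last by move=> n _; rewrite lee_fin expR_ge0.
by rewrite nneseries_expR// -EFinM ltry.
Qed.

End level_weight_theory.

(** * Weighted mass of the edges *)

Section tree_measure.
Context {R : realType} {K : nat} {beta C l : R}.
Hypotheses (beta0 : 0 < beta) (C0 : 0 < C).
Local Notation tree := (tree R K).
Local Notation len := (@tree_length R K).
Local Notation mu := (@mu_tree R K beta C l).
Local Notation weight := (@tree_weight R K beta C l).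

Lemma tree_weight_bounds : exists a1 a2, [/\ 0 < a1, 0 < a2 &
  forall (x : tree) n, size (tip x) = n.+1 ->
    a1 * level_weight beta l n <= weight x <= a2 * level_weight beta l n].
Proof.
(* [b] bounds both ratios between n + 1 and |x| + C on the edge, where n < |x| <= n + 1. *)
pose b := 1 + C + C^-1; have Ci : 0 < C^-1 by rewrite invr_gt0.
have b0 : 0 < b by rewrite /b addr_gt0// addr_gt0.
have b1 : 1 <= b by rewrite /b -addrA lerDl addr_ge0// ltW.
have bl : 0 < b `^ `|l| by rewrite powR_gt0.
exists (expR (- beta) / b `^ `|l|), (b `^ `|l|); split => //.
  by rewrite divr_gt0 ?expR_gt0.
move=> x n /height_edge /andP[nh hn].
have nR0 : 0 <= n%:R :> R by [].
have s1 : n.+1%:R = n%:R + 1 :> R by rewrite natr1.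
have n0 : 0 < n.+1%:R :> R by [].
have h0 : 0 < height x + C by rewrite addr_gt0// (le_lt_trans _ nh).
have c1 : n.+1%:R <= b * (height x + C).
  apply: (@le_trans _ _ ((1 + C^-1) * (n%:R + C))).
    rewrite s1 mulrDl mul1r mulrDr mulVf ?gt_eqF//.
    have : 0 <= C^-1 * n%:R by rewrite mulr_ge0// ltW.
    by move: C0; lra.
  apply: ler_pM; rewrite ?addr_ge0 ?(ltW C0) ?(ltW Ci)//; last by rewrite lerD2r ltW.
  by move: C0; rewrite /b; lra.
have c2 : height x + C <= b * n.+1%:R.
  apply: (@le_trans _ _ ((1 + C) * n.+1%:R)); last first.
    by rewrite ler_pM2r//; move: C0 Ci; rewrite /b; lra.
  have : 0 <= C * n%:R by rewrite mulr_ge0// ltW.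
  by move: hn C0; rewrite s1; lra.
have e1 : expR (- beta) * expR (- beta * n%:R) <= expR (- beta * height x).
  rewrite -expRD ler_expR -subr_ge0.
  rewrite (_ : _ - _ = beta * (n.+1%:R - height x)); last by rewrite s1; ring.
  by rewrite mulr_ge0 ?subr_ge0// ltW.
have e2 : expR (- beta * height x) <= expR (- beta * n%:R).
  by rewrite ler_expR !mulNr lerN2 ler_pM2l// ltW.
have := powR_comparable l n0 h0 b1 c1 c2; have := powR_comparable l h0 n0 b1 c2 c1.
rewrite /tree_weight /level_weight; set y := n.+1%:R `^ l; set z := (height x + C) `^ l => h3 h4.
apply/andP; split.
  rewrite (_ : _ * (_ * y) = (expR (- beta) * expR (- beta * n%:R)) *
    ((b `^ `|l|)^-1 * y)); last by field; rewrite gt_eqF.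
  apply: ler_pM => //; rewrite ?mulr_ge0 ?expR_ge0 ?invr_ge0 ?powR_ge0//.
  by rewrite ler_pdivrMl.
by rewrite mulrCA; apply: ler_pM => //; rewrite ?expR_ge0 ?powR_ge0.
Qed.

Lemma mu_tree_null (D : set tree) : measurable D -> len D = 0%E -> mu D = 0%E.
Proof.
move=> mD D0; rewrite /= /mu_tree null_set_integral//.
by apply: measurable_funTS; apply/measurable_EFinP; exact: measurable_tree_weight.
Qed.

Lemma mu_tree_lower (D : set tree) (c : R) : measurable D ->
  (forall x, D x -> c <= weight x) -> 0 <= c -> (c%:E * len D <= mu D)%E.
Proof.
move=> mD hc c0; rewrite -integral_cst// /= /mu_tree; apply: ge0_le_integral => //.
- by apply: measurable_funTS; apply/measurable_EFinP; exact: measurable_tree_weight.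
Qed.

Lemma mu_tree_upper (D : set tree) (c : R) : measurable D ->
  (forall x, D x -> weight x <= c) -> (mu D <= c%:E * len D)%E.
Proof.
move=> mD hc; rewrite -integral_cst// /= /mu_tree; apply: ge0_le_integral => //.
- by move=> x _; rewrite lee_fin tree_weight_ge0.
- by apply: measurable_funTS; apply/measurable_EFinP; exact: measurable_tree_weight.
Qed.

Lemma le_integral_mu_tree (D : set tree) (c : R) (f : tree -> \bar R) :
  0 < c -> measurable D -> measurable_fun D f -> (forall x, D x -> (0 <= f x)%E) ->
  (forall x, D x -> c <= weight x) ->
  (c%:E * \int[len]_(x in D) f x <= \int[mu]_(x in D) f x)%E.
Proof.
move=> c0 mD mf f0 hc; apply: le_integral_measure => // B mB BD.
by apply: mu_tree_lower => // [x /BD|]; [exact: hc|exact: ltW].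
Qed.

Lemma mu_tree_root : mu (edge [::]) = 0%E.
Proof. by apply: mu_tree_null; [exact: measurable_edge|exact: tree_length_root]. Qed.

Lemma mu_tree_edge : exists a1 a2, [/\ 0 < a1, 0 < a2 &
  forall w n, size w = n.+1 ->
    ((a1 * level_weight beta l n)%:E <= mu (edge w) <=
     (a2 * level_weight beta l n)%:E)%E /\
   forall x : tree, edge w x -> a1 * level_weight beta l n <= weight x].
Proof.
have [a1 [a2 [a10 a20 ha]]] := tree_weight_bounds.
exists a1, a2; split => // w n wn.
have lw0 := level_weight_gt0 beta l n.
have h1 x : edge w x -> a1 * level_weight beta l n <= weight x.
  by move=> xw; have /andP[] := ha x n (etrans (congr1 size xw) wn).
split => //; apply/andP; split.
  have := mu_tree_lower (measurable_edge w) h1; rewrite tree_length_edgeS ?wn// mule1.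
  by apply; rewrite mulr_ge0// ltW.
have h2 x : edge w x -> weight x <= a2 * level_weight beta l n.
  by move=> xw; have /andP[] := ha x n (etrans (congr1 size xw) wn).
by have := mu_tree_upper (measurable_edge w) h2; rewrite tree_length_edgeS ?wn// mule1.
Qed.

(** Index n has K^(n + 1) edges of mass at most a constant times [level_weight beta l n]; the factor
    K^n lowers the exponent beta to beta - ln K > 0, which keeps the series summable. *)
Lemma mu_tree_finite : (0 < K)%N -> ln K%:R < beta -> (mu setT < +oo)%E.
Proof.
move=> K0 Kb; have [a1 [a2 [a10 a20 ha]]] := mu_tree_edge.
have KR0 : 0 < K%:R :> R by rewrite ltr0n.
have lw0 N n : (0 <= (level_weight N l n)%:E)%E by rewrite lee_fin ltW// level_weight_gt0.
rewrite -[X in (X < _)%E]mul1e -integral_cst// (integral_tree mu_tree_root)//.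
apply: (@le_lt_trans _ _ (\sum_(n <oo)
    (K%:R * a2)%:E * (level_weight (beta - ln K%:R) l n)%:E)%E); last first.
  rewrite nneseriesZl; last by move=> n _; exact: lw0.
  have := level_weight_summable l (N := beta - ln K%:R); rewrite subr_gt0 => /(_ Kb).
  have : (0 <= \sum_(n <oo) (level_weight (beta - ln K%:R) l n)%:E)%E.
    by apply: nneseries_ge0 => n _ _; exact: lw0.
  by case: (limn _) => // r _ _; rewrite -EFinM ltry.
apply: lee_nneseries => [n _ _|n _].
  by apply: sume_ge0 => w _; exact: integral_ge0.
apply: (@le_trans _ _ (\sum_(w : n.+1.-tuple (label K)) (a2 * level_weight beta l n)%:E)%E).
  apply: lee_sum => w _; rewrite integral_cst ?mul1e; last exact: measurable_edge.
  by have [/andP[]] := ha w n (size_tuple w).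
rewrite sumEFin sumr_const card_tuple card_label// -EFinM lee_fin.
rewrite -[leLHS]mulr_natr natrX exprS.
rewrite (_ : K%:R ^+ n = expR (ln K%:R * n%:R)); last by rewrite expRM_natr lnK ?posrE.
rewrite (_ : level_weight beta l n = expR (- ln K%:R * n%:R) * level_weight (beta - ln K%:R) l n); last first.
  by rewrite level_weight_shift subrK.
rewrite mulNr expRN le_eqVlt; apply/orP; left; apply/eqP; field.
by rewrite gt_eqF ?expR_gt0.
Qed.

End tree_measure.

(** * Trace *)

Section growth_integrable.
Context {R : realType} {q A : R} {Phi : R -> R}.
Hypotheses (q1 : 1 <= q) (hPhi : power_growth q A Phi).
Context d (T : measurableType d) (m : {measure set T -> \bar R}).

Lemma growth_integrable (D : set T) (f : T -> R) (a : R) : 0 < a ->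
  measurable D -> (m D < +oo)%E -> measurable_fun D f ->
  (\int[m]_(x in D) (Phi (`|f x| * a))%:E < +oo)%E ->
  m.-integrable D (EFin \o f).
Proof.
move=> a0 mD mDoo mf h.
have mF : measurable_fun D (fun x => (`|f x| * a)%:E).
  apply/measurable_EFinP; apply: measurable_funM => //.
  exact: measurableT_comp.
have F0 x : D x -> (0 <= (`|f x| * a)%:E)%E.
  by move=> _; rewrite lee_fin mulr_ge0// ltW.
have := growth_integral_bound q1 hPhi m mD mF F0.
have hfin : (\int[m]_(x in D) (Phi (`|f x| * a))%:E)%E \is a fin_num.
  by rewrite ge0_fin_numE// integral_ge0// => x _; rewrite lee_fin (growth_ge0 hPhi).
have mDf : m D \is a fin_num by rewrite ge0_fin_numE.
rewrite /= -(fineK hfin) -(fineK mDf) -EFinM -EFinD => /le_lt_trans.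
move=> /(_ _ (ltry _)).
under eq_integral do rewrite EFinM.
rewrite ge0_integralZr//; last first.
- by rewrite lee_fin ltW.
- by apply/measurable_EFinP; exact: measurableT_comp.
move=> foo; apply/integrableP; split; first exact/measurable_EFinP.
move: foo; rewrite /=; case: (integral _ _ _) => [r _| |//]; first by rewrite ltry.
by rewrite gt0_mulye ?lte_fin.
Qed.

End growth_integrable.

Section geodesics.
Context {R : realType} {K : nat} {eps : R}.
Hypothesis eps0 : 0 < eps.
Local Notation tree := (tree R K).
Local Notation len := (@tree_length R K).
Implicit Types (w : seq (label K)).

Lemma prefix_mother w : prefix (mother w) w.
Proof. exact: prefix_take. Qed.

Lemma mother_mkseq (xi : ray K) n : mother (mkseq xi n.+1) = mkseq xi n.
Proof. by rewrite /mother size_mkseq/= -mkseq_take. Qed.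

(** Here y is an ancestor of x, so y itself is the branch point and every z on the geodesic lies
    below y: [tip z] is a prefix of w that extends [mother w]. *)
Lemma geodesic_edges w n (x y : tree) : size w = n.+2 ->
  edge w x -> edge (mother w) y ->
  geodesic x y `<=` edge w `|` edge (mother w).
Proof.
rewrite /edge/= => wn xw yw z [zxy zmin].
have wn' : size (mother w) = n.+1 by rewrite size_mother wn.
have yx : ancestor y x.
  split; first by rewrite xw yw prefix_mother.
  have [_ h1 _] := tree_heightP y; have [_ _ h2] := tree_heightP x.
  rewrite yw wn' in h1; rewrite xw wn -natr1 ltrD2r in h2.
  by rewrite (le_trans h1)// ltW.
have [yz _] := zmin y yx (ancestor_refl y).
have zw : prefix (tip z) w.
  case: zxy => -[zp _]; first by rewrite -xw.
  by rewrite yw in zp; rewrite (prefix_trans zp)// prefix_mother.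
rewrite yw in yz.
have := size_prefix yz; have := size_prefix zw; rewrite wn' wn.
rewrite leq_eqVlt ltnS => /predU1P[zs _|zs1 zs2].
  by left; move: zw; rewrite prefixE zs -wn take_size => /eqP.
have zs : size (tip z) = n.+1 by apply/eqP; rewrite eqn_leq zs1.
by right; move: yz; rewrite prefixE wn' -zs take_size => /eqP.
Qed.

Lemma upper_gradient_edges (u : tree -> R) g w n (x y : tree) :
  upper_gradient eps u g -> size w = n.+2 ->
  edge w x -> edge (mother w) y ->
  (`|u x - u y|%:E <= (expR (- eps * n%:R))%:E *
     \int[len]_(z in edge w `|` edge (mother w)) g z)%E.
Proof.
move=> [mg g0 ug] wn xw yw; apply: (le_trans (ug x y)); rewrite /path_integral.
have mD : measurable (edge w `|` edge (mother w) : set tree).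
  by apply: measurableU; exact: measurable_edge.
have mge : measurable_fun setT (fun z : tree => (g z * (expR (- eps * height z))%:E)%E).
  apply: emeasurable_funM => //; apply/measurable_EFinP.
  apply: measurableT_comp => //; apply: measurable_funM => //.
  exact: measurable_height.
apply: (@le_trans _ _ (\int[len]_(z in edge w `|` edge (mother w))
    (g z * (expR (- eps * height z))%:E))%E).
  apply: ge0_subset_integral => //.
  - exact: measurable_geodesic.
  - exact: measurable_funTS.
  - by move=> z _; rewrite mule_ge0// lee_fin expR_ge0.
  - exact: geodesic_edges wn xw yw.
rewrite -ge0_integralZl//; last exact: measurable_funTS.
apply: ge0_le_integral => //.
- by move=> z _; rewrite mule_ge0// lee_fin expR_ge0.
- exact: measurable_funTS.
- by apply: measurable_funeM; exact: measurable_funTS.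
(* The mother edge has size n + 1, so both edges lie at height at least n. *)
move=> z zD; rewrite muleC lee_wpmul2r// lee_fin ler_expR !mulNr lerN2 ler_pM2l//.
have wn' : size (mother w) = n.+1 by rewrite size_mother wn.
case: zD => zw; last first.
  by have /andP[/ltW] := height_edge (etrans (congr1 size zw) wn').
have /andP[/ltW h _] := height_edge (etrans (congr1 size zw) wn).
by apply: le_trans h; rewrite ler_nat.
Qed.

End geodesics.

(** * Energy of the edge means *)

Section trace_energy.
Context {R : realType} {K : nat} {eps beta C l q A : R} {Phi : R -> R}.
Hypotheses (K2 : (2 <= K)%N) (eps0 : 0 < eps) (Kbeta : ln K%:R < beta) (C0 : 0 < C).
Hypotheses (q1 : 1 <= q) (hPhi : power_growth q A Phi).
Local Notation tree := (tree R K).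
Local Notation bdry := (@boundary R K eps).
Local Notation len := (@tree_length R K).
Local Notation mu := (@mu_tree R K beta C l).
Local Notation N := (beta - ln K%:R).
Variables (nu : {measure set bdry -> \bar R}) (b1 b2 : R).
Hypotheses (b10 : 0 < b1) (b20 : 0 < b2).
Hypothesis nub : forall w, ((b1 * expR (- ln K%:R * (size w)%:R))%:E <= nu (cylinder w) <=
     (b2 * expR (- ln K%:R * (size w)%:R))%:E)%E.
Implicit Types (w : seq (label K)) (u : tree -> R).

(* The edge [::] is the root alone, a null set, so its mean would be a junk value. *)
Definition edge_mean u w : R := if w is [::] then 0 else mean mu (edge w) u.

Lemma increment_energy_words (W : seq (label K) -> R) :
  @increment_energy R K eps N l Phi nu W =
  (\sum_(j <oo) (level_weight N l j)%:E *
    \sum_(w : j.+1.-tuple (label K))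
      (Phi (expR (eps * j%:R) * `|W w - W (mother w)|))%:E * nu (cylinder w))%E.
Proof.
apply: eq_eseriesr => j _; congr (_ * _)%E.
rewrite -(integral_mkseq eps0 nu j.+1
  (psi := fun w => (Phi (expR (eps * j%:R) * `|W w - W (mother w)|))%:E)); last first.
  by move=> w; rewrite lee_fin (growth_ge0 hPhi).
by apply: eq_integral => xi _; rewrite /scaled_increment /increment mother_mkseq.
Qed.

Lemma lnK_ge0 : 0 <= ln K%:R :> R.
Proof. by rewrite ln_ge0// ler1n (leq_trans _ K2). Qed.

Lemma beta_gt0 : 0 < beta.
Proof. exact: le_lt_trans lnK_ge0 Kbeta. Qed.

(** This is where N = beta - ln K comes from: the nu-mass K^(-n) of a cylinder makes up for the
    difference between e^(- N n) and e^(- beta n). It converts boundary sums into integrals over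
    edges. *)
Lemma nu_cylinder_level w n : size w = n.+1 ->
  ((level_weight N l n)%:E * nu (cylinder w) <= (b2 * level_weight beta l n)%:E)%E.
Proof.
move=> wn; have /andP[_ h] := nub w.
have lw0 := level_weight_gt0 N l n.
apply: (le_trans (lee_wpmul2l _ h)); first by rewrite lee_fin ltW.
rewrite -EFinM lee_fin mulrCA ler_pM2l// wn.
rewrite (_ : level_weight beta l n = expR (- ln K%:R * n%:R) * level_weight N l n); last first.
  by rewrite level_weight_shift subrK.
rewrite mulrC ler_pM2r// ler_expR !mulNr lerN2 ler_wpM2l ?lnK_ge0//.
by rewrite ler_nat.
Qed.


(** The scale k1 of u enters only at level 0, where an edge mean is compared with the value 0
    assigned to the root; that value supplies the normalisation asked by [energy_limit_bound]. All
    later increments compare adjacent edges and are governed by g at the scale k2. *)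
Lemma trace_energy_bound : exists2 c, 0 < c & forall u g k1 k2,
  measurable_fun setT u -> upper_gradient eps u g -> 0 < k1 -> 0 < k2 ->
  (\int[mu]_x (Phi (`|u x| * k1^-1))%:E <= 1)%E ->
  (\int[mu]_x er_map Phi (`|g x| * (k2^-1)%:E) <= 1)%E ->
  (@increment_energy R K eps N l Phi nu (fun w => (edge_mean u w / (c * (k1 + k2)))%R) <= 1)%E.
Proof.
have A0 := growth_const_gt0 hPhi.
have [a1 [a2 [a10 a20 ha]]] := mu_tree_edge (K := K) beta_gt0 C0 (l := l).
have [s1 [s2 [s10 s20 hs]]] := level_weight_succ beta l.
have muoo := mu_tree_finite (l := l) beta_gt0 C0 (ltnW K2) Kbeta.
have K0 : 0 < K%:R :> R by rewrite ltr0n ltnW.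
(* Let L be the level weight of the lower of two adjacent edges: [a4] L bounds the density from
   below on both, [a5] L bounds their joint mass, and [B0] is the constant that results for the
   scaled difference of means. [T0] and [T1] are the contributions of level 0 and of the later
   levels before division by c; 1 + K appears because an edge occurs once as child and K times as
   mother. *)
pose a4 := a1 / (1 + s2).
have s21 : 0 < 1 + s2 by rewrite addr_gt0.
have a40 : 0 < a4 by rewrite divr_gt0.
pose a5 := a2 * (1 + s1^-1).
have a50 : 0 < a5 by rewrite mulr_gt0// addr_gt0// invr_gt0.
pose B0 := a5 / a4 * expR eps.
have B00 : 0 < B0 by rewrite mulr_gt0 ?expR_gt0// divr_gt0.
pose T0 := A ^+ 2 * (2 * (b2 / a1)).
have T00 : 0 < T0 by rewrite mulr_gt0 ?exprn_gt0// mulr_gt0// divr_gt0.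
pose T1 := A ^+ 2 * (2 * B0 * (b2 / a1)) * (1 + K%:R).
have T10 : 0 < T1.
  rewrite mulr_gt0//.
  by rewrite mulr_gt0 ?exprn_gt0// mulr_gt0 ?divr_gt0// mulr_gt0.
pose c := 2 + 2 * B0 + T0 + T1.
have c0 : 0 < c by rewrite /c; lra.
exists c => // u g k1 k2 mu_u ug k10 k20 uk gk.
have k0 : 0 < k1 + k2 by rewrite addr_gt0.
pose k := c * (k1 + k2); have kp : 0 < k by rewrite mulr_gt0.
have lw0 M n : (0 <= (level_weight M l n)%:E)%E by rewrite lee_fin ltW// level_weight_gt0.
have mPhi := measurable_growth_er_map hPhi.
pose Fu (x : tree) := (`|u x| * k1^-1)%:E.
have Fu0 x : (0 <= Fu x)%E by rewrite lee_fin mulr_ge0// invr_ge0 ltW.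
have mFu : measurable_fun setT Fu.
  by apply/measurable_EFinP; apply: measurable_funM => //; exact: measurableT_comp.
have [mg g0 ugi] := ug.
pose Fg (x : tree) := (`|g x| * (k2^-1)%:E)%E.
have Fg0 x : (0 <= Fg x)%E by rewrite mule_ge0// lee_fin invr_ge0 ltW.
have mFg : measurable_fun setT Fg.
  by apply: emeasurable_funM => //; exact: measurableT_comp.
have Phi0 (y : \bar R) : (0 <= y)%E -> (0 <= er_map Phi y)%E.
  by move=> y0; apply: (growth_er_map_ge0 hPhi).
have uint : mu.-integrable setT (EFin \o u).
  apply: (growth_integrable q1 hPhi (a := k1^-1)) => //; first by rewrite invr_gt0.
  by apply: (le_lt_trans uk); rewrite ltry.
have uintE w : mu.-integrable (edge w) (EFin \o u).
  by apply: integrableS uint => //; exact: measurable_edge.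
have muE w n : size w = n.+1 -> (0 < mu (edge w) < +oo)%E.
  move=> wn; have [/andP[h _] _] := ha w n wn; rewrite (lt_le_trans _ h)/=; last first.
    by rewrite lte_fin mulr_gt0// level_weight_gt0.
  by apply: le_lt_trans muoo; apply: le_measure; rewrite ?inE//; exact: measurable_edge.
pose X w := (\int[mu]_(x in edge w) er_map Phi (Fu x))%E.
have X0 w : (0 <= X w)%E by apply: integral_ge0 => x _; exact: Phi0.
pose Y w := (\int[mu]_(x in edge w) er_map Phi (Fg x))%E.
have Y0 w : (0 <= Y w)%E by apply: integral_ge0 => x _; exact: Phi0.
have mur := mu_tree_root (K := K) (beta := beta) (C := C) (l := l).
have XS : (\sum_(n <oo) \sum_(w : n.+1.-tuple (label K)) X w <= 1)%E.
  by rewrite -(integral_tree mur (f := fun x => er_map Phi (Fu x)))//; [exact: mPhi|move=> x; exact: Phi0].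
have YS : (\sum_(n <oo) \sum_(w : n.+1.-tuple (label K)) Y w <= 1)%E.
  by rewrite -(integral_tree mur (f := fun x => er_map Phi (Fg x)))//; [exact: mPhi|move=> x; exact: Phi0].
have X1 : (\sum_(w : 1.-tuple (label K)) X w <= 1)%E.
  apply: le_trans XS.
  have := @nneseries_lim_ge R (fun n => \sum_(w : n.+1.-tuple (label K)) X w)%E xpredT 0%N 1.
  by rewrite big_nat1; apply => n _ _; exact: sume_ge0.
rewrite increment_energy_words.
pose E0 w := (`|edge_mean u w / k - edge_mean u (mother w) / k|)%R.
pose tm (j : nat) := ((level_weight N l j)%:E *
    \sum_(w : j.+1.-tuple (label K)) (Phi (expR (eps * j%:R) * E0 w))%:E * nu (cylinder w))%E.
have tm0 j : (0 <= tm j)%E.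
  rewrite mule_ge0// sume_ge0// => w _; rewrite mule_ge0//.
  by rewrite lee_fin (growth_ge0 hPhi).
have k1k : k1 / (k1 + k2) <= 1 by rewrite ler_pdivrMr// mul1r lerDl ltW.
have k2k : k2 / (k1 + k2) <= 1 by rewrite ler_pdivrMr// mul1r lerDr ltW.
have term0 : (tm 0%N <= (T0 / c)%:E)%E.
  rewrite /tm level_weight0 mul1e.
  apply: (@le_trans _ _ (\sum_(w : 1.-tuple (label K)) (T0 / c)%:E * X w)%E); last first.
    rewrite -ge0_sume_distrr//; rewrite -[leRHS]mule1; apply: lee_wpmul2l => //.
    by rewrite lee_fin divr_ge0// ltW.
  apply: lee_sum => w _; have mw := @measurable_edge R K w.
  have /andP[mw0 mwoo] := muE _ _ (size_tuple w).
  have w1 := size_tuple w.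
  pose a := mean mu (edge w) u.
  have -> : expR (eps * 0%:R) * E0 w = `|a| / k.
    rewrite mulr0 expR0 mul1r /E0 /a; case: (tval w) w1 => [//|b s] [s0].
    by rewrite /mother/= s0/= mul0r subr0 normrM [`|k^-1|]gtr0_norm ?invr_gt0.
  have aX : (`|a|%:E * mu (edge w) <= \int[mu]_(x in edge w) `|u x|%:E)%E.
    have := mean_dev 0 mw (uintE w); rewrite mw0 mwoo subr0 => /(_ isT) /le_trans; apply.
    by under eq_integral do rewrite subr0.
  pose t := `|a| * k1^-1 / 2.
  have t0 : 0 <= t by rewrite divr_ge0// mulr_ge0// invr_ge0 ltW.
  have tX : ((2 * t)%:E * mu (edge w) <= \int[mu]_(x in edge w) Fu x)%E.
    rewrite /Fu; under eq_integral do rewrite EFinM.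
    rewrite ge0_integralZr//; last 2 first.
    - by apply: measurable_funTS; do 2 apply: measurableT_comp => //.
    - by rewrite lee_fin invr_ge0 ltW.
    rewrite (_ : 2 * t = `|a| * k1^-1); last by rewrite /t; field; rewrite gt_eqF.
    by rewrite EFinM muleAC lee_wpmul2r// lee_fin invr_ge0 ltW.
  have hJ := growth_jensen q1 hPhi mw (measurable_funTS mFu) (fun x _ => Fu0 x) t0 mwoo tX.
  rewrite (_ : `|a| / k = (2 / c * (k1 / (k1 + k2))) * t); last first.
    by rewrite /t /k; field; rewrite !gt_eqF.
  have r1 : 2 / c * (k1 / (k1 + k2)) <= 2 / c by rewrite ler_piMr// divr_ge0// ltW.
  have r2 : 2 / c <= 1 by rewrite ler_pdivrMr// mul1r /c; lra.
  have r0 : 0 <= 2 / c * (k1 / (k1 + k2)).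
    by rewrite !(mulr_ge0, invr_ge0)// ltW.
  have hP : Phi (2 / c * (k1 / (k1 + k2)) * t) <= A * (2 / c) * Phi t.
    apply: (le_trans (growth_contract q1 hPhi _ t0)).
      by rewrite r0 (le_trans r1).
    by rewrite ler_wpM2r ?(growth_ge0 hPhi)// ler_wpM2l// ltW.
  apply: (@le_trans _ _ ((A * (2 / c) * Phi t)%:E * ((b2 / a1)%:E * mu (edge w)))%E).
    apply: lee_pmul => //; first by rewrite lee_fin (growth_ge0 hPhi).
    have := nu_cylinder_level w1; rewrite level_weight0 mul1e => /le_trans; apply.
    have [/andP[h _] _] := ha w 0%N w1.
    have b0 : (0 <= (b2 / a1)%:E)%E by rewrite lee_fin divr_ge0 ?ltW.
    apply: le_trans (lee_wpmul2l b0 h).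
    by rewrite -EFinM lee_fin -[leRHS]mulrA mulKf ?gt_eqF.
  rewrite EFinM -muleA [X in (_ * X)%E]muleCA muleA -EFinM.
  have c3 : 0 <= A * (2 / c) * (b2 / a1) by rewrite !(mulr_ge0, invr_ge0)// ltW.
  apply: (le_trans (@lee_wpmul2l _ (A * (2 / c) * (b2 / a1))%:E _ _ _ hJ)).
    by rewrite lee_fin.
  rewrite muleA -EFinM (_ : A * (2 / c) * (b2 / a1) * A = T0 / c)//.
  by rewrite /T0; field; rewrite !gt_eqF.
have termS n (w : n.+2.-tuple (label K)) :
  ((level_weight N l n.+1)%:E * ((Phi (expR (eps * n.+1%:R) * E0 w))%:E * nu (cylinder w)) <=
   (A ^+ 2 * (2 * B0 * (b2 / a1)) / c)%:E * (Y w + Y (mother w)))%E.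
  have wn := size_tuple w.
  have wm : size (mother w) = n.+1 by rewrite size_mother wn.
  have mw := @measurable_edge R K w; have mm := @measurable_edge R K (mother w).
  have [/andP[haw1 haw2] haw3] := ha w _ wn.
  have [/andP[ham1 ham2] ham3] := ha (mother w) _ wm.
  pose D : set tree := edge w `|` edge (mother w).
  have mD : measurable D by exact: measurableU.
  pose Lw := level_weight beta l n.+1.
  have Lw0 : 0 < Lw by exact: level_weight_gt0.
  have /andP[hs1 hs2] := hs n; rewrite -/Lw in hs1 hs2 haw1 haw2 haw3.
  have ln0 := level_weight_gt0 beta l n.
  have g0' x : D x -> (0 <= g x)%E by move=> _; exact: g0.
  have mgD : measurable_fun D g by exact: measurable_funTS.
  pose IG := (\int[len]_(x in D) g x)%E.
  have IG0 : (0 <= IG)%E by exact: integral_ge0.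
  pose dw := `|mean mu (edge w) u - mean mu (edge (mother w)) u|.
  (* The bound for pairs of points is averaged over one edge and then over the other, which yields
     the difference of the two means. *)
  have dwG : (dw%:E <= (expR (- eps * n%:R))%:E * IG)%E.
    have ug' x y : edge w x -> edge (mother w) y -> (`|u x - u y|%:E <= (expR (- eps * n%:R))%:E * IG)%E.
      by move=> xw ym; exact: (upper_gradient_edges eps0 ug wn xw ym).
    move: ug'; case: IG IG0 => [G| |]// _; last first.
      by rewrite gt0_muley ?leey// lte_fin expR_gt0.
    rewrite -EFinM lee_fin => ug'.
    rewrite /dw distrC; apply: mean_dev_le => //; first exact: muE wm.
    move=> y ym; rewrite distrC; apply: mean_dev_le => //; first exact: muE wn.
    by move=> x xw; rewrite -lee_fin; exact: ug'.
  pose v := expR (eps * n.+1%:R) * dw.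
  have v0 : 0 <= v by rewrite mulr_ge0 ?expR_ge0 ?normr_ge0.
  have vG : (v%:E <= (expR eps)%:E * IG)%E.
    rewrite /v EFinM; apply: (le_trans (@lee_wpmul2l _ (expR (eps * n.+1%:R))%:E _ _ _ dwG)).
      by rewrite lee_fin expR_ge0.
    rewrite muleA -EFinM -expRD (_ : _ + _ = eps)//.
    by rewrite -natr1; ring.
  have wD x : D x -> a4 * Lw <= tree_weight beta C l x.
    move=> [/haw3|/ham3]; apply: le_trans.
      by rewrite ler_pM2r// /a4 ler_piMr ?(ltW a10)// invf_le1// lerDl ltW.
    rewrite /a4 mulrAC -mulrA ler_pM2l// ler_pdivrMr//.
    by apply: (le_trans hs2); rewrite mulrC ler_pM2l// lerDr.
  have IGmu : ((a4 * Lw)%:E * IG <= \int[mu]_(x in D) g x)%E.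
    by apply: le_integral_mu_tree => //; rewrite mulr_gt0.
  have muD : (mu D <= (a5 * Lw)%:E)%E.
    apply: (le_trans (measureU2 _ mw mm)).
    apply: (le_trans (leeD haw2 ham2)); rewrite -EFinD lee_fin /a5.
    rewrite mulrDr mulr1 mulrDl lerD2l -mulrA ler_pM2l// ler_pdivlMl//.
  have muDge : (mu (edge w) <= mu D)%E.
    by apply: le_measure; rewrite ?inE//; exact: subsetUl.
  have muDoo : (mu D < +oo)%E by apply: (le_lt_trans muD); rewrite ltry.
  have vD : (v%:E * mu D <= B0%:E * \int[mu]_(x in D) g x)%E.
    have v0' : (0 <= v%:E)%E by rewrite lee_fin.
    apply: (le_trans (lee_wpmul2l v0' muD)).
    have aL0 : (0 <= (a5 * Lw)%:E)%E by rewrite lee_fin mulr_ge0// ltW.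
    apply: (le_trans (lee_wpmul2r aL0 vG)).
    have B0' : (0 <= B0%:E)%E by rewrite lee_fin ltW.
    apply: le_trans (lee_wpmul2l B0' IGmu).
    rewrite muleAC !muleA -!EFinM lee_wpmul2r// lee_fin /B0.
    by rewrite le_eqVlt; apply/orP; left; apply/eqP; field; rewrite gt_eqF.
  pose t := v * k2^-1 / (2 * B0).
  have t0 : 0 <= t.
    by rewrite divr_ge0// mulr_ge0 ?invr_ge0// ltW.
  have tX : ((2 * t)%:E * mu D <= \int[mu]_(x in D) Fg x)%E.
    have -> : (\int[mu]_(x in D) Fg x = (\int[mu]_(x in D) g x) * (k2^-1)%:E)%E.
      rewrite -ge0_integralZr//; last by rewrite lee_fin invr_ge0 ltW.
      by apply: eq_integral => x _; rewrite /Fg gee0_abs.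
    rewrite (_ : 2 * t = (k2 * B0)^-1 * v); last by rewrite /t; field; rewrite !gt_eqF.
    have kB : (0 <= ((k2 * B0)^-1)%:E)%E by rewrite lee_fin invr_ge0 mulr_ge0// ltW.
    rewrite EFinM -muleA; apply: (le_trans (lee_wpmul2l kB vD)).
    rewrite muleA -EFinM [leRHS]muleC lee_wpmul2r//; first by apply: integral_ge0.
    by rewrite lee_fin le_eqVlt; apply/orP; left; apply/eqP; field; rewrite !gt_eqF.
  have hJ := growth_jensen q1 hPhi mD (measurable_funTS mFg) (fun x _ => Fg0 x) t0 muDoo tX.
  have YD : (\int[mu]_(x in D) er_map Phi (Fg x) = Y w + Y (mother w))%E.
    rewrite /D ge0_integral_setU//.
    - by apply: (mPhi); exact: measurable_funTS.
    - by move=> x _; exact: Phi0.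
    rewrite disj_set2E; apply/eqP/seteqP; split => // x [xw xm].
    have := congr1 size (xm : tip x = _); rewrite (xw : tip x = w) wm wn => /eqP.
    by rewrite eqn_leq ltnn.
  rewrite YD in hJ.
  have -> : expR (eps * n.+1%:R) * E0 w = (2 * B0 / c * (k2 / (k1 + k2))) * t.
    rewrite /E0 -mulrBl normrM [`|k^-1|]gtr0_norm ?invr_gt0// [LHS]mulrA.
    have -> : expR (eps * n.+1%:R) * `|edge_mean u w - edge_mean u (mother w)| = v.
      rewrite /v /dw /edge_mean; congr (_ * `| _ - _|).
        by case: (tval w) wn.
      by case: (mother w) wm.
    by rewrite /t /k; field; rewrite !gt_eqF.
  have Bc0 : 0 <= 2 * B0 / c.
    by apply: divr_ge0; [apply: mulr_ge0; [by []|exact: ltW]|exact: ltW].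
  have k20' : 0 <= k2 / (k1 + k2) by apply: divr_ge0; exact: ltW.
  have r1 : 2 * B0 / c * (k2 / (k1 + k2)) <= 2 * B0 / c.
    by rewrite ler_piMr.
  have r2 : 2 * B0 / c <= 1 by rewrite ler_pdivrMr// mul1r /c; lra.
  have r0 : 0 <= 2 * B0 / c * (k2 / (k1 + k2)).
    exact: mulr_ge0.
  have hP : Phi (2 * B0 / c * (k2 / (k1 + k2)) * t) <= A * (2 * B0 / c) * Phi t.
    apply: (le_trans (growth_contract q1 hPhi _ t0)).
      by rewrite r0 (le_trans r1).
    by rewrite ler_wpM2r ?(growth_ge0 hPhi)// ler_wpM2l// ltW.
  have hnu : ((level_weight N l n.+1)%:E * nu (cylinder w) <= (b2 / a1)%:E * mu D)%E.
    apply: (le_trans (nu_cylinder_level wn)).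
    have b0 : (0 <= (b2 / a1)%:E)%E by rewrite lee_fin divr_ge0 ?ltW.
    apply: le_trans (lee_wpmul2l b0 (le_trans haw1 muDge)).
    by rewrite -EFinM lee_fin -[leRHS]mulrA mulKf ?gt_eqF.
  rewrite muleCA.
  apply: (@le_trans _ _ ((A * (2 * B0 / c) * Phi t)%:E * ((b2 / a1)%:E * mu D))%E).
    apply: lee_pmul => //; first by rewrite lee_fin (growth_ge0 hPhi).
    by rewrite mule_ge0.
  rewrite EFinM -muleA [X in (_ * X)%E]muleCA muleA -EFinM.
  have c3 : 0 <= A * (2 * B0 / c) * (b2 / a1).
    apply: mulr_ge0; first by apply: mulr_ge0 => //; exact: ltW.
    by apply: divr_ge0; exact: ltW.
  apply: (le_trans (@lee_wpmul2l _ (A * (2 * B0 / c) * (b2 / a1))%:E _ _ _ hJ)).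
    by rewrite lee_fin.
  rewrite muleA -EFinM (_ : A * (2 * B0 / c) * (b2 / a1) * A = A ^+ 2 * (2 * B0 * (b2 / a1)) / c)//.
  by field; rewrite !gt_eqF.
pose T2 := A ^+ 2 * (2 * B0 * (b2 / a1)) / c.
have T20 : (0 <= T2%:E)%E.
  rewrite lee_fin; apply: divr_ge0; last exact: ltW.
  apply: mulr_ge0; first exact: sqr_ge0.
  by apply: mulr_ge0; [apply: mulr_ge0 => //; exact: ltW|apply: divr_ge0; exact: ltW].
pose Z n := (\sum_(w : n.+1.-tuple (label K)) Y w)%E.
have Z0 n : (0 <= Z n)%E by exact: sume_ge0.
have levelS n : (tm n.+1 <= T2%:E * (Z n.+1 + K%:R%:E * Z n))%E.
  rewrite /tm ge0_sume_distrr; last first.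
    by move=> w _; rewrite mule_ge0// lee_fin (growth_ge0 hPhi).
  apply: (@le_trans _ _ (\sum_(w : n.+2.-tuple (label K)) T2%:E * (Y w + Y (mother w)))%E).
    by apply: lee_sum => w _; exact: termS.
  rewrite -ge0_sume_distrr; last by move=> w _; exact: adde_ge0.
  by rewrite big_split/= (sum_mother K2).
rewrite (nneseries_recl (P := xpredT) (f := tm))//.
rewrite -(nneseries_addn 1)//.
have sumS : (\sum_(n <oo) tm (n + 1)%N <= (T1 / c)%:E)%E.
  apply: (@le_trans _ _ (\sum_(n <oo) T2%:E * (Z n.+1 + K%:R%:E * Z n))%E).
    by apply: lee_nneseries => // n _; rewrite addn1.
  rewrite nneseriesZl; last by move=> n _; rewrite adde_ge0// mule_ge0// lee_fin.
  rewrite nneseriesD//; last by move=> n _ _; rewrite mule_ge0// lee_fin.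
  rewrite nneseriesZl//.
  have Z1 : (\sum_(n <oo) Z n.+1 <= 1)%E.
    have ZS : (\sum_(n <oo) Z n <= 1)%E by exact: YS.
    apply: le_trans ZS; rewrite (nneseries_recl (P := xpredT) (f := Z))//.
    rewrite -(nneseries_addn 1)//.
    have -> : (\sum_(n <oo) Z (n + 1)%N = \sum_(n <oo) Z n.+1)%E.
      by apply: eq_eseriesr => n _; rewrite addn1.
    by rewrite leeDr.
  apply: (@le_trans _ _ (T2%:E * (1 + K%:R%:E * 1))%E).
    by apply: lee_wpmul2l => //; apply: leeD => //; apply: lee_wpmul2l; rewrite ?lee_fin.
  rewrite mule1 -EFinD -EFinM lee_fin /T2 /T1 le_eqVlt; apply/orP; left; apply/eqP.
  by field; rewrite !gt_eqF.
apply: (le_trans (leeD term0 sumS)); rewrite -EFinD lee_fin -mulrDl ler_pdivrMr// mul1r.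
by rewrite /c; lra.
Qed.

End trace_energy.

(** * Luxemburg norms and the trace operator *)

Section ereal_inf_add.
Context {R : realType}.
Local Open Scope ereal_scope.
Implicit Types (P Q : set (\bar R)) (M : \bar R).

(** Both norms of the theorem are sums of two infima, while the estimates are proved for one
    admissible scale from each; nonnegativity rules out undefined sums of infinities. *)
Lemma le_ereal_inf_add P Q M :
  (forall a, P a -> 0 <= a) -> (forall b, Q b -> 0 <= b) ->
  (forall a b, P a -> Q b -> M <= a + b) ->
  M <= ereal_inf P + ereal_inf Q.
Proof.
move=> P0 Q0 h.
have i10 : 0 <= ereal_inf P by apply: le_ereal_inf_tmp => a /P0.
have i20 : 0 <= ereal_inf Q by apply: le_ereal_inf_tmp => b /Q0.
have h1 b : Q b -> M <= ereal_inf P + b.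
  move=> Sb; have := Q0 b Sb; move: Sb; case: b => [b| |]// Sb _; last first.
    by rewrite addey ?leey// gt_eqF// (lt_le_trans _ i10).
  rewrite -leeBlDr//; apply: le_ereal_inf_tmp => a Sa.
  by rewrite leeBlDr//; exact: h.
move: i10 h1; case: (ereal_inf P) => [a| |]// i10 h1; last first.
  by rewrite addye ?leey// gt_eqF// (lt_le_trans _ i20).
rewrite -leeBlDl//; apply: le_ereal_inf_tmp => b Sb.
by rewrite leeBlDl//; exact: h1.
Qed.

Lemma le_scaled_ereal_inf_add P Q M (c : R) : (0 < c)%R ->
  (forall a, P a -> 0 <= a) -> (forall b, Q b -> 0 <= b) ->
  (forall a b, P a -> Q b -> M <= c%:E * (a + b)) ->
  M <= c%:E * (ereal_inf P + ereal_inf Q).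
Proof.
move=> c0 P0 Q0 h; rewrite -lee_pdivrMl//; apply: le_ereal_inf_add => // a b Sa Sb.
by rewrite lee_pdivrMl//; exact: h.
Qed.

End ereal_inf_add.

Section luxemburg_theory.
Context d (T : measurableType d) (R : realType) (Phi : R -> R).
Variable m : {measure set T -> \bar R}.
Implicit Types f : T -> \bar R.
Local Open Scope ereal_scope.

Lemma luxemburg_ge0 f : 0 <= luxemburg Phi m f.
Proof. by apply: le_ereal_inf_tmp => _ [k [k0 _] <-]; rewrite lee_fin ltW. Qed.

Lemma luxemburg_le f (k : R) : (0 < k)%R ->
  \int[m]_x er_map Phi (`|f x| * (k^-1)%:E) <= 1 -> luxemburg Phi m f <= k%:E.
Proof. by move=> k0 h; apply: ereal_inf_lbound; exists k. Qed.

Lemma luxemburg_lty f : luxemburg Phi m f < +oo ->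
  exists2 k : R, (0 < k)%R & \int[m]_x er_map Phi (`|f x| * (k^-1)%:E) <= 1.
Proof. by move=> /ereal_inf_lt[_ [k [k0 h] <-] _]; exists k. Qed.

End luxemburg_theory.

Section word_limit.
Context {R : realType} {K : nat} {eps : R}.
Hypothesis eps0 : 0 < eps.
Implicit Types W : seq (label K) -> R.

(** The upper limit is defined and measurable without any convergence assumption, and it is the
    limit wherever a finite one exists. *)
Definition word_limit W : ray K -> R := fun xi =>
  fine (limn_esup (fun n => (W (mkseq xi n))%:E)).

Lemma measurable_word_limit W :
  measurable_fun [set: @boundary R K eps] (word_limit W).
Proof.
apply: (@measurableT_comp _ _ _ _ _ _ (@fine R)) => //.
apply: measurable_fun_limn_esup => n.
apply/measurable_EFinP; exact: (measurable_mkseq eps0).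
Qed.

Lemma word_limitE W (xi : ray K) (r : R) :
  W (mkseq xi n) @[n --> \oo] --> r -> word_limit W xi = r.
Proof.
move=> h; rewrite /word_limit.
have /cvg_limn_einf_sup[_ ->] : (W (mkseq xi n))%:E @[n --> \oo] --> r%:E.
  by apply: cvg_EFin => //; exact: nearW.
by [].
Qed.

End word_limit.

Section trace.
Context {R : realType} {K : nat} {eps beta C l q A theta p : R} {Phi : R -> R}.
Hypotheses (K2 : (2 <= K)%N) (eps0 : 0 < eps) (Kbeta : ln K%:R < beta) (C0 : 0 < C).
Hypotheses (q1 : 1 <= q) (hPhi : power_growth q A Phi).
Local Notation tree := (tree R K).
Local Notation bdry := (@boundary R K eps).
Local Notation mu := (@mu_tree R K beta C l).
Local Notation N := (beta - ln K%:R).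
Hypotheses (Nq : N < q * eps) (Ntheta : eps * (theta - 1) * p = - N).
Variable nu : {measure set bdry -> \bar R}.
Hypothesis nuA : ahlfors_regular (ln K%:R / eps) nu.
Implicit Types (w : seq (label K)) (u : tree -> R).
Local Notation edge_mean := (@edge_mean R K beta C l).
Local Notation sobolev_norm := (@sobolev_norm R K eps beta C l Phi).
Local Notation besov_norm := (@besov_norm R K eps theta p l Phi nu).
Local Notation sobolev := (@orlicz_sobolev R K eps beta C l Phi).
Local Notation besov := (@orlicz_besov R K eps theta p l Phi nu).

Definition trace u : bdry -> R := word_limit (edge_mean u).

Lemma measurable_trace u : measurable_fun setT (trace u).
Proof. exact: measurable_word_limit. Qed.

(** [energy_limit_bound] is applied to the edge means divided by c2 (k1 + k2), whose energy is at
    most 1; convergence along a ray is unaffected by this rescaling. *)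
Lemma trace_bound : exists2 c, 0 < c & forall u g k1 k2,
  measurable_fun setT u -> upper_gradient eps u g -> 0 < k1 -> 0 < k2 ->
  (\int[mu]_x (Phi (`|u x| * k1^-1))%:E <= 1)%E ->
  (\int[mu]_x er_map Phi (`|g x| * (k2^-1)%:E) <= 1)%E ->
  let k := c * (k1 + k2) in
  [/\ {ae nu, forall xi, edge_mean u (mkseq xi n) @[n --> \oo] --> trace u xi},
      (\int[nu]_xi (Phi (`|trace u xi| * k^-1))%:E <= 1)%E &
      (besov_energy theta p l Phi nu (fun xi => (trace u xi / k)%R) <= 1)%E].
Proof.
have [b1 [b2 [b10 b20 nub]]] := ahlfors_cylinder K2 eps0 nuA.
have [c1 c10 h1] := energy_limit_bound (l := l) K2 eps0 q1 hPhi Nq Ntheta b10 b20 nub.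
have [c2 c20 h2] := trace_energy_bound (l := l) K2 eps0 Kbeta C0 q1 hPhi b20 nub.
exists (c1 * c2); first exact: mulr_gt0.
move=> u g k1 k2 mu_u ug k10 k20 uk gk /=.
have k0 : 0 < k1 + k2 by rewrite addr_gt0.
have kp : 0 < c2 * (k1 + k2) by rewrite mulr_gt0.
have E1 := h2 u g k1 k2 mu_u ug k10 k20 uk gk.
set W := (fun w => _) in E1.
have Woo : (@increment_energy R K eps N l Phi nu W < +oo)%E.
  by rewrite (le_lt_trans E1)// ltry.
have cv : {ae nu, forall xi, edge_mean u (mkseq xi n) @[n --> \oo] --> trace u xi}.
  apply: (aeS (increment_tail_ae eps0 q1 hPhi Nq nub Woo)) => xi.
  move=> /increment_tail_cvg /cvg_ex[r hr].
  have hr' : edge_mean u (mkseq xi n) @[n --> \oo] --> r * (c2 * (k1 + k2)).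
    rewrite (_ : (fun n => edge_mean u (mkseq xi n)) =
      (fun n => W (mkseq xi n) * (c2 * (k1 + k2)))); last first.
      by apply/funext => n; rewrite /W divfK// gt_eqF.
    by apply: cvgM => //; exact: cvg_cst.
  by rewrite (word_limitE hr' : trace u xi = _).
have mf : measurable_fun setT (fun xi : bdry => trace u xi / (c2 * (k1 + k2))).
  by apply: measurable_funM => //; exact: measurable_trace.
have W0 : W [::] = 0 by rewrite /W /edge_mean mul0r.
have Wf : {ae nu, forall xi, W (mkseq xi n) @[n --> \oo] --> trace u xi / (c2 * (k1 + k2))}.
  by apply: (aeS cv) => xi h; apply: cvgM => //; exact: cvg_cst.
have [_ i1 i2] := h1 W _ W0 E1 mf Wf.
split => //.
- apply: le_trans i1; rewrite le_eqVlt; apply/orP; left; apply/eqP.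
  apply: eq_integral => xi _; rewrite normrM [`|_^-1|]gtr0_norm ?invr_gt0//.
  by congr (Phi _)%:E; field; rewrite !gt_eqF.
- apply: le_trans i2; rewrite le_eqVlt; apply/orP; left; apply/eqP; congr besov_energy.
  by apply/funext => xi; field; rewrite !gt_eqF.
Qed.

Lemma sobolev_witness u : fs_mem (f := sobolev) u ->
  exists g k1 k2, [/\ measurable_fun setT u, upper_gradient eps u g, 0 < k1, 0 < k2 &
    (\int[mu]_x (Phi (`|u x| * k1^-1))%:E <= 1)%E /\
    (\int[mu]_x er_map Phi (`|g x| * (k2^-1)%:E) <= 1)%E].
Proof.
move=> [[mu_u _]]; rewrite /= /sobolev_norm => h.
have i0 : (0 <= ereal_inf [set luxemburg Phi mu g | g in upper_gradient eps u])%E.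
  by apply: le_ereal_inf_tmp => _ [g _ <-]; exact: luxemburg_ge0.
have l0 := luxemburg_ge0 Phi mu (EFin \o u).
have /luxemburg_lty[k1 k10 h1] : (luxemburg Phi mu (EFin \o u) < +oo)%E.
  by apply: le_lt_trans h; rewrite leeDl.
have /ereal_inf_lt[_ [g ug <-] /luxemburg_lty[k2 k20 h2]] :
    (ereal_inf [set luxemburg Phi mu g | g in upper_gradient eps u] < +oo)%E.
  by apply: le_lt_trans h; rewrite leeDr.
by exists g, k1, k2; split.
Qed.

Lemma trace_ae u : fs_mem (f := sobolev) u ->
  {ae nu, forall xi, edge_mean u (mkseq xi n) @[n --> \oo] --> trace u xi}.
Proof.
move=> /sobolev_witness[g [k1 [k2 [mu_u ug k10 k20 [h1 h2]]]]].
by have [c c0 /(_ u g k1 k2 mu_u ug k10 k20 h1 h2)[]] := trace_bound.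
Qed.

Lemma sobolev_integrable u w : fs_mem (f := sobolev) u ->
  mu.-integrable (edge w) (EFin \o u).
Proof.
move=> /sobolev_witness[g [k1 [k2 [mu_u ug k10 k20 [h1 h2]]]]].
have muoo := mu_tree_finite (l := l) (beta_gt0 K2 Kbeta) C0 (ltnW K2) Kbeta.
apply: (integrableS measurableT) => //; first exact: measurable_edge.
apply: (growth_integrable q1 hPhi (a := k1^-1)) => //; first by rewrite invr_gt0.
by apply: (le_lt_trans h1); rewrite ltry.
Qed.

Lemma besov_norm_le (f : bdry -> R) (k : R) : 0 < k ->
  (\int[nu]_xi (Phi (`|f xi| * k^-1))%:E <= 1)%E ->
  (besov_energy theta p l Phi nu (fun xi => (f xi / k)%R) <= 1)%E ->
  (besov_norm f <= (2 * k)%:E)%E.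
Proof.
move=> k0 h1 h2; rewrite /besov_norm (_ : 2 * k = k + k); last by ring.
rewrite EFinD; apply: leeD; first exact: luxemburg_le.
by apply: ereal_inf_lbound; exists k.
Qed.

Lemma trace_bounded_linear : bounded_linear (Y := sobolev) (Z := besov) trace.
Proof.
have [c c0 hc] := trace_bound.
split.
- move=> u /sobolev_witness[g [k1 [k2 [mu_u ug k10 k20 [h1 h2]]]]].
  have k0 : 0 < c * (k1 + k2) by rewrite mulr_gt0// addr_gt0.
  have [_ i1 i2] := hc u g k1 k2 mu_u ug k10 k20 h1 h2.
  split; last first.
    by apply: le_lt_trans (besov_norm_le k0 i1 i2) _; rewrite ltry.
  split; first exact: measurable_trace.
  exists (c * (k1 + k2))^-1; first by rewrite invr_gt0.
  under eq_integral do rewrite mulrC.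
  by apply: (le_lt_trans i1); rewrite ltry.
- move=> u v hu hv /= uv.
  have [_ [_ [_ [mu_u _ _ _ _]]]] := sobolev_witness hu.
  have [_ [_ [_ [mv_v _ _ _ _]]]] := sobolev_witness hv.
  (* Edge means do not see null sets, so the two traces agree at every ray. *)
  apply: aeW => xi; rewrite /trace /word_limit; congr (fine (limn_esup _)); apply/funext => n.
  congr EFin; rewrite /edge_mean; case: (mkseq xi n) => [//|a s].
  by apply: mean_ae_eq => //; [exact: measurable_edge|exact: measurable_funTS..].
(* An upper limit is not additive; linearity is read off at the rays where both sequences of edge
   means converge. *)
- move=> a u v hu hv /=; apply: (aeS2 (trace_ae hu) (trace_ae hv)) => xi cu cv.
  apply: word_limitE.
  rewrite (_ : (fun n => _) = (fun n => a * edge_mean u (mkseq xi n) + edge_mean v (mkseq xi n))).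
    by apply: cvgD => //; apply: cvgM => //; exact: cvg_cst.
  apply/funext => n; rewrite /edge_mean; case: (mkseq xi n) => [|b s].
    by rewrite mulr0 addr0.
  by apply: mean_linear; [exact: measurable_edge|exact: sobolev_integrable..].
(* The factor 2 arises because one scale bounds both summands of the Besov norm. *)
exists (2 * c) => u hu.
have c2 : 0 < 2 * c by rewrite mulr_gt0.
rewrite /= /sobolev_norm; apply: le_scaled_ereal_inf_add => //.
- by move=> _ [k [k0 _] <-]; rewrite lee_fin ltW.
- by move=> _ [g _ <-]; exact: luxemburg_ge0.
move=> _ _ [k1 [k10 h1] <-] [g ug <-].
(* With g fixed, the inner infimum over k2 remains; k1 is written as the infimum of a singleton so
   that the same lemma applies. *)
rewrite -[X in (_ * (X + _))%E]ereal_inf1; apply: le_scaled_ereal_inf_add => //.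
- by move=> _ ->; rewrite lee_fin ltW.
- by move=> _ [k [k0 _] <-]; rewrite lee_fin ltW.
move=> _ _ -> [k2 [k20 h2] <-].
have [_ [_ [_ [mu_u _ _ _ _]]]] := sobolev_witness hu.
have [_ i1 i2] := hc u g k1 k2 mu_u ug k10 k20 h1 h2.
have k0 : 0 < c * (k1 + k2) by rewrite mulr_gt0// addr_gt0.
apply: (le_trans (besov_norm_le k0 i1 i2)).
by rewrite -EFinD -EFinM lee_fin mulrA.
Qed.

End trace.

(** * Extension *)

Lemma longest_common_prefix (T : eqType) (s t : seq T) :
  exists w, [/\ prefix w s, prefix w t &
    forall v, prefix v s -> prefix v t -> prefix v w].
Proof.
elim: s t => [|a s IH] [|b t]; try by exists [::]; split => //; case.
have [->|ab] := eqVneq a b.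
  have [w [ws wt wmax]] := IH t; exists (b :: w); split; rewrite /= ?eqxx//.
  by case=> [//|c v] /=; case: eqP => //= _; exact: wmax.
exists [::]; split => //; case=> [//|c v] /= /andP[/eqP -> _] /andP[/eqP ba _].
by rewrite ba eqxx in ab.
Qed.

Section interpolation.
Context {R : realType} {K : nat} {eps : R}.
Hypothesis eps0 : 0 < eps.
Local Notation tree := (tree R K).
Local Notation len := (@tree_length R K).
Variable F : seq (label K) -> R.
Implicit Types (w : seq (label K)) (x y z b v : tree).

Definition interpolate x : R := F (mother (tip x)) +
  (height x - (size (tip x)).-1%:R) * (F (tip x) - F (mother (tip x))).

(** The slope with respect to |x| divided by e^(- eps |w|), the smallest density of ds_X on the
    edge: a gradient constant on each edge. *)
Definition edge_slope x : R :=
  `|F (tip x) - F (mother (tip x))| * expR (eps * (size (tip x))%:R).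

Lemma measurable_tip (psi : seq (label K) -> R) :
  measurable_fun setT (fun x : tree => psi (tip x)).
Proof.
move=> _ Y mY; rewrite setTI.
rewrite (_ : _ @^-1` Y = \bigcup_w (if `[< Y (psi w) >] then edge w else set0)).
  apply: countable_bigcupT_measurable => // w.
  by case: ifP => // _; exact: measurable_edge.
apply/seteqP; split => x /=.
  by move=> Yx; exists (tip x) => //; rewrite asboolT.
by move=> [w _]; case: ifP => // /asboolP Yw; rewrite /edge/= => ->.
Qed.

Lemma measurable_interpolate : measurable_fun setT interpolate.
Proof.
apply: measurable_funD; first exact: (measurable_tip (F \o @mother K)).
apply: measurable_funM.
  apply: measurable_funB; first exact: measurable_height.
  exact: (measurable_tip (fun w => (size w).-1%:R)).
exact: (measurable_tip (fun w => F w - F (mother w))).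
Qed.

Lemma measurable_edge_slope : measurable_fun setT edge_slope.
Proof. exact: (measurable_tip (fun w => `|F w - F (mother w)| * expR (eps * (size w)%:R))). Qed.

Lemma edge_slope_ge0 x : 0 <= edge_slope x.
Proof. by rewrite mulr_ge0 ?expR_ge0. Qed.

Lemma interpolate_vertex w : interpolate (vertex R w) = F w.
Proof.
rewrite /interpolate /tip /height/=; case: w => [|a s].
  by rewrite /mother/= !subrr mul0r addr0.
by rewrite /= -natr1 addrAC subrr add0r mul1r addrC subrK.
Qed.

Let weighted z : \bar R := ((edge_slope z)%:E * (expR (- eps * height z))%:E)%E.

Let weighted_ge0 z : (0 <= weighted z)%E.
Proof. by rewrite mule_ge0 ?lee_fin ?expR_ge0 ?edge_slope_ge0. Qed.

Let measurable_weighted D : measurable_fun D weighted.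
Proof.
apply: measurable_funTS; apply: emeasurable_funM.
  by apply/measurable_EFinP; exact: measurable_edge_slope.
apply/measurable_EFinP; apply: measurableT_comp => //.
by apply: measurable_funM => //; exact: measurable_height.
Qed.

Lemma edge_piece_slope w (a c : R) : 0 <= a -> (size w)%:R <= a + 1 -> a <= c ->
  c <= (size w)%:R ->
  (((c - a) * `|F w - F (mother w)|)%:E <= \int[len]_(z in edge_piece w a c) weighted z)%E.
Proof.
move=> a0 wa ac cw; have mp := measurable_edge_piece (R := R) w a c.
rewrite mulrC EFinM -(tree_length_piece a0 wa ac cw) -integral_cst//.
apply: ge0_le_integral => //; first by move=> z _; rewrite lee_fin.
move=> z [zw /andP[_ zc]]; rewrite /weighted /edge_slope zw -EFinM lee_fin.
rewrite -mulrA -expRD ler_peMr// -[leLHS]expR0 ler_expR mulNr -mulrBr.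
by apply: mulr_ge0; [exact: ltW|rewrite subr_ge0; exact: le_trans cw].
Qed.

(** For an ancestor b of z this is the half-open geodesic ]b, z]; leaving out b makes pieces meeting
    at b disjoint. *)
Definition segment b z : set tree := [set v | ancestor v z /\ height b < height v].

Lemma measurable_segment b z : measurable (segment b z).
Proof.
rewrite (_ : segment b z =
  [set v | prefix (tip v) (tip z)] `&` (@height R K @^-1` `]height b, height z]%classic)).
  apply: measurableI; last first.
    by rewrite -[X in measurable X]setTI; exact: measurable_height.
  rewrite (_ : mkset _ = \bigcup_(w in [set: seq (label K)]) (if prefix w (tip z) then edge w else set0)).
    apply: (@countable_bigcupT_measurable _ tree) => // w.
    by case: ifP => // _; exact: measurable_edge.
  apply/seteqP; split => v /=.
    by move=> vz; exists (tip v) => //; rewrite vz.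
  by move=> [w _]; case: ifP => // wz; rewrite /edge/= => ->.
apply/seteqP; split => v; rewrite /segment /ancestor /= in_itv/=.
  by move=> [[-> ->] ->].
by move=> [-> /andP[-> ->]].
Qed.

(** Induction on the number of edges: the segment is cut at the upper endpoint of the edge carrying
    z, where the interpolation takes the vertex value. *)
Lemma segment_slope b z : ancestor b z ->
  (`|interpolate z - interpolate b|%:E <= \int[len]_(v in segment b z) weighted v)%E.
Proof.
have [n] := ubnP (size (tip z)); elim: n z => // n IH z zn bz.
have [hz0 hz1 hz2] := tree_heightP z; have [hb0 hb1 hb2] := tree_heightP b.
have [bzp bzh] := bz; set w := tip z.
have [bw|bw] := eqVneq (tip b) w.
  have -> : interpolate z - interpolate b = (height z - height b) * (F w - F (mother w)).
    by rewrite /interpolate bw -/w; ring.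
  rewrite normrM ger0_norm ?subr_ge0//.
  apply: (le_trans (@edge_piece_slope w (height b) (height z) hb0 _ bzh hz1)).
    by rewrite ltW// -bw.
  apply: ge0_subset_integral => //; first exact: measurable_edge_piece.
    exact: measurable_segment.
  move=> v [vw /andP[bv vz]]; split => //; split => //.
  by rewrite vw prefix_refl.
have sbw : (size (tip b) < size w)%N.
  rewrite ltn_neqAle size_prefix// andbT; apply: contra bw => /eqP sb.
  by move: bzp; rewrite prefixE sb take_size eq_sym.
have w0 : (0 < size w)%N by exact: leq_ltn_trans sbw.
have sw : size (mother w) = (size w).-1 by rewrite size_mother.
have s1 : (size w)%:R = (size w).-1%:R + 1 :> R by rewrite natr1 (prednK w0).
pose m := vertex R (mother w).
have bm : ancestor b m.
  split; rewrite /m /tip /height/=.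
    have : (size (tip b) <= size (mother w))%N by rewrite sw -ltnS (prednK w0).
    move: bzp; rewrite !prefixE /mother -/(tip b) => /eqP bzp sb.
    by rewrite take_takel -/w ?bzp//; move: sb; rewrite size_takel// leq_pred.
  by rewrite (le_trans hb1)// ler_nat sw -ltnS (prednK w0).
have hm : height m = (size w).-1%:R by rewrite /m /height/= sw.
have IHm := IH m _ bm; rewrite interpolate_vertex in IHm.
have {}IHm : (`|F (mother w) - interpolate b|%:E <= \int[len]_(v in segment b m) weighted v)%E.
  by apply: IHm; rewrite /m /tip/= sw -ltnS (prednK w0).
have hzw : (size w).-1%:R <= height z by rewrite -(lerD2r 1) -s1 ltW.
have pz := @edge_piece_slope w (size w).-1%:R (height z) _ _ hzw hz1.
have {}pz : (`|interpolate z - F (mother w)|%:E <=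
   \int[len]_(v in edge_piece w (size w).-1%:R (height z)) weighted v)%E.
  apply: le_trans (pz _ _) => //; last by rewrite s1.
  by rewrite /interpolate -/w addrAC subrr add0r normrM ger0_norm ?subr_ge0.
have mS := measurable_segment b m.
have mP := @measurable_edge_piece R K w (size w).-1%:R (height z).
apply: (@le_trans _ _ (`|interpolate z - F (mother w)|%:E + `|F (mother w) - interpolate b|%:E)%E).
  by rewrite -EFinD lee_fin (le_trans _ (ler_normD _ _))// addrA subrK.
apply: (le_trans (leeD pz IHm)).
rewrite -ge0_integral_setU//; last first.
  rewrite disj_set2E; apply/eqP/seteqP; split => // v [[vw _] [[vm _] _]].
  have := size_prefix vm; rewrite vw /m/= /tip/= sw.
  by rewrite -ltnS (prednK w0) ltnn.
apply: ge0_subset_integral => //; first exact: measurableU.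
  exact: measurable_segment.
move=> v [[vw /andP[v1 v2]]|[[vm vh] vb]].
  split; first by split => //; rewrite vw prefix_refl.
  by apply: le_lt_trans v1; rewrite (le_trans hb1)// ler_nat -ltnS (prednK w0).
split => //; split.
  by rewrite (prefix_trans vm)// prefix_mother.
by rewrite (le_trans vh)// hm.
Qed.

Lemma branch_point x y : exists b, [/\ ancestor b x, ancestor b y &
  forall v, ancestor v x -> ancestor v y -> ancestor v b].
Proof.
have [w [wx wy wmax]] := longest_common_prefix (tip x) (tip y).
have [hx0 hx1 hx2] := tree_heightP x; have [hy0 hy1 hy2] := tree_heightP y.
(* The branch point may lie inside an edge when one point is an ancestor of the other. All three
   entries exceed size w - 1, so (w, h) is a valid code. *)
pose h := Num.min (Num.min (height x) (height y)) (size w)%:R.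
have swx : (size w)%:R <= (size (tip x))%:R :> R by rewrite ler_nat size_prefix.
have swy : (size w)%:R <= (size (tip y))%:R :> R by rewrite ler_nat size_prefix.
have hw : tree_code (w, h).
  apply/and3P; split => /=.
  - by rewrite !le_min hx0 hy0/=.
  - by rewrite ge_min lexx orbT.
  - rewrite -ltrBlDr !lt_min !ltrBlDr ltrDl ltr01 andbT.
    by rewrite (le_lt_trans swx)//= (le_lt_trans swy).
exists (TreePoint hw); split.
- by split => //; rewrite /height/= !ge_min lexx.
- by split => //; rewrite /height/= !ge_min lexx orbT.
move=> v [vx hvx] [vy hvy]; split; first exact: wmax.
rewrite /height/= !le_min -/(height v) hvx hvy/=.
have [_ hv _] := tree_heightP v; rewrite (le_trans hv)// ler_nat.
by apply: size_prefix; exact: wmax.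
Qed.

(** The geodesic is split at the branch point b; ]b, x] and ]b, y] are disjoint since a common point
    would be an ancestor of b. *)
Lemma upper_gradient_interpolate :
  upper_gradient eps interpolate (fun x => (edge_slope x)%:E).
Proof.
split.
- by apply/measurable_EFinP; exact: measurable_edge_slope.
- by move=> x; rewrite lee_fin edge_slope_ge0.
move=> x y; have [b [bx by_ bmax]] := branch_point x y.
have mx := measurable_segment b x; have my := measurable_segment b y.
apply: (@le_trans _ _ (`|interpolate x - interpolate b|%:E + `|interpolate y - interpolate b|%:E)%E).
  rewrite -EFinD lee_fin [X in _ <= _ + X]distrC (le_trans _ (ler_normD _ _))//.
  by rewrite addrA subrK.
apply: (le_trans (leeD (segment_slope bx) (segment_slope by_))).
rewrite -ge0_integral_setU//; last first.
  rewrite disj_set2E; apply/eqP/seteqP; split => // v [[vx bv] [vy _]].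
  by have [_] := bmax v vx vy; rewrite leNgt bv.
rewrite /path_integral; apply: ge0_subset_integral => //.
- exact: measurableU.
- exact: measurable_geodesic.
move=> v [[vx bv]|[vy bv]]; split; [by left| |by right|] => c cx cy;
  have [_ cb] := bmax c cx cy.
  by apply: (ancestor_chain cx vx); rewrite (le_trans cb)// ltW.
by apply: (ancestor_chain cy vy); rewrite (le_trans cb)// ltW.
Qed.

Lemma interpolate_edge w x n : size w = n.+1 -> edge w x ->
  exists2 s, 0 <= s <= 1 & interpolate x = (1 - s) * F (mother w) + s * F w.
Proof.
move=> wn xw; have xn : size (tip x) = n.+1 by rewrite (xw : tip x = w).
have /andP[h1 h2] := height_edge xn.
exists (height x - n%:R).
  by rewrite subr_ge0 (ltW h1)/= lerBlDr addrC natr1.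
by rewrite /interpolate (xw : tip x = w) wn/=; ring.
Qed.

End interpolation.

(** * Modular bounds for the extension *)

Section extension.
Context {R : realType} {K : nat} {eps beta C l q A theta p : R} {Phi : R -> R}.
Hypotheses (K2 : (2 <= K)%N) (eps0 : 0 < eps) (Kbeta : ln K%:R < beta) (C0 : 0 < C).
Hypotheses (q1 : 1 <= q) (hPhi : power_growth q A Phi).
Local Notation tree := (tree R K).
Local Notation bdry := (@boundary R K eps).
Local Notation mu := (@mu_tree R K beta C l).
Local Notation N := (beta - ln K%:R).
Hypothesis Ntheta : eps * (theta - 1) * p = - N.
Variable nu : {measure set bdry -> \bar R}.
Hypothesis nuA : ahlfors_regular (ln K%:R / eps) nu.
Implicit Types (w : seq (label K)) (f : bdry -> R).
Local Notation sobolev_norm := (@sobolev_norm R K eps beta C l Phi).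
Local Notation besov_norm := (@besov_norm R K eps theta p l Phi nu).
Local Notation sobolev := (@orlicz_sobolev R K eps beta C l Phi).
Local Notation besov := (@orlicz_besov R K eps theta p l Phi nu).
Local Notation energy := (@besov_energy R K eps theta p l Phi nu).

Definition extend f : tree -> R := interpolate (cylinder_mean nu f).

Lemma ahlfors_setT_lty : (nu setT < +oo)%E.
Proof.
have [b1 [b2 [b10 b20 nub]]] := ahlfors_cylinder K2 eps0 nuA.
exact: nu_setT_lty nub.
Qed.

Lemma ahlfors_cylinder_gt0 w : (0 < nu (cylinder w))%E.
Proof.
have [b1 [b2 [b10 b20 nub]]] := ahlfors_cylinder K2 eps0 nuA.
exact: nu_cylinder_gt0 b10 nub w.
Qed.

Lemma besov_integrable f : fs_mem (f := besov) f -> nu.-integrable setT (EFin \o f).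
Proof.
move=> [[mf [a a0 h]] _]; apply: (growth_integrable q1 hPhi a0) => //.
  exact: ahlfors_setT_lty.
by under eq_integral do rewrite mulrC.
Qed.

(** The counterpart of [nu_cylinder_level], from the lower Ahlfors bound: it converts integrals over
    edges back into boundary sums. *)
Lemma mu_tree_edge_nu : exists2 D, 0 < D & forall w n, size w = n.+1 ->
  (mu (edge w) <= (D * level_weight N l n)%:E * nu (cylinder w))%E.
Proof.
have [b1 [b2 [b10 b20 nub]]] := ahlfors_cylinder K2 eps0 nuA.
have [a1 [a2 [a10 a20 ha]]] := mu_tree_edge (K := K) (beta_gt0 K2 Kbeta) C0 (l := l).
have K0 : 0 < K%:R :> R by rewrite ltr0n ltnW.
exists (a2 * K%:R / b1); first by rewrite divr_gt0// mulr_gt0.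
move=> w n wn; have [/andP[_ h] _] := ha w n wn; apply: (le_trans h).
have /andP[h1 _] := nub w.
have D0 : (0 <= (a2 * K%:R / b1 * level_weight N l n)%:E)%E.
  rewrite lee_fin; apply: mulr_ge0; last by rewrite ltW// level_weight_gt0.
  by apply: divr_ge0; [apply: mulr_ge0 => //; exact: ltW|exact: ltW].
apply: le_trans (lee_wpmul2l D0 h1); rewrite -EFinM lee_fin wn.
rewrite (_ : level_weight beta l n = expR (- ln K%:R * n%:R) * level_weight N l n); last first.
  by rewrite level_weight_shift subrK.
have -> : expR (- ln K%:R * n.+1%:R) = expR (- ln K%:R * n%:R) / K%:R :> R.
  rewrite -natr1 mulrDr mulr1 expRD; congr (_ * _).
  by rewrite expRN lnK ?posrE.
by rewrite le_eqVlt; apply/orP; left; apply/eqP; field; rewrite !gt_eqF.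
Qed.

(** The series is reindexed to start at 0; the choice of theta enters through eps (theta - 1) p = -
    N. *)
Lemma besov_energy_shift f : energy f = (\sum_(n <oo) (expR (- N) * level_weight N l n)%:E *
  \sum_(w : n.+1.-tuple (label K)) nu (cylinder w) *
     (Phi (`|cylinder_mean nu f w - cylinder_mean nu f (mother w)| / expR (- eps * n.+1%:R)))%:E)%E.
Proof.
rewrite /besov_energy -nneseries_addn; last first.
  move=> n; apply: mule_ge0; first by rewrite lee_fin mulr_ge0 ?expR_ge0 ?powR_ge0.
  by apply: sume_ge0 => w _; rewrite mule_ge0// lee_fin (growth_ge0 hPhi).
apply: eq_eseriesr => n _; rewrite addn1; congr (_%:E * _)%E.
rewrite /level_weight mulrA -expRD; congr (expR _ * _).
rewrite (_ : eps * n.+1%:R * (theta - 1) * p = (eps * (theta - 1) * p) * n.+1%:R); last by ring.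
by rewrite Ntheta -natr1; ring.
Qed.

Lemma cylinder_mean_growth f (k1 c : R) w :
  nu.-integrable setT (EFin \o f) -> 0 < k1 -> 2 <= c ->
  ((Phi (`|cylinder_mean nu f w| * (c * k1)^-1))%:E * nu (cylinder w) <=
   (2 * A ^+ 2 / c)%:E * \int[nu]_(xi in cylinder w) (Phi (`|f xi| * k1^-1))%:E)%E.
Proof.
move=> fi k10 c2; have A0 := growth_const_gt0 hPhi.
have c0 : 0 < c by apply: lt_le_trans c2.
have mI := measurable_cylinder eps0 w.
have nuoo := ahlfors_setT_lty.
have Ioo := cylinder_lty eps0 nuoo w.
have mf : measurable_fun [set: bdry] f by apply/measurable_EFinP; case/integrableP: fi.
pose F (xi : bdry) := (`|f xi| * k1^-1)%:E.
have mF : measurable_fun (cylinder w : set bdry) F.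
  apply: measurable_funTS; apply/measurable_EFinP; apply: measurable_funM => //.
  exact: measurableT_comp.
have F0 xi : (0 <= F xi)%E by rewrite lee_fin mulr_ge0// invr_ge0 ltW.
pose t := `|cylinder_mean nu f w| * k1^-1 / 2.
have t0 : 0 <= t by rewrite divr_ge0// mulr_ge0// invr_ge0 ltW.
have tI : ((2 * t)%:E * nu (cylinder w) <= \int[nu]_(xi in cylinder w) F xi)%E.
  rewrite /F; under eq_integral do rewrite EFinM.
  rewrite ge0_integralZr//; last 2 first.
  - by apply: measurable_funTS; do 2 apply: measurableT_comp => //.
  - by rewrite lee_fin invr_ge0 ltW.
  rewrite (_ : 2 * t = `|cylinder_mean nu f w| * k1^-1); last by rewrite /t; field; rewrite gt_eqF.
  rewrite EFinM muleAC lee_wpmul2r// ?lee_fin ?invr_ge0 ?(ltW k10)//.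
  have := cylinder_mean_dev eps0 nuoo 0 fi (ahlfors_cylinder_gt0 w).
  rewrite subr0 => /le_trans; apply.
  rewrite le_eqVlt; apply/orP; left; apply/eqP.
  by apply: eq_integral => xi _; rewrite subr0.
have hJ := @growth_jensen _ _ _ _ q1 hPhi _ bdry nu _ _ mI mF (fun xi _ => F0 xi) t t0 Ioo tI.
rewrite (_ : `|cylinder_mean nu f w| * (c * k1)^-1 = 2 / c * t); last first.
  by rewrite /t; field; rewrite !gt_eqF.
have r01 : 0 <= 2 / c <= 1 by rewrite divr_ge0 ?(ltW c0)//= ler_pdivrMr// mul1r.
have c20 : (0 <= (A * (2 / c))%:E)%E.
  by rewrite lee_fin mulr_ge0 ?(ltW A0)//; case/andP: r01.
apply: (@le_trans _ _ ((A * (2 / c))%:E * ((Phi t)%:E * nu (cylinder w)))%E).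
  rewrite muleA -EFinM lee_wpmul2r// lee_fin.
  exact: (growth_contract q1 hPhi).
apply: (le_trans (lee_wpmul2l c20 hJ)).
rewrite muleA -EFinM (_ : A * (2 / c) * A = 2 * A ^+ 2 / c)//.
by field; rewrite gt_eqF.
Qed.

(** For the function: on an edge it lies between two cylinder means, whose modulars sum to a bounded
    quantity at each level by Jensen, and the level weights are summable as N > 0. For the slope:
    its modular over an edge is controlled by the matching term of the Besov energy. *)
Lemma extend_bound : exists2 c, 0 < c & forall f k1 k2,
  nu.-integrable setT (EFin \o f) -> 0 < k1 -> 0 < k2 ->
  (\int[nu]_xi (Phi (`|f xi| * k1^-1))%:E <= 1)%E ->
  (energy (fun xi => (f xi / k2)%R) <= 1)%E ->
  (\int[mu]_x (Phi (`|extend f x| * (c * k1)^-1))%:E <= 1)%E /\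
  (\int[mu]_x (Phi (edge_slope (eps := eps) (cylinder_mean nu f) x * (c * k2)^-1))%:E <= 1)%E.
Proof.
have A0 := growth_const_gt0 hPhi; have A1 := growth_const_ge1 hPhi.
have K0 : 0 < K%:R :> R by rewrite ltr0n ltnW.
have [D D0 hD] := mu_tree_edge_nu.
have N0 : 0 < N by rewrite subr_gt0.
have lw0 n : (0 <= (level_weight N l n)%:E)%E by rewrite lee_fin ltW// level_weight_gt0.
have SN0 : (0 <= \sum_(n <oo) (level_weight N l n)%:E)%E.
  by apply: nneseries_ge0 => n _ _; exact: lw0.
have := level_weight_summable l N0.
move E : (\sum_(n <oo) (level_weight N l n)%:E)%E SN0 => [SN| |]// SN0 _.
rewrite lee_fin in SN0.
(* [SN] is the total level weight and 1 + K counts each cylinder as child and as mother; in [T1],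
   e^N undoes the factor e^(- N) of the shifted energy. *)
pose T0 := A * D * (2 * A ^+ 2) * (1 + K%:R) * SN.
pose T1 := A * D * expR N.
have T00 : 0 <= T0.
  apply: mulr_ge0 => //; apply: mulr_ge0; last by rewrite addr_ge0// ltW.
  by apply: mulr_ge0; [apply: mulr_ge0; exact: ltW|rewrite mulr_ge0// sqr_ge0].
have T10 : 0 < T1 by rewrite /T1 mulr_gt0 ?expR_gt0// mulr_gt0.
pose c := 2 + T0 + T1.
have c2 : 2 <= c by rewrite /c; lra.
have c0 : 0 < c by apply: lt_le_trans c2.
exists c => // f k1 k2 fi k10 k20 fk fe.
have ck1 : 0 < c * k1 by rewrite mulr_gt0.
have ck2 : 0 < c * k2 by rewrite mulr_gt0.
have mPhi : measurable_fun setT Phi by case: hPhi.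
have Phi0 (r : R) : (0 <= (Phi r)%:E)%E by rewrite lee_fin (growth_ge0 hPhi).
have mur := mu_tree_root (K := K) (beta := beta) (C := C) (l := l).
pose F := cylinder_mean nu f.
have nuw w : nu (cylinder w) \is a fin_num.
  by rewrite ge0_fin_numE// (cylinder_lty eps0 ahlfors_setT_lty).
split.
  have mf : measurable_fun [set: bdry] f by apply/measurable_EFinP; case/integrableP: fi.
  pose G w := (\int[nu]_(xi in cylinder w) (Phi (`|f xi| * k1^-1))%:E)%E.
  have G0 w : (0 <= G w)%E by exact: integral_ge0.
  have GS n : (\sum_(w : n.-tuple (label K)) G w <= 1)%E.
    rewrite -(integral_cylinder eps0 nu n (f := fun xi => (Phi (`|f xi| * k1^-1))%:E))//.
    apply/measurable_EFinP; apply: measurableT_comp => //; apply: measurable_funM => //.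
    exact: measurableT_comp.
  have mI : measurable_fun setT (fun x : tree => (Phi (`|extend f x| * (c * k1)^-1))%:E).
    apply/measurable_EFinP; apply: measurableT_comp => //; apply: measurable_funM => //.
    by apply: measurableT_comp => //; exact: measurable_interpolate.
  rewrite (integral_tree mur)//.
  pose c3 := A * D * (2 * A ^+ 2 / c).
  have c30 : 0 <= c3.
    apply: mulr_ge0; first by apply: mulr_ge0; exact: ltW.
    by apply: divr_ge0; [rewrite mulr_ge0// sqr_ge0|exact: ltW].
  have onedge n (w : n.+1.-tuple (label K)) :
    (\int[mu]_(x in edge w) (Phi (`|extend f x| * (c * k1)^-1))%:E <=
     (c3 * level_weight N l n)%:E * (G w + G (mother w)))%E.
    have wn := size_tuple w; have mw := @measurable_edge R K w.
    pose P1 := Phi (`|F w| * (c * k1)^-1); pose P2 := Phi (`|F (mother w)| * (c * k1)^-1).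
    have P10 : 0 <= P1 by exact: growth_ge0 hPhi _.
    have P20 : 0 <= P2 by exact: growth_ge0 hPhi _.
    (* Phi need not be convex, so the value is compared with the larger of the two endpoint values,
       through almost monotonicity alone. *)
    have pw x : edge w x -> Phi (`|extend f x| * (c * k1)^-1) <= A * (P1 + P2).
      move=> xw; rewrite /extend -/F; have [s /andP[s0 s1] ->] := interpolate_edge F wn xw.
      have i0 : 0 <= (c * k1)^-1 by rewrite invr_ge0 ltW.
      have tri : `|(1 - s) * F (mother w) + s * F w| <=
          (1 - s) * `|F (mother w)| + s * `|F w|.
        by rewrite (le_trans (ler_normD _ _))// !normrM ger0_norm ?subr_ge0// (ger0_norm s0).
      have [FF|FF] := leP `|F w| `|F (mother w)|.
        apply: (@le_trans _ _ (A * P2)); last by rewrite ler_wpM2l ?(ltW A0)// lerDr.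
        apply: (growth_mono q1 hPhi); rewrite mulr_ge0//= ler_wpM2r// (le_trans tri)//.
        apply: (@le_trans _ _ ((1 - s) * `|F (mother w)| + s * `|F (mother w)|)).
          by rewrite lerD2l ler_wpM2l.
        by rewrite -mulrDl subrK mul1r.
      apply: (@le_trans _ _ (A * P1)); last by rewrite ler_wpM2l ?(ltW A0)// lerDl.
      apply: (growth_mono q1 hPhi); rewrite mulr_ge0//= ler_wpM2r// (le_trans tri)//.
      apply: (@le_trans _ _ ((1 - s) * `|F w| + s * `|F w|)).
        by rewrite lerD2r ler_wpM2l ?subr_ge0// ltW.
      by rewrite -mulrDl subrK mul1r.
    apply: (@le_trans _ _ ((A * (P1 + P2))%:E * mu (edge w))%E).
      rewrite -integral_cst//; apply: ge0_le_integral => //.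
      exact: measurable_funTS.
    have AP0 : (0 <= (A * (P1 + P2))%:E)%E.
      by rewrite lee_fin mulr_ge0 ?(ltW A0)// addr_ge0.
    apply: (le_trans (lee_wpmul2l AP0 (hD w n wn))).
    have g1 := cylinder_mean_growth w fi k10 c2.
    have g2 := cylinder_mean_growth (mother w) fi k10 c2.
    have P12 : ((P1 + P2)%:E * nu (cylinder w) <= (2 * A ^+ 2 / c)%:E * (G w + G (mother w)))%E.
      rewrite EFinD ge0_muleDl ?lee_fin// ge0_muleDr//; apply: leeD => //.
      apply: le_trans g2; apply: lee_wpmul2l; first by rewrite lee_fin.
      exact: le_nu_cylinder_mother.
    have AD0 : (0 <= (A * D * level_weight N l n)%:E)%E.
      by rewrite lee_fin; apply: mulr_ge0; [apply: mulr_ge0; exact: ltW|rewrite ltW// level_weight_gt0].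
    have := lee_wpmul2l AD0 P12.
    rewrite !muleA -!EFinM => h.
    rewrite (_ : A * (P1 + P2) * (D * level_weight N l n) = A * D * level_weight N l n * (P1 + P2)); last by ring.
    apply: (le_trans h); rewrite le_eqVlt; apply/orP; left; apply/eqP.
    by congr (_%:E * _)%E; rewrite /c3; field; rewrite gt_eqF.
  apply: (@le_trans _ _ (\sum_(n <oo) (c3 * (1 + K%:R))%:E * (level_weight N l n)%:E)%E).
    apply: lee_nneseries => [n _ _|n _].
      by apply: sume_ge0 => w _; exact: integral_ge0.
    apply: (@le_trans _ _ (\sum_(w : n.+1.-tuple (label K))
       (c3 * level_weight N l n)%:E * (G w + G (mother w)))%E).
      by apply: lee_sum => w _; exact: onedge.
    rewrite -ge0_sume_distrr; last by move=> w _; exact: adde_ge0.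
    rewrite big_split/= (sum_mother K2)//.
    have cl0 : (0 <= (c3 * level_weight N l n)%:E)%E.
      by rewrite lee_fin mulr_ge0// ltW// level_weight_gt0.
    have S1 : (\sum_(w : n.+1.-tuple (label K)) G w + K%:R%:E * \sum_(v : n.-tuple (label K)) G v
        <= (1 + K%:R)%:E)%E.
      rewrite EFinD; apply: leeD; first exact: GS.
      by rewrite -[leRHS]mule1; apply: lee_wpmul2l; [rewrite lee_fin|exact: GS].
    apply: (le_trans (lee_wpmul2l cl0 S1)).
    by rewrite -!EFinM lee_fin mulrAC.
  rewrite nneseriesZl; last by move=> n _; exact: lw0.
  rewrite E -EFinM lee_fin.
  rewrite (_ : c3 * (1 + K%:R) * SN = T0 / c); last by rewrite /c3 /T0; field; rewrite gt_eqF.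
  by rewrite ler_pdivrMr// mul1r /c; lra.
have mS : measurable_fun setT (fun x : tree => (Phi (edge_slope (eps := eps) F x * (c * k2)^-1))%:E).
  apply/measurable_EFinP; apply: measurableT_comp => //; apply: measurable_funM => //.
  exact: measurable_edge_slope.
rewrite (integral_tree mur)//.
pose Q n w := Phi (`|cylinder_mean nu (fun xi => f xi / k2) w -
  cylinder_mean nu (fun xi => f xi / k2) (mother w)| / expR (- eps * n.+1%:R)).
apply: (@le_trans _ _ (\sum_(n <oo) (T1 / c)%:E * ((expR (- N) * level_weight N l n)%:E *
  \sum_(w : n.+1.-tuple (label K)) nu (cylinder w) * (Q n w)%:E))%E); last first.
  rewrite nneseriesZl; last first.
    move=> n _; rewrite mule_ge0//; first by rewrite lee_fin mulr_ge0 ?expR_ge0// ltW// level_weight_gt0.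
    by apply: sume_ge0 => w _; rewrite mule_ge0// Phi0.
  rewrite -besov_energy_shift.
  apply: (@le_trans _ _ ((T1 / c)%:E * 1)%E).
    by apply: lee_wpmul2l => //; rewrite lee_fin divr_ge0// ltW.
  by rewrite mule1 lee_fin ler_pdivrMr// mul1r /c; lra.
apply: lee_nneseries => [n _ _|n _].
  by apply: sume_ge0 => w _; exact: integral_ge0.
rewrite muleA -EFinM ge0_sume_distrr; last by move=> w _; rewrite mule_ge0// Phi0.
apply: lee_sum => w _; have wn := size_tuple w; have mw := @measurable_edge R K w.
pose s := `|F w - F (mother w)| * expR (eps * n.+1%:R) / k2.
have s0 : 0 <= s by rewrite divr_ge0 ?mulr_ge0 ?expR_ge0// ltW.
have Qs : Q n w = Phi s.
  rewrite /Q !(cylinder_meanZ eps0)// -mulrBl normrM [`|k2^-1|]gtr0_norm ?invr_gt0//.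
  by rewrite mulNr expRN invrK mulrAC.
rewrite Qs.
apply: (@le_trans _ _ ((A / c * Phi s)%:E * mu (edge w))%E).
  rewrite -integral_cst//; apply: ge0_le_integral => //.
  - exact: measurable_funTS.
  move=> x xw; rewrite lee_fin /edge_slope (xw : tip x = w) wn.
  rewrite (_ : _ * (c * k2)^-1 = c^-1 * s); last by rewrite /s; field; rewrite !gt_eqF.
  apply: (growth_contract q1 hPhi) => //.
  by rewrite invr_ge0 (ltW c0)/= invf_le1// (le_trans _ c2)// ler1n.
have AP0 : (0 <= (A / c * Phi s)%:E)%E.
  by rewrite lee_fin mulr_ge0 ?(growth_ge0 hPhi)// divr_ge0// ltW.
apply: (le_trans (lee_wpmul2l AP0 (hD w n wn))).
rewrite muleA -EFinM [X in (_ <= _ * X)%E]muleC muleA -EFinM lee_wpmul2r// lee_fin /T1.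
rewrite le_eqVlt; apply/orP; left; apply/eqP.
have -> : expR (- N) = (expR N)^-1 by rewrite expRN.
by field; rewrite !gt_eqF ?expR_gt0.
Qed.

End extension.

(** * Differentiation along cylinders *)

Section cylinder_differentiation.
Context {R : realType} {K : nat} {eps : R}.
Hypotheses (K2 : (2 <= K)%N) (eps0 : 0 < eps).
Local Notation bdry := (@boundary R K eps).
Variable nu : {measure set bdry -> \bar R}.
Hypotheses (nuoo : (nu setT < +oo)%E) (nu0 : forall w, (0 < nu (cylinder w))%E).
Implicit Types (w v : seq (label K)) (f h : bdry -> R).

Lemma cylinder_nil : cylinder [::] = [set: ray K].
Proof. by apply/seteqP; split. Qed.

Lemma cylinder_rcons v : cylinder v =
  \big[setU/set0]_(i <- index_enum (label K)) cylinder (rcons v i).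
Proof.
apply/seteqP; split => xi; rewrite -bigcup_seq.
  move=> xiv; exists (xi (size v)); first by rewrite /= mem_index_enum.
  by rewrite /cylinder/= size_rcons mkseqS (xiv : mkseq _ _ = v).
move=> [i _]; rewrite /cylinder/= size_rcons mkseqS => /rcons_inj[-> _].
by [].
Qed.

Lemma integral_cylinder_rcons f v : measurable_fun setT f ->
  (\int[nu]_(xi in cylinder v) (f xi)%:E =
   \sum_(i : label K) \int[nu]_(xi in cylinder (rcons v i)) (f xi)%:E)%E.
Proof.
move=> mf; rewrite {1}cylinder_rcons integral_bigsetU_EFin//.
- by move=> i; exact: measurable_cylinder.
- exact: index_enum_uniq.
- move=> i j _ _ [xi [xii xij]]; suff /rcons_inj[] : rcons v i = rcons v j by [].
  by rewrite -(xii : mkseq _ _ = _) -[RHS](xij : mkseq _ _ = _) !size_rcons.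
- by rewrite -cylinder_rcons; apply: measurable_funTS; exact/measurable_EFinP.
Qed.

(** Dynkin's argument: the sets over which f integrates to 0 form a Dynkin class containing the
    cylinders, hence all Borel sets. *)
Lemma integral_cylinder_eq0 f : nu.-integrable setT (EFin \o f) ->
  (forall w, \int[nu]_(xi in cylinder w) (f xi)%:E = 0)%E ->
  {ae nu, forall xi, f xi = 0}.
Proof.
move=> fi f0; have mf : measurable_fun setT (EFin \o f) by case/integrableP: fi.
(* Two cylinders are nested or disjoint, so adjoining the empty set makes the family stable under
   intersection. *)
pose G : set (set bdry) := [set B | B = set0 \/ exists w, B = cylinder w].
have GE : @measurable _ bdry = <<s G >>.
  rewrite (measurable_cylinderE eps0); apply/seteqP; split; apply: smallest_sub.
  - exact: smallest_sigma_algebra.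
  - by move=> _ [w _ <-]; apply: sub_sigma_algebra; right; exists w.
  - exact: smallest_sigma_algebra.
  - move=> _ [->|[w ->]]; last by apply: sub_sigma_algebra; exists w.
    by have [] := smallest_sigma_algebra [set: ray K] (range (@cylinder K)).
have GI : setI_closed G.
  have cap v w : (size v <= size w)%N -> G (cylinder v `&` cylinder w).
    move=> vw; have [wv|wv] := eqVneq (take (size v) w) v.
      right; exists w; apply/seteqP; split => xi [] // xiw.
      by split => //; rewrite /cylinder/= (mkseq_take _ vw) (xiw : mkseq _ _ = w).
    left; apply/seteqP; split => // xi [xiv xiw].
    move/eqP: wv; apply; rewrite -{1}(xiw : mkseq _ _ = w) -mkseq_take//.
  move=> A B [->|[v ->]] [->|[w ->]]; rewrite ?set0I ?setI0; [by left..|].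
  by have [vw|/ltnW wv] := leqP (size v) (size w); [exact: cap|rewrite setIC; exact: cap].
pose P (S : set bdry) := (\int[nu]_(xi in S) (f xi)%:E = 0)%E.
have PT : P setT by rewrite /P -cylinder_nil f0.
have PS S : <<s G >> S -> P S.
  apply: (dynkin_induction (T := bdry) (P := P)) => //.
  - by move=> _ [->|[w ->]]; rewrite /P ?integral_set0.
  - move=> B mB PB.
    have := @integral_setU _ _ _ nu B (~` B) (EFin \o f) mB (measurableC mB).
    rewrite setUv => /(_ mf); rewrite disj_set2E setICr eqxx => /(_ isT).
    rewrite -[LHS]/(\int[nu]_(xi in setT) (f xi)%:E)%E (PT : _ = _) => h.
    by rewrite /P; move: h; rewrite -[X in (_ = X + _)%E]/(\int[nu]_(xi in B) (f xi)%:E)%E PB add0e.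
  - move=> B mB tB PB; rewrite /P integral_bigcup//.
      by apply: eseries0 => i _ _; exact: PB.
    apply: (integrableS measurableT) fi => //.
    exact: bigcup_measurable.
have : ae_eq nu setT (EFin \o f) (cst 0%E).
  apply: integral_ae_eq => // E _ mE.
  by rewrite integral0; apply: PS; rewrite -GE.
by move=> h; apply: (aeS h) => xi /(_ I) [].
Qed.

(** The martingale property of the means: the induction splits v into its children, and n = 0 is the
    definition of the mean. *)
Lemma integral_cylinder_mean f v n : nu.-integrable setT (EFin \o f) ->
  (\int[nu]_(xi in cylinder v) (cylinder_mean nu f (mkseq xi (n + size v)))%:E =
   \int[nu]_(xi in cylinder v) (f xi)%:E)%E.
Proof.
move=> fi; have mf : measurable_fun [set: bdry] f by apply/measurable_EFinP; case/integrableP: fi.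
elim: n v => [|n IH] v.
  rewrite add0n; transitivity (\int[nu]_(xi in cylinder v) (cylinder_mean nu f v)%:E)%E.
    by apply: eq_integral => xi; rewrite inE => xiv; rewrite (xiv : mkseq _ _ = v).
  rewrite integral_cst; last exact: measurable_cylinder.
  have voo := cylinder_lty eps0 nuoo v.
  have vf : nu (cylinder v) \is a fin_num by rewrite ge0_fin_numE.
  have fvi := integrable_cylinder eps0 v fi.
  have fvf : (\int[nu]_(xi in cylinder v) (f xi)%:E)%E \is a fin_num.
    by apply: integrable_fin_num => //; exact: measurable_cylinder.
  rewrite -(fineK vf) -(fineK fvf) -EFinM /cylinder_mean mulrC mulVKf//.
  by rewrite gt_eqF// fine_gt0// nu0 voo.
rewrite integral_cylinder_rcons; last exact: (measurable_mkseq eps0).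
rewrite integral_cylinder_rcons//; apply: eq_bigr => i _.
by rewrite -IH size_rcons addSnnS.
Qed.

(** The integrable tail serves twice: its finiteness gives pointwise limits, and, added to |F [::]|,
    it dominates all the means, which allows the limit under the integral. *)
Lemma cylinder_mean_cvg f : nu.-integrable setT (EFin \o f) ->
  nu.-integrable setT (increment_tail (cylinder_mean nu f) 0) ->
  {ae nu, forall xi, cylinder_mean nu f (mkseq xi n) @[n --> \oo] --> f xi}.
Proof.
move=> fi ti; set F := cylinder_mean nu f in ti *.
have mf : measurable_fun [set: bdry] f by apply/measurable_EFinP; case/integrableP: fi.
pose h : bdry -> R := word_limit F.
have mh : measurable_fun setT h by exact: measurable_word_limit.
have tae : {ae nu, forall xi, (increment_tail F 0 xi < +oo)%E}.
  apply: (aeS (integrable_ae measurableT ti)) => xi /(_ I).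
  by rewrite ge0_fin_numE// increment_tail_ge0.
have cv : {ae nu, forall xi, F (mkseq xi n) @[n --> \oo] --> h xi}.
  apply: (aeS tae) => xi /increment_tail_cvg /cvg_ex[r hr].
  by rewrite /h (word_limitE hr).
have mF n : measurable_fun [set: bdry] (fun xi => (F (mkseq xi n))%:E).
  by apply/measurable_EFinP; exact: (measurable_mkseq eps0).
pose g (xi : bdry) := (`|F [::]|%:E + increment_tail F 0 xi)%E.
have gi : nu.-integrable setT g.
  have ci : nu.-integrable setT (EFin \o cst `|F [::]|) by exact: integrable_fin_cst.
  exact: (integrableD measurableT ci ti).
have dom n xi : (`|(F (mkseq xi n))%:E| <= g xi)%E.
  apply: (@le_trans _ _ (`|F [::]|%:E + \sum_(0 <= m < n) (increment F (0 + m) xi)%:E)%E).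
    rewrite sumEFin -EFinD lee_fin.
    have := @telescope_sumr R 0 n (fun m => F (mkseq xi m)) (leq0n _).
    rewrite [mkseq xi 0]/= => h1.
    rewrite -[X in `|X|](subrK (F [::])) addrC (le_trans (ler_normD _ _))// lerD2l -h1.
    by apply: (le_trans (ler_norm_sum _ _ _)).
  by rewrite leeD2lE//; apply: nneseries_lim_ge => m _ _; rewrite lee_fin increment_ge0.
have hint v : (\int[nu]_(xi in cylinder v) (h xi)%:E = \int[nu]_(xi in cylinder v) (f xi)%:E)%E.
  have mv := measurable_cylinder eps0 v.
  have mFv n : measurable_fun (cylinder v : set bdry) (fun xi => (F (mkseq xi n))%:E).
    by apply: measurable_funTS; exact: mF.
  have mhv : measurable_fun (cylinder v : set bdry) (fun xi => (h xi)%:E).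
    by apply: measurable_funTS; exact/measurable_EFinP.
  have cvv : {ae nu, forall xi, cylinder v xi -> (F (mkseq xi n))%:E @[n --> \oo] --> (h xi)%:E}.
    by apply: (aeS cv) => xi hx _; apply: cvg_EFin => //; exact: nearW.
  have giv : nu.-integrable (cylinder v) g by exact: (integrableS measurableT).
  have domv : {ae nu, forall xi n, cylinder v xi -> (`|(F (mkseq xi n))%:E| <= g xi)%E}.
    by apply: aeW => xi n _.
  have [_ _ lim] := dominated_convergence mv mFv mhv cvv giv domv.
  (* From n = size v on, the integrals of the means over the cylinder are constant, equal to that of
     f. *)
  apply: cvg_unique lim _ => //; apply: cvg_near_cst.
  near=> n; have vn : (size v <= n)%N by near: n; exists (size v).
  by rewrite /= -(subnK vn); exact: integral_cylinder_mean.
have hi : nu.-integrable setT (EFin \o h).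
  have mFT n : measurable_fun [set: bdry] (fun xi => (F (mkseq xi n))%:E) by exact: mF.
  have mhT : measurable_fun [set: bdry] (fun xi => (h xi)%:E) by exact/measurable_EFinP.
  have cvT : {ae nu, forall xi, [set: bdry] xi -> (F (mkseq xi n))%:E @[n --> \oo] --> (h xi)%:E}.
    by apply: (aeS cv) => xi hx _; apply: cvg_EFin => //; exact: nearW.
  have domT : {ae nu, forall xi n, [set: bdry] xi -> (`|(F (mkseq xi n))%:E| <= g xi)%E}.
    by apply: aeW => xi n _.
  by have [] := dominated_convergence measurableT mFT mhT cvT gi domT.
have fh0 : {ae nu, forall xi, f xi - h xi = 0}.
  apply: integral_cylinder_eq0.
    by have := integrableB measurableT fi hi.
  move=> w; have mw := measurable_cylinder eps0 w.
  have fw := integrable_cylinder eps0 w fi; have hw := integrable_cylinder eps0 w hi.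
  have := integralB_EFin mw fw hw; rewrite hint subee//.
  exact: (integrable_fin_num mw fw).
by apply: (aeS2 cv fh0) => xi + /eqP; rewrite subr_eq0 => + /eqP ->.
Unshelve. all: by end_near.
Qed.

End cylinder_differentiation.

Section integrable_subset.
Context d (T : measurableType d) (R : realType) (m : {measure set T -> \bar R}).
Import HBNNSimple.

(** D is arbitrary, so this applies directly to the balls in [locally_L1]; the integral over D is
    that of the restriction, a supremum over fewer simple functions. *)
Lemma integrable_subset (D : set T) (f : T -> \bar R) :
  m.-integrable setT f -> m.-integrable D f.
Proof.
move=> /integrableP[mf foo]; apply/integrableP; split; first exact: measurable_funTS.
apply: le_lt_trans foo; rewrite integral_mkcond !ge0_integralTE//; last first.
  by move=> x; exact: erestrict_ge0.
apply: ereal_sup_le => _ [h hf <-]; exists h => // x; apply: (le_trans (hf x)).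
by rewrite /patch; case: ifP => _; rewrite ?abse_ge0.
Qed.

End integrable_subset.

(** * The extension operator as a right inverse of the trace *)

Section extension_operator.
Context {R : realType} {K : nat} {eps beta C l q A theta p : R} {Phi : R -> R}.
Hypotheses (K2 : (2 <= K)%N) (eps0 : 0 < eps) (Kbeta : ln K%:R < beta) (C0 : 0 < C).
Hypotheses (q1 : 1 <= q) (hPhi : power_growth q A Phi).
Local Notation tree := (tree R K).
Local Notation bdry := (@boundary R K eps).
Local Notation mu := (@mu_tree R K beta C l).
Local Notation N := (beta - ln K%:R).
Hypotheses (Nq : N < q * eps) (Ntheta : eps * (theta - 1) * p = - N).
Variable nu : {measure set bdry -> \bar R}.
Hypothesis nuA : ahlfors_regular (ln K%:R / eps) nu.
Implicit Types (w : seq (label K)) (f : bdry -> R).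
Local Notation sobolev_norm := (@sobolev_norm R K eps beta C l Phi).
Local Notation besov_norm := (@besov_norm R K eps theta p l Phi nu).
Local Notation sobolev := (@orlicz_sobolev R K eps beta C l Phi).
Local Notation besov := (@orlicz_besov R K eps theta p l Phi nu).
Local Notation energy := (@besov_energy R K eps theta p l Phi nu).
Local Notation extend := (@extend R K eps nu).
Local Notation edge_mean := (@edge_mean R K beta C l).

Lemma besov_witness f : fs_mem (f := besov) f -> exists k1 k2, [/\ 0 < k1, 0 < k2,
  (\int[nu]_xi (Phi (`|f xi| * k1^-1))%:E <= 1)%E &
  (energy (fun xi => (f xi / k2)%R) <= 1)%E].
Proof.
move=> [_]; rewrite /= /besov_norm => h.
set B := ereal_inf _ in h.
have i0 : (0 <= B)%E by apply: le_ereal_inf_tmp => _ [k [k0 _] <-]; rewrite lee_fin ltW.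
have l0 := luxemburg_ge0 Phi nu (EFin \o f).
have /luxemburg_lty[k1 k10 h1] : (luxemburg Phi nu (EFin \o f) < +oo)%E.
  by apply: le_lt_trans h; rewrite leeDl.
have /ereal_inf_lt[_ [k2 [k20 h2] <-] _] : (B < +oo)%E.
  by apply: le_lt_trans h; rewrite leeDr.
by exists k1, k2; split.
Qed.

Lemma sobolev_norm_extend_le f (c k1 k2 : R) : 0 < c -> 0 < k1 -> 0 < k2 ->
  (\int[mu]_x (Phi (`|extend f x| * (c * k1)^-1))%:E <= 1)%E ->
  (\int[mu]_x (Phi (edge_slope (eps := eps) (cylinder_mean nu f) x * (c * k2)^-1))%:E <= 1)%E ->
  (sobolev_norm (extend f) <= c%:E * (k1%:E + k2%:E))%E.
Proof.
move=> c0 k10 k20 h1 h2; rewrite -EFinD -EFinM mulrDr EFinD; apply: leeD.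
  by apply: luxemburg_le => //; rewrite mulr_gt0.
apply: ge_ereal_inf; exists (luxemburg Phi mu (fun x => (edge_slope (eps := eps) (cylinder_mean nu f) x)%:E)).
  by exists (fun x => (edge_slope (eps := eps) (cylinder_mean nu f) x)%:E) => //; exact: upper_gradient_interpolate.
apply: luxemburg_le; first by rewrite mulr_gt0.
apply: le_trans h2; rewrite le_eqVlt; apply/orP; left; apply/eqP.
by apply: eq_integral => x _; rewrite /= ger0_norm// edge_slope_ge0.
Qed.

Lemma interpolate_linear (F G : seq (label K) -> R) a (x : tree) :
  interpolate (fun w => a * F w + G w) x = a * interpolate F x + interpolate G x.
Proof. by rewrite /interpolate; ring. Qed.

Lemma extend_bounded_linear : bounded_linear (Y := besov) (Z := sobolev) extend.
Proof.
have [c c0 hc] := extend_bound (l := l) K2 eps0 Kbeta C0 q1 hPhi Ntheta nuA.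
have bint := @besov_integrable R K eps l q A theta p Phi K2 eps0 q1 hPhi nu nuA.
have muoo := mu_tree_finite (l := l) (beta_gt0 K2 Kbeta) C0 (ltnW K2) Kbeta.
split.
- move=> f hf; have [k1 [k2 [k10 k20 h1 h2]]] := besov_witness hf.
  have [i1 i2] := hc f k1 k2 (bint _ hf) k10 k20 h1 h2.
  split; last first.
    by apply: le_lt_trans (sobolev_norm_extend_le c0 k10 k20 i1 i2) _; rewrite -EFinD -EFinM ltry.
  have mE : measurable_fun setT (extend f) by exact: measurable_interpolate.
  split => // x; exists 1 => //; apply: integrable_subset.
  apply: (growth_integrable q1 hPhi (a := (c * k1)^-1)) => //.
    by rewrite invr_gt0 mulr_gt0.
  by apply: (le_lt_trans i1); rewrite ltry.
- move=> f g hf hg /= fg; apply: aeW => x; rewrite /extend; congr interpolate.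
  apply/funext => w; apply: (mean_ae_eq (m := nu)) => //.
  + exact: measurable_cylinder.
  + by apply: measurable_funTS; case: hf => -[].
  + by apply: measurable_funTS; case: hg => -[].
- move=> a f g hf hg; apply: aeW => x; rewrite -interpolate_linear; congr interpolate.
  apply/funext => w; apply: (mean_linear (m := nu)).
  + exact: measurable_cylinder.
  + by apply: integrable_cylinder => //; exact: bint.
  + by apply: integrable_cylinder => //; exact: bint.
exists c => f hf; rewrite /= /besov_norm; apply: le_scaled_ereal_inf_add => //.
- by move=> _ [k [k0 _] <-]; rewrite lee_fin ltW.
- by move=> _ [k [k0 _] <-]; rewrite lee_fin ltW.
move=> _ _ [k1 [k10 h1] <-] [k2 [k20 h2] <-].
have [i1 i2] := hc f k1 k2 (bint _ hf) k10 k20 h1 h2.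
exact: sobolev_norm_extend_le.
Qed.

(** The Besov energy scales the increment from level n to n + 1 by e^(eps (n + 1)),
    [increment_energy] by the smaller e^(eps n); almost monotonicity costs A and the shift of
    weights costs e^N. *)
Lemma besov_increment_energy f (k2 : R) : nu.-integrable setT (EFin \o f) -> 0 < k2 ->
  (energy (fun xi => (f xi / k2)%R) <= 1)%E ->
  (@increment_energy R K eps N l Phi nu (cylinder_mean nu (fun xi => (f xi / k2)%R)) < +oo)%E.
Proof.
move=> fi k20 fe; have A0 := growth_const_gt0 hPhi.
pose f' xi := f xi / k2; set F := cylinder_mean nu _.
rewrite (increment_energy_words (l := l) (beta := beta) eps0 hPhi).
apply: (@le_lt_trans _ _ ((A * expR N)%:E * energy f')%E); last first.
  apply: (@le_lt_trans _ _ ((A * expR N)%:E * 1)%E); last by rewrite mule1 ltry.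
  by apply: lee_wpmul2l => //; rewrite lee_fin mulr_ge0 ?expR_ge0// ltW.
have Phi0 (r : R) : (0 <= (Phi r)%:E)%E by rewrite lee_fin (growth_ge0 hPhi).
rewrite (besov_energy_shift (q := q) (A := A) hPhi Ntheta) -nneseriesZl; last first.
  move=> n _; rewrite mule_ge0//; first by rewrite lee_fin mulr_ge0 ?expR_ge0// ltW// level_weight_gt0.
  by apply: sume_ge0 => w _; rewrite mule_ge0// Phi0.
apply: lee_nneseries => [n _ _|n _].
  rewrite mule_ge0//; first by rewrite lee_fin ltW// level_weight_gt0.
  by apply: sume_ge0 => w _; rewrite mule_ge0// Phi0.
rewrite muleA -EFinM (_ : A * expR N * _ = level_weight N l n * A); last first.
  by rewrite expRN; field; rewrite gt_eqF ?expR_gt0.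
rewrite (EFinM (level_weight N l n) A) -muleA; apply: lee_wpmul2l; first by rewrite lee_fin ltW// level_weight_gt0.
rewrite ge0_sume_distrr; last by move=> w _; rewrite mule_ge0// Phi0.
apply: lee_sum => w _; rewrite [X in (_ <= _ * X)%E]muleC muleA -EFinM.
apply: lee_wpmul2r => //; rewrite lee_fin; apply: (growth_mono q1 hPhi).
rewrite mulr_ge0 ?expR_ge0//= mulrC ler_wpM2l// mulNr expRN invrK ler_expR.
by rewrite ler_pM2l// ler_nat.
Qed.

(** On an edge the extension stays within |F w - F (mother w)| of F w, and so does its mean. Along
    almost every ray the means F converge to f, so these differences tend to 0. *)
Lemma trace_extend f : fs_mem (f := besov) f ->
  {ae nu, forall xi, trace (beta := beta) (C := C) (l := l) (extend f) xi = f xi}.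
Proof.
move=> hf; have [k1 [k2 [k10 k20 h1 h2]]] := besov_witness hf.
have fi : nu.-integrable setT (EFin \o f) by exact: (besov_integrable K2 eps0 q1 hPhi nuA hf).
have muoo := mu_tree_finite (l := l) (beta_gt0 K2 Kbeta) C0 (ltnW K2) Kbeta.
have [a1 [a2 [a10 a20 ha]]] := mu_tree_edge (K := K) (beta_gt0 K2 Kbeta) C0 (l := l).
have [b1 [b2 [b10 b20 nub]]] := ahlfors_cylinder K2 eps0 nuA.
(* The energy is known to be finite only at the scale k2; convergence is proved for f / k2 and
   scaled back. *)
pose f' xi := f xi / k2.
have fi' : nu.-integrable setT (EFin \o f').
  by have := integrableZr measurableT k2^-1 fi.
have Eoo := besov_increment_energy fi k20 h2.
have ti := increment_tail_integrable eps0 q1 hPhi Nq nub Eoo.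
have cv := cylinder_mean_cvg eps0 (ahlfors_setT_lty K2 eps0 nuA)
  (ahlfors_cylinder_gt0 K2 eps0 nuA) fi' ti.
pose F := cylinder_mean nu f.
have Ei : mu.-integrable setT (EFin \o extend f).
  have [c c0 hc] := extend_bound (l := l) K2 eps0 Kbeta C0 q1 hPhi Ntheta nuA.
  have [i1 _] := hc f k1 k2 fi k10 k20 h1 h2.
  apply: (growth_integrable q1 hPhi (a := (c * k1)^-1)) => //.
  - by rewrite invr_gt0 mulr_gt0.
  - exact: measurable_interpolate.
  - by apply: (le_lt_trans i1); rewrite ltry.
have dev w n : size w = n.+1 ->
    `|edge_mean (extend f) w - F w| <= `|F w - F (mother w)|.
  move=> wn; rewrite (_ : edge_mean _ w = mean mu (edge w) (extend f)); last first.
    by case: w wn.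
  apply: mean_dev_le.
  - exact: measurable_edge.
  - exact: integrable_subset.
  - have [/andP[h _] _] := ha w n wn; rewrite (lt_le_trans _ h)/=; last first.
      by rewrite lte_fin mulr_gt0// level_weight_gt0.
    by apply: le_lt_trans muoo; apply: le_measure; rewrite ?inE//; exact: measurable_edge.
  move=> x xw; rewrite /extend -/F; have [s /andP[s0 s1] ->] := interpolate_edge F wn xw.
  rewrite (_ : _ - F w = (s - 1) * (F w - F (mother w))); last by ring.
  by rewrite normrM ler_piMl// distrC ger0_norm ?subr_ge0// gerBl.
apply: (aeS cv) => xi hxi; apply: word_limitE.
have Fcv : F (mkseq xi n) @[n --> \oo] --> f xi.
  rewrite (_ : (fun n => F (mkseq xi n)) = (fun n => cylinder_mean nu f' (mkseq xi n) * k2)); last first.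
    by apply/funext => n; rewrite (cylinder_meanZ eps0)// divfK// gt_eqF.
  rewrite (_ : f xi = f' xi * k2); last by rewrite divfK// gt_eqF.
  by apply: cvgM => //; exact: cvg_cst.
have Fcv1 : F (mkseq xi n.+1) @[n --> \oo] --> f xi by rewrite (cvg_shiftS (fun n => F (mkseq xi n))).
have inc0 : `|F (mkseq xi n.+1) - F (mkseq xi n)| @[n --> \oo] --> (0 : R).
  rewrite -(normr0 R) -(subrr (f xi)); apply: cvg_norm; exact: cvgB.
have dif : edge_mean (extend f) (mkseq xi n.+1) - F (mkseq xi n.+1) @[n --> \oo] --> (0 : R).
  apply: norm_cvg0.
  apply: (squeeze_cvgr _ (cvg_cst 0) inc0); apply: nearW => n; rewrite normr_ge0/=.
  have := dev (mkseq xi n.+1) n; rewrite size_mkseq => /(_ erefl).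
  by rewrite mother_mkseq.
rewrite -(cvg_shiftS (fun n => edge_mean (extend f) (mkseq xi n))).
rewrite (_ : [sequence _]_n = (fun n => (edge_mean (extend f) (mkseq xi n.+1) -
  F (mkseq xi n.+1)) + F (mkseq xi n.+1))); last first.
  by apply/funext => n; rewrite subrK.
by rewrite -[f xi]add0r; exact: cvgD.
Qed.

End extension_operator.

Theorem theorem1p1 (R : realType) (K : nat)
    (eps beta C p lambda1 lambda2 : R)
    (nu : {measure set (boundary K eps) -> \bar R}) :
  (2 <= K)%N ->
  0 < eps ->
  ln K%:R < beta ->
  Num.max (2 * `|lambda2| / (beta - ln K%:R)) (2 * ln 4 / eps) <= C ->
  1 < p \/ (p = 1 /\ 0 <= lambda1) ->
  ahlfors_regular (ln K%:R / eps) nu ->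
  0 < (beta - ln K%:R) / eps < p ->
  is_trace_space
    (orlicz_besov (1 - (beta - ln K%:R) / (eps * p)) p lambda2
       (Phi_log p lambda1) nu)
    (orlicz_sobolev K eps beta C lambda2 (Phi_log p lambda1)).
Proof.
move=> K2 eps0 Kbeta hC hp nuA /andP[_ Np].
have C0 : 0 < C.
  apply: lt_le_trans hC; rewrite lt_max; apply/orP; right.
  by rewrite divr_gt0// mulr_gt0// ln_gt0// ltr1n.
have p0 : 0 < p by case: hp => [|[-> _]] //; exact: lt_trans.
(* The strict inequality (beta - ln K) / eps < p is spent here, to obtain N < q eps. *)
have [q [A [q1 Nq hPhi]]] := Phi_log_exponent hp Np.
rewrite ltr_pdivrMr// in Nq.
set theta := 1 - _.
have Ntheta : eps * (theta - 1) * p = - (beta - ln K%:R).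
  by rewrite /theta; field; rewrite !gt_eqF.
exists (trace (beta := beta) (C := C) (l := lambda2)), (extend nu); split.
- exact: (trace_bounded_linear K2 eps0 Kbeta C0 q1 hPhi Nq Ntheta nuA).
- exact: (extend_bounded_linear K2 eps0 Kbeta C0 q1 hPhi Ntheta nuA).
- by move=> f; exact: (trace_extend K2 eps0 Kbeta C0 q1 hPhi Nq Ntheta nuA).
Qed.
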